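(* Let $1<p<\infty$ and $u\in A_\infty$. Given a pair of weights $(u,v)$, suppose that for some $r>1$ there is a constant $C_0<\infty$ such that for all cubes $Q$, $$\left(\frac{1}{|Q|}\int_Q u(x)^r\,dx\right)^{1/(rp)}\left(\frac{1}{|Q|}\int_Q v(x)^{-p'/p}\,dx\right)^{1/p'}\leq C_0 .$$ If $\psi$ satisfies the $\mathcal D_\kappa$ condition with $0\leq\kappa<1$, then every $\theta$-type Calderón–Zygmund operator $T_\theta$ is bounded from $\mathcal M^{p,\psi}(v,u)$ into $W\mathcal M^{p,\psi}(u)$, i.e. there is $C>0$ such that $\|T_\theta f\|_{W\mathcal M^{p,\psi}(u)}\leq C\|f\|_{\mathcal M^{p,\psi}(v,u)}$ for all $f\in\mathcal M^{p,\psi}(v,u)$.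
   Context: Operators. Let $\theta:(0,\infty)\to[0,\infty)$ be non-decreasing with $\int_0^1\frac{\theta(t)}{t}\,dt<\infty$. A measurable function $K$ on $\mathbb R^n\times\mathbb R^n\setminus\{(x,x):x\in\mathbb R^n\}$ is a $\theta$-type kernel if for some constant $C>0$: (i) $|K(x,y)|\leq C|x-y|^{-n}$ for $x\neq y$; (ii) $|K(x,y)-K(z,y)|+|K(y,x)-K(y,z)|\leq C|x-y|^{-n}\,\theta\big(\frac{|x-z|}{|x-y|}\big)$ whenever $|x-z|<|x-y|/2$. A linear operator $T_\theta$ from $\mathscr S(\mathbb R^n)$ into $\mathscr S'(\mathbb R^n)$ is a $\theta$-type Calderón–Zygmund operator if (1) it extends to a bounded linear operator on $L^2(\mathbb R^n)$, and (2) there is a $\theta$-type kernel $K$ with $T_\theta f(x)=\int_{\mathbb R^n}K(x,y)f(y)\,dy$ for all $f\in C_0^\infty(\mathbb R^n)$ and all $x\notin\operatorname{supp}f$. For compactly supported $g\in L^1(\mathbb R^n)$, $T_\theta g$ is defined through the continuous (weak type $(1,1)$) extension of $T_\theta$ to $L^1(\mathbb R^n)$. For $f$ in a Morrey type space, $T_\theta f$ is defined on each cube $Q$ by $T_\theta f(x)=T_\theta(f\chi_{2Q})(x)+\int_{(2Q)^c}K(x,y)f(y)\,dy$ for a.e. $x\in Q$, where $2Q$ is the concentric cube with twice the side length. Weights. A weight is a locally integrable function on $\mathbb R^n$ with values in $(0,\infty)$ a.e.; $u(E)=\int_E u\,dx$. $p'$ is given by $1/p+1/p'=1$. For $1<q<\infty$,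 $u\in A_q$ means that there is $C>0$ with $\big(\frac1{|B|}\int_B u\,dx\big)^{1/q}\big(\frac1{|B|}\int_B u^{-q'/q}\,dx\big)^{1/q'}\leq C$ for every ball $B$; $u\in A_1$ means $\frac1{|B|}\int_B u\,dx\leq C\,\operatorname{ess\,inf}_B u$ for every ball $B$; $A_\infty=\bigcup_{1\leq q<\infty}A_q$. All cubes $Q\subset\mathbb R^n$ have sides parallel to the coordinate axes. Spaces. For $0\leq\kappa<1$, a positive increasing (in the weak sense; $\psi\equiv1$ is allowed) function $\psi$ on $(0,\infty)$ satisfies the $\mathcal D_\kappa$ condition if there is $C>0$ with $\frac{\psi(\xi)}{\xi^\kappa}\leq C\frac{\psi(\xi')}{(\xi')^\kappa}$ for all $0<\xi'<\xi<\infty$. $\mathcal M^{p,\psi}(v,u)$ is the space of $f\in L^p_{loc}(v)$ with $\|f\|_{\mathcal M^{p,\psi}(v,u)}:=\sup_Q\big(\frac1{\psi(u(Q))}\int_Q|f(x)|^pv(x)\,dx\big)^{1/p}<\infty$ (supremum over all cubes). $W\mathcal M^{p,\psi}(u)$ is the space of measurable $f$ with $\|f\|_{W\mathcal M^{p,\psi}(u)}:=\sup_B\sup_{\sigma>0}\frac{1}{\psi(u(B))^{1/p}}\,\sigma\cdot[u(\{x\in B:|f(x)|>\sigma\})]^{1/p}<\infty$ (supremum over all balls). *)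

(* Defs.v *)
From HB Require Import structures.
From mathcomp Require Import all_boot all_order all_algebra.
From mathcomp Require Import all_classical all_reals all_analysis.
From mathcomp Require Import complex.

Set Implicit Arguments.
Unset Strict Implicit.
Unset Printing Implicit Defensive.
Import Order.TTheory GRing.Theory Num.Theory.
Import numFieldNormedType.Exports.

Local Open Scope classical_set_scope.
Local Open Scope ring_scope.

(* R^n is ['rV[R]_n], whose library norm is the sup norm; the Euclidean norm is
   [enorm] below. Weights are real valued, all other functions on R^n are
   complex valued. *)

(* The product Borel sigma-algebra on R^n, generated by the coordinates, as the
   library does for tuples. *)
Section measurable_rV.
Context (R : realType) (n : nat).

Definition rV_coord (i : 'I_n) (x : 'rV[R]_n) : measurableTypeR R := x ord0 i.

Let rV_set0 : g_sigma_preimage rV_coord set0.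
Proof. exact: sigma_algebra0. Qed.

Let rV_setC A : g_sigma_preimage rV_coord A -> g_sigma_preimage rV_coord (~` A).
Proof. exact: sigma_algebraC. Qed.

Let rV_bigcup (F : _^nat) : (forall i, g_sigma_preimage rV_coord (F i)) ->
  g_sigma_preimage rV_coord (\bigcup_i (F i)).
Proof. exact: sigma_algebra_bigcup. Qed.

HB.instance Definition _ := @isMeasurable.Build default_measure_display
  'rV[R]_n (g_sigma_preimage rV_coord) rV_set0 rV_setC rV_bigcup.

End measurable_rV.

Lemma measurable_rV_coord (R : realType) (n : nat) (i : 'I_n) :
  measurable_fun [set: 'rV[R]_n] (@rV_coord R n i).
Proof.
move=> _ Y mY; rewrite setTI; apply: sub_sigma_algebra => /=.
rewrite -bigcup_seq/=; exists i => /=; first by rewrite mem_index_enum.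
by exists Y => //; rewrite setTI.
Qed.

Lemma measurable_fun_rVP d (T : measurableType d) (R : realType) (n : nat)
    (f : T -> 'rV[R]_n) :
  (forall i, measurable_fun [set: T] (@rV_coord R n i \o f)) ->
  measurable_fun [set: T] f.
Proof.
move=> mf _ A mA; rewrite setTI; move: A mA; apply: smallest_sub.
  split => /=.
  - by rewrite preimage_set0.
  - by move=> A mA; rewrite setTD preimage_setC; exact: measurableC.
  - by move=> F mF; rewrite preimage_bigcup; exact: bigcup_measurable.
move=> A; rewrite -bigcup_seq/= => -[i _ [B mB <-]].
by rewrite setTI -comp_preimage -[X in measurable X]setTI; exact: mf.
Qed.

(* Lebesgue measure on R^n, by induction on the dimension: the image of the
   product of Lebesgue measures under (x, y) |-> row_mx x y. *)
Section lebesgue_rV.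
Context (R : realType).

Definition rV_cons (n : nat) (xy : measurableTypeR R * 'rV[R]_n) :
  'rV[R]_n.+1 := row_mx (const_mx xy.1 : 'rV_1) xy.2.

Definition rV_uncons (n : nat) (x : 'rV[R]_n.+1) :
  measurableTypeR R * 'rV[R]_n :=
  (x ord0 ord0, rsubmx (x : 'rV_(1 + n))).

Lemma rV_consK n : cancel (@rV_cons n) (@rV_uncons n).
Proof.
move=> [x y]; congr pair; last exact: row_mxKr.
have -> : (ord0 : 'I_n.+1) = lshift n (ord0 : 'I_1) by exact: val_inj.
by apply: etrans (row_mxEl _ _ _ _) _; rewrite mxE.
Qed.

Lemma measurable_rV_cons n : measurable_fun setT (@rV_cons n).
Proof.
apply: measurable_fun_rVP => i.
have [j|j] := fintype.splitP (i : 'I_(1 + n)) => ij.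
- rewrite (_ : _ \o _ = fst); first exact: measurable_fst.
  apply/funext => -[x y]; rewrite /rV_coord /=.
  have -> : i = lshift n j by exact: val_inj.
  by apply: etrans (row_mxEl _ _ _ _) _; rewrite mxE.
- rewrite (_ : _ \o _ = @rV_coord R n j \o snd).
    by apply: measurableT_comp => //; exact: measurable_rV_coord.
  apply/funext => -[x y]; rewrite /rV_coord /=.
  have -> : i = rshift 1 j by exact: val_inj.
  exact: row_mxEr.
Qed.

Lemma measurable_rV_uncons n : measurable_fun setT (@rV_uncons n).
Proof.
apply/measurable_fun_pairP; split.
- exact: (@measurable_rV_coord R n.+1 ord0).
- apply: measurable_fun_rVP => j.
  rewrite (_ : _ \o _ = @rV_coord R n.+1 (rshift 1 j)).
    exact: measurable_rV_coord.
  by apply/funext => x; rewrite /rV_coord /= mxE.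
Qed.

Section step.
Context (n : nat) (m : {sigma_finite_measure set 'rV[R]_n -> \bar R}).

Definition lebesgue_rV_step : set 'rV[R]_n.+1 -> \bar R :=
  pushforward (@lebesgue_measure R \x m)%E (@rV_cons n).

Let step0 : lebesgue_rV_step set0 = 0%E.
Proof. by rewrite /lebesgue_rV_step /pushforward preimage_set0 measure0. Qed.

Let step_ge0 A : (0 <= lebesgue_rV_step A)%E.
Proof. by rewrite /lebesgue_rV_step /pushforward measure_ge0. Qed.

Let step_sigma_additive : semi_sigma_additive lebesgue_rV_step.
Proof.
have mc A : measurable A -> measurable (@rV_cons n @^-1` A).
  by move=> mA; rewrite -[X in measurable X]setTI; exact: measurable_rV_cons.
move=> F mF tF mUF; rewrite /lebesgue_rV_step /pushforward preimage_bigcup.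
apply: measure_semi_sigma_additive.
- by move=> i; exact: mc.
- apply/trivIsetP => /= i j _ _ ij; rewrite -preimage_setI.
  by move/trivIsetP : tF => /(_ _ _ _ _ ij) ->//; rewrite preimage_set0.
- by rewrite -preimage_bigcup; exact: mc.
Qed.

HB.instance Definition _ := isMeasure.Build _ _ _ lebesgue_rV_step
  step0 step_ge0 step_sigma_additive.

Let step_sigma_finite : sigma_finite setT lebesgue_rV_step.
Proof.
have /sigma_finiteP[F [TF ndF Foo]] := sigma_finiteT (@lebesgue_measure R).
have /sigma_finiteP[G [TG ndG Goo]] := sigma_finiteT m.
exists (fun k => @rV_uncons n @^-1` (F k `*` G k)).
  rewrite -preimage_bigcup -[LHS](preimage_setT (@rV_uncons n)); congr preimage.
  rewrite -setXTT TF TG predeqE => -[x y]; split.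
    move=> [/= [i _ Fix] [k _ Gky]]; exists (maxn i k) => //; split.
    - by move: x Fix; exact/subsetPset/ndF/leq_maxl.
    - by move: y Gky; exact/subsetPset/ndG/leq_maxr.
  by move=> [k _ []/= ? ?]; split; exists k.
move=> k; have [mF Fk] := Foo k; have [mG Gk] := Goo k; split.
  rewrite -[X in measurable X]setTI.
  by apply: measurable_rV_uncons => //; exact: measurableX.
rewrite /lebesgue_rV_step /pushforward -comp_preimage.
rewrite (_ : _ \o _ = id); last by apply/funext => x; exact: rV_consK.
by rewrite preimage_id product_measure1E// lte_mul_pinfty// ge0_fin_numE.
Qed.

HB.instance Definition _ := Measure_isSigmaFinite.Build _ _ _ lebesgue_rV_step
  step_sigma_finite.

End step.

Fixpoint lebesgue_rV (n : nat) : {sigma_finite_measure set 'rV[R]_n -> \bar R} :=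
  match n with
  | 0 => dirac (0 : 'rV[R]_0)
  | n'.+1 => lebesgue_rV_step (lebesgue_rV n')
  end.

Lemma lebesgue_rV_box (n : nat) (A : 'I_n -> set (measurableTypeR R)) :
  (forall i, measurable (A i)) ->
  lebesgue_rV n [set x : 'rV[R]_n | forall i, A i (x ord0 i)] =
  (\prod_(i < n) lebesgue_measure (A i))%E.
Proof.
elim: n A => [|n IHn] A mA.
  rewrite big_ord0 /= diracE (_ : _ \in _ = true)//.
  by apply/mem_set => -[].
have mB : measurable [set x : 'rV[R]_n | forall i, A (lift ord0 i) (x ord0 i)].
  rewrite (_ : mkset _ =
      \big[setI/setT]_(i < n) (@rV_coord R n i @^-1` A (lift ord0 i))).
    apply: bigsetI_measurable => i _; rewrite -[X in measurable X]setTI.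
    exact: measurable_rV_coord.
  rewrite -bigcap_seq; apply/seteqP; split => [x Ax i _|x Ax i]; first exact: Ax.
  by apply: Ax; rewrite /= mem_index_enum.
rewrite big_ord_recl -IHn// -product_measure1E//= /lebesgue_rV_step /pushforward.
congr (_ _); apply/seteqP; split => [[x y] Axy|[x y] [/= Ax Ay] i].
- split => [|i] /=.
    have := Axy ord0.
    by rewrite -[rV_cons _ _ _]/(rV_uncons (rV_cons (x, y))).1 rV_consK.
  have := Axy (lift ord0 i).
  rewrite (_ : rV_cons _ _ _ = y ord0 i)//.
  by rewrite (_ : lift _ _ = rshift 1 i) ?[LHS]row_mxEr//; exact: val_inj.
- have [->|[j ->]] : i = ord0 \/ exists j, i = lift ord0 j.
    by case: (unliftP ord0 i) => [j ->|->]; [right; exists j|left].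
  + by rewrite -[rV_cons _ _ _]/(rV_uncons (rV_cons (x, y))).1 rV_consK.
  + have := Ay j.
    rewrite (_ : rV_cons _ _ _ = y ord0 j)//.
    by rewrite (_ : lift _ _ = rshift 1 j) ?[LHS]row_mxEr//; exact: val_inj.
Qed.

End lebesgue_rV.

Section euclidean.
Context {R : realType} {n : nat}.
Implicit Types (x y c : 'rV[R]_n) (r l : R).

Definition enorm x : R := Num.sqrt (\sum_(i < n) x ord0 i ^+ 2).

Definition eball c r : set 'rV[R]_n := [set x | enorm (x - c) < r].

(* The cube with centre c and side length l. *)
Definition cube c l : set 'rV[R]_n :=
  [set x | forall i, `|x ord0 i - c ord0 i| <= l / 2].

End euclidean.

Section complex_valued.
Context {R : realType}.

Definition cabs (z : R[i]) : R := Normc.normc z.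

Definition cmeasurable d (T : measurableType d) (D : set T) (f : T -> R[i]) :=
  measurable_fun D (fun x => complex.Re (f x)) /\
  measurable_fun D (fun x => complex.Im (f x)).

Context {n : nat}.
Local Notation Rn := 'rV[R]_n.
Local Notation mu := (lebesgue_rV R n).

Definition cintegrable (D : set Rn) (f : Rn -> R[i]) :=
  mu.-integrable D (fun x => (complex.Re (f x))%:E) /\
  mu.-integrable D (fun x => (complex.Im (f x))%:E).

Definition cintegral (D : set Rn) (f : Rn -> R[i]) : R[i] :=
  Complex (\int[mu]_(x in D) complex.Re (f x))
          (\int[mu]_(x in D) complex.Im (f x)).

Definition cLnorm (p : R) (f : Rn -> R[i]) : \bar R :=
  Lnorm mu p%:E (fun x => (cabs (f x))%:E).

Definition in_Lp (p : R) (f : Rn -> R[i]) :=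
  cmeasurable setT f /\ (cLnorm p f < +oo)%E.

(* The quasi-norm of weak L^1. *)
Definition wL1norm (f : Rn -> R[i]) : \bar R :=
  ereal_sup [set z | exists2 s : R, 0 < s &
    z = (s%:E * mu [set x | (s < cabs (f x))%R])%E].

End complex_valued.

Section schwartz.
Context {R : realType} {n : nat}.
Local Notation Rn := 'rV[R]_n.

(* Iterated partial derivatives, in the directions listed in s. *)
Definition pderiv (i : 'I_n) (f : Rn -> R) : Rn -> R :=
  fun x => 'D_(delta_mx ord0 i) f x.

Definition pderivs (s : seq 'I_n) (f : Rn -> R) : Rn -> R := foldr pderiv f s.

Definition cpderivs (s : seq 'I_n) (f : Rn -> R[i]) : Rn -> R[i] := fun x =>
  Complex (pderivs s (fun y => complex.Re (f y)) x)
          (pderivs s (fun y => complex.Im (f y)) x).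

Definition smooth (f : Rn -> R) :=
  forall (s : seq 'I_n) (x : Rn), differentiable (pderivs s f) x.

Definition csmooth (f : Rn -> R[i]) :=
  smooth (fun x => complex.Re (f x)) /\ smooth (fun x => complex.Im (f x)).

Definition csupp (f : Rn -> R[i]) : set Rn := closure [set x | f x != 0].

Definition Cc_infty (f : Rn -> R[i]) := csmooth f /\ compact (csupp f).

Definition monomial (a : 'I_n -> nat) (x : Rn) : R :=
  \prod_(i < n) x ord0 i ^+ a i.

Definition schwartz (f : Rn -> R[i]) :=
  csmooth f /\
  forall (a : 'I_n -> nat) (s : seq 'I_n), exists M : R,
    forall x, `|monomial a x| * cabs (cpderivs s f x) <= M.

(* A tempered distribution is a linear functional on the Schwartz space that is
   bounded by finitely many of the seminorms sup |x^a D^s f|. *)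
Definition tempered (L : (Rn -> R[i]) -> R[i]) :=
  (forall (c : R[i]) f g, schwartz f -> schwartz g ->
     L (fun x => c * f x + g x) = c * L f + L g) /\
  exists (N : nat) (A : R), forall f (M : R), schwartz f ->
    (forall (a : 'I_n -> nat) (s : seq 'I_n),
       (\sum_(i < n) a i <= N)%N -> (size s <= N)%N ->
       forall x, `|monomial a x| * cabs (cpderivs s f x) <= M) ->
    cabs (L f) <= A * M.

End schwartz.

Section calderon_zygmund.
Context {R : realType} {n : nat}.
Local Notation Rn := 'rV[R]_n.
Local Notation mu := (lebesgue_rV R n).

(* Only the values of theta on the positive reals matter. *)
Definition dini (theta : R -> R) :=
  [/\ forall t, 0 < t -> 0 <= theta t,
      forall s t, 0 < s -> s <= t -> theta s <= theta t &
      (\int[lebesgue_measure]_(t in `]0%R, 1%R[) (theta t / t)%:E < +oo)%E].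

(* The smoothness estimate is trivial when x = z, where theta(0) would
   otherwise occur; hence 0 < |x - z|. *)
Definition theta_kernel (theta : R -> R) (K : Rn -> Rn -> R[i]) :=
  cmeasurable [set xy : Rn * Rn | xy.1 != xy.2] (fun xy => K xy.1 xy.2) /\
  exists C : R, [/\ 0 < C,
    forall x y, x != y -> cabs (K x y) <= C * enorm (x - y) ^- n &
    forall x y z, 0 < enorm (x - z) -> enorm (x - z) < enorm (x - y) / 2 ->
      cabs (K x y - K z y) + cabs (K y x - K y z)
      <= C * enorm (x - y) ^- n * theta (enorm (x - z) / enorm (x - y))].

(* T is a linear operator from the Schwartz space to tempered distributions;
   [T f g] is the value of the distribution T f at the test function g. *)
Definition schwartz_operator (T : (Rn -> R[i]) -> (Rn -> R[i]) -> R[i]) :=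
  (forall f, schwartz f -> tempered (T f)) /\
  (forall (c : R[i]) f g h, schwartz f -> schwartz g -> schwartz h ->
     T (fun x => c * f x + g x) h = c * T f h + T g h).

(* T2 acts on representatives: it is a bounded linear operator on L^2, and for
   f in the Schwartz space the function T2 f represents the distribution T f. *)
Definition L2_extension (T : (Rn -> R[i]) -> (Rn -> R[i]) -> R[i])
    (T2 : (Rn -> R[i]) -> Rn -> R[i]) :=
  [/\ forall (c : R[i]) f g, in_Lp 2 f -> in_Lp 2 g ->
        {ae mu, forall x, T2 (fun y => c * f y + g y) x = c * T2 f x + T2 g x},
      exists A : R, forall f, in_Lp 2 f ->
        in_Lp 2 (T2 f) /\ (cLnorm 2 (T2 f) <= A%:E * cLnorm 2 f)%E &
      forall f g, schwartz f -> schwartz g ->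
        T f g = cintegral setT (fun x => T2 f x * g x)].

(* T is a theta-type Calderon-Zygmund operator, T2 its extension to L^2, and K
   its kernel. T2 f is a class modulo null sets, so the kernel representation
   holds for almost every x outside supp f. *)
Definition theta_CZO (theta : R -> R)
    (T : (Rn -> R[i]) -> (Rn -> R[i]) -> R[i])
    (T2 : (Rn -> R[i]) -> Rn -> R[i]) (K : Rn -> Rn -> R[i]) :=
  [/\ schwartz_operator T, L2_extension T T2, theta_kernel theta K &
      forall f, Cc_infty f ->
        {ae mu, forall x, ~ csupp f x ->
          T2 f x = cintegral setT (fun y => K x y * f y)}].

(* h is the value at g of the extension of T by continuity from the Schwartz
   space, with the norm of L^1, to L^1, with values in weak L^1:
   h is the limit of T f as f tends to g. It is unique almost everywhere, as
   the Schwartz space is dense in L^1. *)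
Definition is_L1_value (T2 : (Rn -> R[i]) -> Rn -> R[i]) (g h : Rn -> R[i]) :=
  [/\ in_Lp 1 g, cmeasurable setT h &
    forall e : R, 0 < e -> exists2 d : R, 0 < d &
      forall f, schwartz f -> (cLnorm 1 (fun x => (f x - g x)%R) < d%:E)%E ->
        (wL1norm (fun x => (T2 f x - h x)%R) <= e%:E)%E].

(* F = T f for f in a Morrey space: on every cube Q,
   F = T (f chi_2Q) + \int_(2Q)^c K(., y) f(y) dy almost everywhere. *)
Definition is_value (T2 : (Rn -> R[i]) -> Rn -> R[i]) (K : Rn -> Rn -> R[i])
    (f F : Rn -> R[i]) :=
  cmeasurable setT F /\
  forall (c : Rn) (l : R), 0 < l ->
    exists2 h, is_L1_value T2 (fun x => f x * (\1_(cube c (2 * l)) x)%:C%C) h &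
      {ae mu, forall x, cube c l x ->
        cintegrable (~` cube c (2 * l)) (fun y => K x y * f y) /\
        F x = h x + cintegral (~` cube c (2 * l)) (fun y => K x y * f y)}.

End calderon_zygmund.

Section weights.
Context {R : realType} {n : nat}.
Local Notation Rn := 'rV[R]_n.
Local Notation mu := (lebesgue_rV R n).
Implicit Types (u v : Rn -> R) (D : set Rn).

Definition weight u :=
  [/\ measurable_fun setT u,
      forall D, compact D -> mu.-integrable D (EFin \o u) &
      {ae mu, forall x, 0 < u x}].

Definition wmeas u D : \bar R := (\int[mu]_(x in D) (u x)%:E)%E.

Definition average D u : \bar R :=
  ((fine (mu D))^-1%:E * \int[mu]_(x in D) (u x)%:E)%E.

Definition conj_exponent (p : R) : R := (1 - p^-1)^-1.

Definition ess_inf_on D u : \bar R :=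
  ereal_sup [set y | {ae mu, forall x, D x -> (y <= (u x)%:E)%E}].

Definition A_1 u := exists C : R, forall (c : Rn) (r : R), 0 < r ->
  (average (eball c r) u <= C%:E * ess_inf_on (eball c r) u)%E.

(* The condition for exponents 1 < q < oo. *)
Definition A_q (q : R) u := exists2 C : R, 0 < C &
  forall (c : Rn) (r : R), 0 < r ->
    (average (eball c r) u `^ q^-1 *
     average (eball c r) (fun x => (u x `^ (- (conj_exponent q / q)))%R)
       `^ (conj_exponent q)^-1 <= C%:E)%E.

Definition A_infty u := A_1 u \/ exists2 q : R, 1 < q & A_q q u.

End weights.

Section morrey.
Context {R : realType} {n : nat}.
Local Notation Rn := 'rV[R]_n.
Local Notation mu := (lebesgue_rV R n).
Implicit Types (u v : Rn -> R) (f F : Rn -> R[i]) (p : R) (psi : R -> R).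

(* psi is a function on the positive reals; its other values do not matter. *)
Definition D_cond (kappa : R) psi :=
  [/\ forall t, 0 < t -> 0 < psi t,
      forall s t, 0 < s -> s <= t -> psi s <= psi t &
      exists2 C : R, 0 < C & forall s t, 0 < s -> s < t ->
        psi t / t `^ kappa <= C * (psi s / s `^ kappa)].

Definition morrey_norm p psi v u f : \bar R :=
  ereal_sup [set z | exists (c : Rn) (l : R), 0 < l /\
    z = (((psi (fine (wmeas u (cube c l))))^-1%:E *
          \int[mu]_(x in cube c l) (cabs (f x) `^ p * v x)%:E) `^ p^-1)%E].

Definition morrey p psi v u f :=
  [/\ cmeasurable setT f,
      forall D : set Rn, compact D ->
        (\int[mu]_(x in D) (cabs (f x) `^ p * v x)%:E < +oo)%E &
      (morrey_norm p psi v u f < +oo)%E].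

Definition wmorrey_norm p psi u F : \bar R :=
  ereal_sup [set z | exists (c : Rn) (r s : R), [/\ 0 < r, 0 < s &
    z = (((psi (fine (wmeas u (eball c r))) `^ p^-1)^-1 * s)%:E *
         wmeas u [set x | eball c r x /\ (s < cabs (F x))%R]
           `^ p^-1)%E]].

End morrey.

(* Main.v *)
(* Let f belong to the Morrey space and split T f on a cube Q into the value of T
   at f 1_2Q and the integral over the complement of 2Q. The two-weight condition
   and Hoelder's inequality bound the average of |f| over 2^k Q by a multiple of
   (psi(u(2^k Q)) / u(2^k Q))^(1/p), which decays geometrically in k by the D_kappa
   condition and the reverse doubling of u. This bounds the second part uniformly
   on Q.

   For the first part one needs the weak type estimate
   u{x in Q : |T g| > s} <= C s^-p \int |g|^p v for g in L^1. The weak type (1,1)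
   estimate (Calderon-Zygmund decomposition) and the Dini condition show that, if
   the averages of |g| over all dilations of a cube b are at most t, then T g
   differs from a constant by at most A t except on a small part of b. Following
   these constants down the dyadic tree gives a good-lambda inequality: for some
   eta < beta^p < 1,
   u{|T g| > s} <= u{M g > c s} + eta u{|T g| > beta s}.
   The A_infty condition enters only through the fact that a fixed proportion of a
   cube carries a fixed proportion of its u-measure. The maximal function is
   controlled by a Vitali covering and the two-weight condition, and the inequality
   is iterated. *)
From HB Require Import structures.
Require Import Defs.
From mathcomp Require Import all_boot all_order all_algebra.
From mathcomp Require Import all_classical all_reals all_analysis.
From mathcomp Require Import complex.
From mathcomp Require Import measurable_realfun ring lra.
Import Order.TTheory GRing.Theory Num.Theory.
Import numFieldNormedType.Exports.
Local Open Scope classical_set_scope.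
Local Open Scope ring_scope.
Set Implicit Arguments.
Unset Strict Implicit.
Unset Printing Implicit Defensive.

(** * Modulus and measurability of complex-valued functions *)

Section complex_modulus.
Context {R : realType}.
Implicit Types z w : R[i].

(** Three obstacles shape the proof. The kernel formula is given only for smooth functions of
    compact support, [T2] is determined only up to null sets, and its values on L^1 are limits in
    measure. Estimates for the operator are therefore proved on finite combinations of indicators of
    dyadic cubes and then carried to L^1; small-scale information comes from the L^1 density of
    these step functions. The constant from which T g is measured on a cube [b] is [frozen g b], the
    integral of [K b.1] against [g] off a dilation of [b]. If [g] lives on the root cube, this
    constant is 0 there, so the descent starts below the level. Only finitely many generations are
    explored; in the cubes of the last generation that have not stopped, {|T g| > s} is sparse and
    is removed by density. The interval from [be * s] to [s] is cut into six equal steps: the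
    descent stops above the midpoint, a stopping value overshoots it by at most two steps, and T g
    deviates from that value by at most one step off a small set. Weights are positive only almost
    everywhere, so u(D) is represented by the measure of density [pospart u]. Bounds for complex
    integrals cost a factor 2, since real and imaginary parts are estimated separately. *)

Lemma cabs_ge0 z : 0 <= cabs z.
Proof. by case: z => a b; rewrite /cabs /Normc.normc sqrtr_ge0. Qed.

Lemma cabs0 : cabs (0 : R[i]) = 0. Proof. exact: Normc.normc0. Qed.

Lemma cabsD z w : cabs (z + w) <= cabs z + cabs w.
Proof. exact: le_normcD. Qed.

Lemma cabsM z w : cabs (z * w) = cabs z * cabs w.
Proof. exact: Normc.normcM. Qed.

Lemma cabsN z : cabs (- z) = cabs z.
Proof. by case: z => a b; rewrite /cabs /Normc.normc /= !sqrrN. Qed.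

Lemma cabsB z w : cabs (z - w) <= cabs z + cabs w.
Proof. by rewrite -(cabsN w) cabsD. Qed.

Lemma cabsBC z w : cabs (z - w) = cabs (w - z).
Proof. by rewrite -cabsN opprB. Qed.

Lemma cabs_le_add z w : cabs z <= cabs (z - w) + cabs w.
Proof. by rewrite -[X in cabs X <= _](subrK w) cabsD. Qed.

Lemma cabs_real (a : R) : cabs a%:C%C = `|a|.
Proof. by rewrite /cabs /Normc.normc /= expr0n addr0 sqrtr_sqr. Qed.

Lemma Re_le_cabs z : `|complex.Re z| <= cabs z.
Proof.
case: z => a b; rewrite /cabs /Normc.normc /= -sqrtr_sqr ler_sqrt ?addr_ge0 ?sqr_ge0//.
by rewrite lerDl sqr_ge0.
Qed.

Lemma Im_le_cabs z : `|complex.Im z| <= cabs z.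
Proof.
case: z => a b; rewrite /cabs /Normc.normc /= -sqrtr_sqr ler_sqrt ?addr_ge0 ?sqr_ge0//.
by rewrite lerDr sqr_ge0.
Qed.

Lemma cabs_le_ReIm z : cabs z <= `|complex.Re z| + `|complex.Im z|.
Proof.
case: z => a b; rewrite /cabs /Normc.normc /=.
rewrite -[leRHS]ger0_norm ?addr_ge0// -sqrtr_sqr ler_sqrt ?sqr_ge0//.
rewrite sqrrD !real_normK ?num_real// lerD2r lerDl.
by rewrite mulrn_wge0// mulr_ge0.
Qed.

Lemma ReD z w : complex.Re (z + w) = complex.Re z + complex.Re w.
Proof. by case: z; case: w. Qed.
Lemma ImD z w : complex.Im (z + w) = complex.Im z + complex.Im w.
Proof. by case: z; case: w. Qed.
Lemma ReM z w : complex.Re (z * w) =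
  complex.Re z * complex.Re w - complex.Im z * complex.Im w.
Proof. by case: z; case: w. Qed.
Lemma ImM z w : complex.Im (z * w) =
  complex.Re z * complex.Im w + complex.Im z * complex.Re w.
Proof. by case: z; case: w. Qed.

End complex_modulus.

Section complex_measurability.
Context {R : realType} d (T : measurableType d) (D : set T).
Implicit Types f g : T -> R[i].

Lemma cmeasurable_cst (z : R[i]) : cmeasurable D (fun=> z).
Proof. by split; exact: measurable_cst. Qed.

Lemma cmeasurableD f g : cmeasurable D f -> cmeasurable D g ->
  cmeasurable D (fun x => f x + g x).
Proof.
move=> [f1 f2] [g1 g2]; split.
  under eq_fun do rewrite ReD; exact: measurable_funD.
under eq_fun do rewrite ImD; exact: measurable_funD.
Qed.

Lemma cmeasurableM f g : cmeasurable D f -> cmeasurable D g ->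
  cmeasurable D (fun x => f x * g x).
Proof.
move=> [f1 f2] [g1 g2]; split.
  under eq_fun do rewrite ReM; apply: measurable_funB; exact: measurable_funM.
under eq_fun do rewrite ImM; apply: measurable_funD; exact: measurable_funM.
Qed.

Lemma cmeasurableB f g : cmeasurable D f -> cmeasurable D g ->
  cmeasurable D (fun x => f x - g x).
Proof.
move=> mf mg; under eq_fun do rewrite -mulN1r.
by apply: cmeasurableD => //; apply: cmeasurableM => //; exact: cmeasurable_cst.
Qed.

Lemma cmeasurable_real (f : T -> R) : measurable_fun D f ->
  cmeasurable D (fun x => (f x)%:C%C).
Proof. by move=> mf; split => //=; exact: measurable_cst. Qed.

Lemma measurable_cabs f : cmeasurable D f -> measurable_fun D (fun x => cabs (f x)).
Proof.
move=> [f1 f2]; rewrite /cabs (_ : (fun _ => _) =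
   (fun x => Num.sqrt (complex.Re (f x) ^+ 2 + complex.Im (f x) ^+ 2))).
  apply: (@measurableT_comp _ _ _ _ _ _ (@Num.sqrt R)).
    apply: continuous_measurable_fun; exact: sqrt_continuous.
  by apply: measurable_funD; exact: measurable_funX.
by apply/funext => x; case: (f x).
Qed.

End complex_measurability.

Lemma cmeasurable_indic (R : realType) d (T : measurableType d) (D A : set T)
  (f : T -> R[i]) : cmeasurable D f -> measurable A ->
  cmeasurable D (fun x => f x * (\1_A x)%:C%C).
Proof.
move=> mf mA; apply: cmeasurableM => //; apply: cmeasurable_real.
exact: measurable_indic.
Qed.

(** * Dyadic cubes *)

Section boxes.
Context {R : realType} {n : nat}.
Local Notation Rn := 'rV[R]_n.
Local Notation mu := (lebesgue_rV R n).
Implicit Types (c x y : Rn) (l : R).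

Lemma measurable_rV_prod (A : 'I_n -> set (measurableTypeR R)) :
  (forall i, measurable (A i)) ->
  measurable [set x : Rn | forall i, A i (x ord0 i)].
Proof.
move=> mA; rewrite (_ : mkset _ =
    \big[setI/setT]_(i < n) (@rV_coord R n i @^-1` A i)).
  apply: bigsetI_measurable => i _; rewrite -[X in measurable X]setTI.
  exact: measurable_rV_coord.
rewrite -bigcap_seq; apply/seteqP; split => [x Ax i _|x Ax i]; first exact: Ax.
by apply: Ax; rewrite /= mem_index_enum.
Qed.

Lemma measurable_coord (i : 'I_n) : measurable_fun setT (fun x : Rn => x ord0 i).
Proof. exact: measurable_rV_coord. Qed.

(** The Booleans select open or closed endpoints, so this one computation serves half-open, open and
    closed cubes. *)
Lemma lebesgue_rV_itv (a b : 'I_n -> bool) (c : Rn) l : 0 <= l ->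
  mu [set x | forall i, [set` Interval (BSide (a i) (c ord0 i - l / 2))
    (BSide (b i) (c ord0 i + l / 2))] (x ord0 i)] = (l ^+ n)%:E.
Proof.
move=> l0; rewrite (@lebesgue_rV_box R n (fun i => [set` Interval
  (BSide (a i) (c ord0 i - l / 2)) (BSide (b i) (c ord0 i + l / 2))])); last first.
  by move=> i; exact: measurable_itv.
transitivity (\prod_(i < n) l%:E)%E; last first.
  by rewrite prodEFin prodr_const card_ord.
apply: eq_bigr => i _; rewrite lebesgue_measure_itv /= lte_fin.
case: ltP => h; first by rewrite -EFinD; congr EFin; lra.
by congr EFin; lra.
Qed.

Lemma measurable_rV_itv (J : 'I_n -> interval R) :
  measurable [set x : Rn | forall i, x ord0 i \in J i].
Proof. by apply: (measurable_rV_prod (A := fun i => [set` J i])). Qed.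

Definition box : Type := (Rn * R)%type.

(* Half-open cube with centre [b.1] and side [b.2]. *)
Definition hbox (b : box) : set Rn :=
  [set x | forall i, b.1 ord0 i - b.2 / 2 <= x ord0 i < b.1 ord0 i + b.2 / 2].

Definition obox c l : set Rn :=
  [set x | forall i, c ord0 i - l / 2 < x ord0 i < c ord0 i + l / 2].

Lemma hboxE b : hbox b = [set x | forall i,
  [set` Interval (BSide true (b.1 ord0 i - b.2 / 2))
    (BSide true (b.1 ord0 i + b.2 / 2))] (x ord0 i)].
Proof. by apply/seteqP; split => x /= H i; move: (H i); rewrite in_itv. Qed.

Lemma oboxE c l : obox c l = [set x | forall i,
  [set` Interval (BSide false (c ord0 i - l / 2))
    (BSide true (c ord0 i + l / 2))] (x ord0 i)].
Proof. by apply/seteqP; split => x /= H i; move: (H i); rewrite in_itv. Qed.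

Lemma cubeE c l : cube c l = [set x | forall i,
  [set` Interval (BSide true (c ord0 i - l / 2))
    (BSide false (c ord0 i + l / 2))] (x ord0 i)].
Proof.
apply/seteqP; split => x /= H i; move: (H i); rewrite in_itv/= ler_norml;
  by move=> /andP[? ?]; apply/andP; split; lra.
Qed.

Lemma measurable_hbox b : measurable (hbox b).
Proof. by rewrite hboxE; exact: measurable_rV_itv. Qed.

Lemma measurable_obox c l : measurable (obox c l).
Proof. by rewrite oboxE; exact: measurable_rV_itv. Qed.

Lemma measurable_cube c l : measurable (cube c l).
Proof. by rewrite cubeE; exact: measurable_rV_itv. Qed.

Lemma mu_hbox b : 0 <= b.2 -> mu (hbox b) = (b.2 ^+ n)%:E.
Proof. by move=> l0; rewrite hboxE; exact: lebesgue_rV_itv. Qed.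

Lemma mu_obox c l : 0 <= l -> mu (obox c l) = (l ^+ n)%:E.
Proof. by move=> l0; rewrite oboxE; exact: lebesgue_rV_itv. Qed.

Lemma mu_cube c l : 0 <= l -> mu (cube c l) = (l ^+ n)%:E.
Proof. by move=> l0; rewrite cubeE; exact: lebesgue_rV_itv. Qed.

Lemma hbox_cube b : hbox b `<=` cube b.1 b.2.
Proof. by move=> x H i; rewrite ler_norml; move: (H i) => /andP[? ?]; lra. Qed.

Lemma obox_hbox c l : obox c l `<=` hbox (c, l).
Proof. by move=> x H i; move: (H i) => /= /andP[? ?]; apply/andP; split; lra. Qed.

Lemma hbox_center b : 0 < b.2 -> hbox b b.1.
Proof. by move=> l0 i; apply/andP; split; lra. Qed.

Definition kid (b : box) (e : {ffun 'I_n -> bool}) : box :=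
  (\row_i (b.1 ord0 i + (if e i then 1 else - 1) * (b.2 / 4)), b.2 / 2).

(** The comparison is weak, matching cubes that contain their lower faces only. Hence [orth b x] is
    the only index whose child can contain [x] ([hbox_kid]), and the children partition the cube. *)
Definition orth (b : box) x : {ffun 'I_n -> bool} :=
  [ffun i => b.1 ord0 i <= x ord0 i].

Lemma kid_sub b e : 0 < b.2 -> hbox (kid b e) `<=` hbox b.
Proof.
move=> l0 x H i; move: (H i); rewrite /= mxE.
by case: (e i) => /andP[? ?]; apply/andP; split; lra.
Qed.

Lemma hbox_kid b e x : 0 < b.2 -> hbox (kid b e) x -> e = orth b x.
Proof.
move=> l0 H; apply/ffunP => i; rewrite ffunE; move: (H i); rewrite /= mxE.
case: (e i) => /andP[? ?]; first by apply/esym; lra.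
by apply/esym/negbTE; rewrite -ltNge; lra.
Qed.

Lemma hbox_orth b x : 0 < b.2 -> hbox b x -> hbox (kid b (orth b x)) x.
Proof.
move=> l0 H i; move: (H i); rewrite /= mxE ffunE => /andP[? ?].
by case: ifPn; rewrite -?ltNge => ?; apply/andP; split; lra.
Qed.

Lemma hbox_kids b : 0 < b.2 ->
  hbox b = \big[setU/set0]_(e : {ffun 'I_n -> bool}) hbox (kid b e).
Proof.
move=> l0; rewrite -bigcup_seq; apply/seteqP; split => x /=.
  by move=> bx; exists (orth b x); [rewrite /= mem_index_enum|exact: hbox_orth].
by move=> [e _]; exact: kid_sub.
Qed.

Lemma ge0_integral_kids (m : {measure set Rn -> \bar R}) b (f : Rn -> \bar R) :
  0 < b.2 -> measurable_fun (hbox b) f -> (forall x, hbox b x -> (0 <= f x)%E) ->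
  (\int[m]_(x in hbox b) f x =
   \sum_(e : {ffun 'I_n -> bool}) \int[m]_(x in hbox (kid b e)) f x)%E.
Proof.
move=> l0 mf f0; rewrite {1}(hbox_kids l0) ge0_integral_bigsetU//.
- by move=> e; exact: measurable_hbox.
- exact: index_enum_uniq.
- by move=> e1 e2 _ _ [x [/(hbox_kid l0) -> /(hbox_kid l0) ->]].
- by rewrite -hbox_kids.
- by move=> x; rewrite -hbox_kids//; exact: f0.
Qed.

Lemma measure_kids (m : {measure set Rn -> \bar R}) b (A : set Rn) : 0 < b.2 ->
  measurable A ->
  (m (hbox b `&` A) =
   \sum_(e : {ffun 'I_n -> bool}) m (hbox (kid b e) `&` A))%E.
Proof.
move=> l0 mA; have H D : measurable D ->
  m (D `&` A) = (\int[m]_(x in D) (\1_A x)%:E)%E.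
  by move=> mD; rewrite integral_indic// setIC.
rewrite H ?ge0_integral_kids//; last 2 first.
- by apply/measurable_EFinP; exact: measurable_indic.
- exact: measurable_hbox.
by apply: eq_bigr => e _; rewrite H//; exact: measurable_hbox.
Qed.

(** The recursion splits at the root, not at the leaves, so that inductions on [k] apply their
    hypothesis to each child of [b]. *)
Fixpoint gen (b : box) (k : nat) : seq box :=
  if k is k'.+1 then flatten [seq gen (kid b e) k' | e <- index_enum {ffun 'I_n -> bool}]
  else [:: b].

Lemma genS b k b' : b' \in gen b k.+1 -> exists e, b' \in gen (kid b e) k.
Proof. by move=> /flatten_mapP[e _ ?]; exists e. Qed.

Lemma big_genS (V : nmodType) b k (F : box -> V) :
  \sum_(b' <- gen b k.+1) F b' = \sum_e \sum_(b' <- gen (kid b e) k) F b'.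
Proof. by rewrite /= big_flatten big_map. Qed.

Lemma gen_side b k b' : b' \in gen b k -> b'.2 = b.2 / 2 ^+ k.
Proof.
elim: k b => [|k IH] b; first by rewrite inE => /eqP ->; rewrite expr0 divr1.
by move=> /genS[e /IH ->]; rewrite /= exprS invfM; lra.
Qed.

Lemma gen_side_gt0 b k b' : 0 < b.2 -> b' \in gen b k -> 0 < b'.2.
Proof. by move=> l0 /gen_side ->; rewrite divr_gt0// exprn_gt0. Qed.

Lemma gen_sub b k b' : 0 < b.2 -> b' \in gen b k -> hbox b' `<=` hbox b.
Proof.
elim: k b => [|k IH] b l0; first by rewrite inE => /eqP ->.
move=> /genS[e /IH]; rewrite /= divr_gt0// => /(_ isT).
by move/subset_trans; apply; exact: kid_sub.
Qed.

Lemma measure_gen (m : {measure set Rn -> \bar R}) b k (A : set Rn) : 0 < b.2 ->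
  measurable A ->
  (m (hbox b `&` A) = \sum_(b' <- gen b k) m (hbox b' `&` A))%E.
Proof.
move=> + mA; elim: k b => [|k IH] b l0; first by rewrite big_seq1.
rewrite big_genS measure_kids//; apply: eq_bigr => e _; rewrite IH//.
by rewrite /= divr_gt0.
Qed.

Lemma ge0_integral_gen (m : {measure set Rn -> \bar R}) b k (f : Rn -> \bar R) :
  0 < b.2 -> measurable_fun (hbox b) f -> (forall x, hbox b x -> (0 <= f x)%E) ->
  (\int[m]_(x in hbox b) f x =
   \sum_(b' <- gen b k) \int[m]_(x in hbox b') f x)%E.
Proof.
elim: k b => [|k IH] b l0 mf f0; first by rewrite big_seq1.
rewrite big_genS ge0_integral_kids//; apply: eq_bigr => e _; apply: IH.
- by rewrite /= divr_gt0.
- by apply: measurable_funS mf; [exact: measurable_hbox|exact: kid_sub].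
- by move=> x /(kid_sub l0); exact: f0.
Qed.

Lemma indic_gen b k x : 0 < b.2 ->
  (\sum_(b' <- gen b k) \1_(hbox b') x = \1_(hbox b) x :> R).
Proof.
elim: k b => [|k IH] b l0; first by rewrite big_seq1.
rewrite big_genS (eq_bigr (fun e => \1_(hbox (kid b e)) x)); last first.
  by move=> e _; rewrite IH//= divr_gt0.
have [bx|nbx] := pselect (hbox b x); last first.
  rewrite big1 => [|e _]; first by rewrite indicE memNset.
  by rewrite indicE memNset// => /(kid_sub l0).
rewrite (bigD1 (orth b x))//= big1 => [|e]; last first.
  by rewrite indicE => /eqP ne; rewrite memNset// => /(hbox_kid l0).
by rewrite !indicE !mem_set// ?addr0//; exact: hbox_orth.
Qed.

(* The centre of the dyadic subcube of generation [k] containing [x]. *)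
Fixpoint ctr (b : box) (k : nat) x : Rn :=
  if k is k'.+1 then ctr (kid b (orth b x)) k' x else b.1.

Lemma ctr_gen b k b' x : 0 < b.2 -> b' \in gen b k -> hbox b' x -> ctr b k x = b'.1.
Proof.
elim: k b => [|k IH] b l0; first by rewrite inE => /eqP ->.
move=> /genS[e be] bx /=; have ke : 0 < (kid b e).2 by rewrite /= divr_gt0.
by rewrite -(hbox_kid l0 (gen_sub ke be bx)); exact: IH.
Qed.

Lemma gen_cover b k x : 0 < b.2 -> hbox b x ->
  exists2 b', b' \in gen b k & hbox b' x.
Proof.
elim: k b => [|k IH] b l0 bx; first by exists b => //; rewrite inE.
have [||b' b'k b'x] := IH (kid b (orth b x)).
- by rewrite /= divr_gt0.
- exact: hbox_orth.
- by exists b' => //=; apply/flatten_mapP; exists (orth b x) => //; rewrite mem_index_enum.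
Qed.

Lemma ctr_in b k x : 0 < b.2 -> hbox b x -> hbox b (ctr b k x).
Proof.
move=> l0 bx; have [b' bk b'x] := gen_cover k l0 bx.
rewrite (ctr_gen l0 bk b'x); apply: (gen_sub l0 bk); apply: hbox_center.
exact: gen_side_gt0 bk.
Qed.

Lemma ctr_near b k x i : 0 < b.2 -> hbox b x ->
  `|x ord0 i - ctr b k x ord0 i| <= b.2 / 2 ^+ k.
Proof.
move=> l0 bx; have [b' bk b'x] := gen_cover k l0 bx.
rewrite (ctr_gen l0 bk b'x) -(gen_side bk) ler_norml.
by have := gen_side_gt0 l0 bk; move: (b'x i) => /andP[? ?] ?; lra.
Qed.

(** The centre of the subcube of generation [k.+1] lies in the same subcube of generation [k] as
    [x]. This makes step functions of one generation also step functions of the next. *)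
Lemma ctr_ctr b k x : 0 < b.2 -> hbox b x -> ctr b k (ctr b k.+1 x) = ctr b k x.
Proof.
elim: k b => [//|k IH] b l0 bx.
have k0 e : 0 < (kid b e).2 by rewrite /= divr_gt0.
have -> : ctr b k.+2 x = ctr (kid b (orth b x)) k.+1 x by [].
set y := ctr _ k.+1 x.
have ky : hbox (kid b (orth b x)) y by apply: ctr_in => //; exact: hbox_orth.
rewrite [LHS]/= -(hbox_kid l0 ky) /=; apply: IH => //; exact: hbox_orth.
Qed.

Lemma measurable_orth b e : measurable [set x | orth b x = e].
Proof.
have -> : [set x | orth b x = e] = [set x | forall i,
   (if e i then `[b.1 ord0 i, +oo[%classic
    else `]-oo, b.1 ord0 i[%classic) (x ord0 i)]; last first.
  apply: (measurable_rV_prod (A := fun i => if e i then `[b.1 ord0 i, +oo[%classic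
   else `]-oo, b.1 ord0 i[%classic)) => i; case: ifP => _; exact: measurable_itv.
apply/seteqP; split => x /=.
  by move=> <- i; rewrite ffunE; case: ifPn; rewrite -?ltNge /= in_itv/= ?andbT.
move=> H; apply/ffunP => i; rewrite ffunE; move: (H i); case: (e i) => /=.
  by rewrite in_itv/= andbT.
by rewrite in_itv/= => h; apply/negbTE; rewrite -ltNge.
Qed.

(** No measurability of [A] is required: [ctr b k x] depends on [x] only through finitely many
    measurable choices of orthants. *)
Lemma measurable_ctr b k (A : set Rn) : measurable (ctr b k @^-1` A).
Proof.
elim: k b => [|k IH] b.
  have [Ab|nAb] := pselect (A b.1).
    by rewrite (_ : _ @^-1` _ = setT)//; apply/seteqP; split.
  by rewrite (_ : _ @^-1` _ = set0)//; apply/seteqP; split.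
rewrite (_ : _ @^-1` _ = \big[setU/set0]_(e : {ffun 'I_n -> bool})
   ([set x | orth b x = e] `&` (ctr (kid b e) k @^-1` A))).
  apply: bigsetU_measurable => e _; apply: measurableI => //; exact: measurable_orth.
rewrite -bigcup_seq; apply/seteqP; split => x /=.
  by move=> Ax; exists (orth b x) => //=; rewrite mem_index_enum.
by move=> [e _ [<-]].
Qed.

Lemma measurable_fun_ctr d (T : measurableType d) b k (f : Rn -> T) :
  measurable_fun setT (f \o ctr b k).
Proof. by move=> _ Y mY; rewrite setTI comp_preimage; exact: measurable_ctr. Qed.

End boxes.
Arguments box : clear implicits.

(** * Dyadic approximation in L^1 *)

Section real_integral_bounds.
Context {R : realType} d (T : measurableType d) (m : {measure set T -> \bar R}).
Implicit Types (D : set T) (f g h : T -> R).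

Lemma cvge0_small (u : (\bar R)^nat) (e : R) : u @ \oo --> 0%E -> 0 < e ->
  exists N, forall k, (N <= k)%N -> (u k <= e%:E)%E.
Proof.
move=> u0 e0; have [N _ HN] := u0 _ (@nbhs_open_ereal_lt R 0 (fun=> e) e0).
by exists N => k Nk; apply: ltW; exact: (HN k).
Qed.

Lemma le_integral_EFin D f g : measurable D -> measurable_fun D f ->
  measurable_fun D g -> (forall x, D x -> 0 <= f x) ->
  (forall x, D x -> f x <= g x) ->
  (\int[m]_(x in D) (f x)%:E <= \int[m]_(x in D) (g x)%:E)%E.
Proof.
by move=> mD mf mg f0 fg; apply: ge0_le_integral => //; exact/measurable_EFinP.
Qed.

Lemma le_integral_EFinD D f g h : measurable D -> measurable_fun D f ->
  measurable_fun D g -> measurable_fun D h -> (forall x, D x -> 0 <= f x) ->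
  (forall x, D x -> 0 <= g x) -> (forall x, D x -> 0 <= h x) ->
  (forall x, D x -> f x <= g x + h x) ->
  (\int[m]_(x in D) (f x)%:E <=
   \int[m]_(x in D) (g x)%:E + \int[m]_(x in D) (h x)%:E)%E.
Proof.
move=> mD mf mg mh f0 g0 h0 fgh.
rewrite -ge0_integralD//; [|exact/measurable_EFinP..].
under [leRHS]eq_integral do rewrite -EFinD.
by apply: le_integral_EFin => //; exact: measurable_funD.
Qed.

Lemma integral_EFinZ D f (k : R) : measurable D -> measurable_fun D f ->
  (forall x, D x -> 0 <= f x) -> 0 <= k ->
  (\int[m]_(x in D) (k * f x)%:E = k%:E * \int[m]_(x in D) (f x)%:E)%E.
Proof.
move=> mD mf f0 k0; under eq_integral do rewrite EFinM.
by rewrite ge0_integralZl_EFin//; exact/measurable_EFinP.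
Qed.

Lemma measurable_dist D f g : measurable_fun D f -> measurable_fun D g ->
  measurable_fun D (fun x => `|f x - g x|).
Proof.
move=> mf mg; apply: (measurableT_comp (@normr_measurable R setT)).
exact: measurable_funB.
Qed.

End real_integral_bounds.

Section dyadic_approximation.
Context {R : realType} {n : nat}.
Local Notation Rn := 'rV[R]_n.
Local Notation mu := (lebesgue_rV R n).
Variable b : box R n.
Hypothesis b0 : 0 < b.2.
Implicit Types (f g : Rn -> R).

(** Being constant on the dyadic subcubes of generation [k] is expressed as invariance under passing
    to the centre. *)
Definition step k g := measurable_fun setT g /\
  forall x, hbox b x -> g (ctr b k x) = g x.

Lemma stepS k g : step k g -> step k.+1 g.
Proof.
move=> [mg sg]; split=> // x bx.
by rewrite -(sg (ctr b k.+1 x)) ?ctr_ctr ?sg//; exact: ctr_in.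
Qed.

Lemma step_le k k' g : (k <= k')%N -> step k g -> step k' g.
Proof.
move=> /subnK <- sg; elim: (k' - k)%N => [//|j IH]; rewrite addSn; exact: stepS.
Qed.

Lemma step_ctr k g : step k (g \o ctr b k).
Proof.
split=> [|x bx]; first exact: measurable_fun_ctr.
rewrite /=; congr g; have [b' b'k b'x] := gen_cover k b0 bx.
rewrite (ctr_gen b0 b'k b'x) (ctr_gen b0 b'k)//.
by apply: hbox_center; exact: gen_side_gt0 b'k.
Qed.

Definition dist1 f g := (\int[mu]_(x in hbox b) `|f x - g x|%:E)%E.

(** This is the closure of the dyadic step functions in L^1 of the box; by [appr_integrable] it
    contains every integrable function. *)
Definition appr f := measurable_fun setT f /\
  forall e : R, 0 < e -> exists k g, step k g /\ (dist1 f g <= e%:E)%E.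

Lemma mhb : measurable (hbox b). Proof. exact: measurable_hbox. Qed.
Local Hint Resolve mhb : core.

Lemma measurable_hb f : measurable_fun setT f -> measurable_fun (hbox b) f.
Proof. exact: measurable_funTS. Qed.
Local Hint Resolve measurable_hb : core.

Lemma dist1_tri f g h : measurable_fun setT f -> measurable_fun setT g ->
  measurable_fun setT h -> (dist1 f h <= dist1 f g + dist1 g h)%E.
Proof.
move=> mf mg mh; apply: le_integral_EFinD => // [||| x _].
1-3: by apply: measurable_dist; exact: measurable_hb.
by rewrite -[f x - h x](subrKA (g x)) ler_normD.
Qed.

Lemma appr_lim f : measurable_fun setT f ->
  (forall e : R, 0 < e -> exists g, appr g /\ (dist1 f g <= e%:E)%E) -> appr f.
Proof.
move=> mf H; split=> // e e0; have e2 : 0 < e / 2 by lra.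
have [g [[mg ag] fg]] := H _ e2; have [k [h [sh gh]]] := ag _ e2.
exists k, h; split=> //; apply: (le_trans (dist1_tri mf mg sh.1)).
by rewrite [e in leRHS](splitr e) EFinD leeD.
Qed.

Lemma appr_step k g : step k g -> appr g.
Proof.
move=> sg; split=> [|e e0]; first exact: sg.1.
exists k, g; split=> //; rewrite /dist1.
under eq_integral do rewrite subrr normr0.
by rewrite integral0 lee_fin ltW.
Qed.

Lemma appr_cst c : appr (fun=> c).
Proof. by apply: (@appr_step 0); split=> //; exact: measurable_cst. Qed.

(* Sums and maxima both satisfy the hypothesis on [op]. *)
Lemma appr_op (op : R -> R -> R) f g :
  (forall d (T : measurableType d) (f g : T -> R), measurable_fun setT f ->
    measurable_fun setT g -> measurable_fun setT (fun x => op (f x) (g x))) ->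
  (forall a a' c c', `|op a c - op a' c'| <= `|a - a'| + `|c - c'|) ->
  appr f -> appr g -> appr (fun x => op (f x) (g x)).
Proof.
move=> mop lop [mf af] [mg ag]; split=> [|e e0]; first exact: mop.
have e2 : 0 < e / 2 by lra.
have [k1 [f1 [sf d1]]] := af _ e2; have [k2 [g1 [sg d2]]] := ag _ e2.
exists (maxn k1 k2), (fun x => op (f1 x) (g1 x)); split.
  have [m1 s1] := step_le (leq_maxl k1 k2) sf.
  have [m2 s2] := step_le (leq_maxr k1 k2) sg.
  by split=> [|x bx]; [exact: mop|rewrite s1// s2].
rewrite [e in leRHS](splitr e) EFinD; apply: (le_trans _ (leeD d1 d2)).
have [mf1 _] := sf; have [mg1 _] := sg.
apply: le_integral_EFinD => //.
- by apply: measurable_hb; apply: measurable_dist; exact: mop.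
- by apply: measurable_hb; exact: measurable_dist.
- by apply: measurable_hb; exact: measurable_dist.
Qed.

Lemma apprD f g : appr f -> appr g -> appr (fun x => f x + g x).
Proof.
apply: appr_op => [d T f' g'|a a' c c']; first exact: measurable_funD.
by rewrite opprD addrACA ler_normD.
Qed.

Lemma appr_max f g : appr f -> appr g -> appr (fun x => Num.max (f x) (g x)).
Proof.
apply: appr_op => [d T f' g'|a a' c c']; first exact: measurable_maxr.
by rewrite !maxEle; case: ifPn; case: ifPn; rewrite -?ltNge => ? ?;
  rewrite ler_norml; case: (ler0P (a - a')); case: (ler0P (c - c')) => ? ?;
  apply/andP; split; lra.
Qed.

Lemma apprZ c f : appr f -> appr (fun x => c * f x).
Proof.
move=> [mf af]; split=> [|e e0]; first exact: measurable_funM.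
have c0 : 0 < `|c| + 1 by rewrite ltr_wpDl.
have [k [g [[mg sg] fg]]] := af (e / (`|c| + 1)) (divr_gt0 e0 c0).
have mfg := measurable_hb (measurable_dist mf mg).
exists k, (fun x => c * g x); split.
  by split=> [|x bx]; [exact: measurable_funM|rewrite sg].
apply: (@le_trans _ _ (\int[mu]_(x in hbox b) ((`|c| + 1) * `|f x - g x|)%:E)%E).
  apply: le_integral_EFin => //.
  - by apply: measurable_hb; apply: measurable_dist; exact: measurable_funM.
  - by apply: measurable_funM.
  - by move=> x _; rewrite -mulrBr normrM ler_wpM2r ?lerDl.
rewrite integral_EFinZ//.
rewrite -lee_pdivlMl//; apply: le_trans fg _; rewrite lee_fin mulrC//.
Qed.

Lemma mu_hb : mu (hbox b) = (b.2 ^+ n)%:E.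
Proof. by rewrite mu_hbox// ltW. Qed.

(* The indicator of a half-space differs from its value at the centres of the
   dyadic cubes only in a thin slab. *)
Lemma appr_ray (i : 'I_n) t : appr \1_[set x : Rn | t <= x ord0 i].
Proof.
have mray : measurable [set x : Rn | t <= x ord0 i].
  rewrite (_ : mkset _ = (fun x : Rn => x ord0 i) @^-1` `[t, +oo[%classic).
    by rewrite -[X in measurable X]setTI; apply: measurable_coord.
  by apply/seteqP; split => x /=; rewrite in_itv/= andbT.
set f := \1_ _; have mf : measurable_fun setT f by exact: measurable_indic.
split=> // e e0; pose L := b.2.
(* The slab below has width 2 L / 2^k in the direction [i] and length L in the other directions,
   hence measure 2 L^n / 2^k. Off the slab, [x] and the centre of its subcube lie on the same side
   of the hyperplane. *)
have [k Hk] : exists k, 2 * L ^+ n / 2 ^+ k < e.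
  have X0 : 0 <= 2 * L ^+ n / e.
    by rewrite divr_ge0 ?mulr_ge0 ?exprn_ge0 ?ltW.
  have := truncnS_gt (2 * L ^+ n / e); set N := (Num.truncn _) => HN.
  exists N.+1; rewrite ltr_pdivrMr ?exprn_gt0// -ltr_pdivrMl// mulrC.
  apply: (lt_le_trans HN); rewrite -natrX ler_nat; exact/ltnW/ltn_expl.
exists k, (f \o ctr b k); split; first exact: step_ctr.
pose h := L / 2 ^+ k; have h0 : 0 < h by rewrite divr_gt0// exprn_gt0.
pose J (j : 'I_n) := if j == i then `[t - h, t + h] else
  `[b.1 ord0 j - L / 2, b.1 ord0 j + L / 2].
pose S : set Rn := [set x | forall j, [set` J j] (x ord0 j)].
have mS : measurable S by exact: (@measurable_rV_itv R n J).
have Hx (x : Rn) : hbox b x -> `|f x - (f \o ctr b k) x| <= \1_S x.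
  move=> bx; have := ctr_near k i b0 bx; rewrite ler_norml => /andP[h1 h2].
  have [Sx|nSx] := pselect (S x).
    rewrite indicE mem_set// /f /= !indicE.
    by case: (_ \in _); case: (_ \in _); rewrite ?subrr ?subr0 ?sub0r ?normrN ?normr0 ?normr1.
  suff -> : f x = f (ctr b k x) by rewrite subrr normr0 indicE.
  have nt : ~ (t - h <= x ord0 i <= t + h).
    move=> tx; apply: nSx => j; rewrite /J /=; case: ifPn => [/eqP ->|_].
      by rewrite in_itv.
    have /andP[c1 c2] := bx j.
    by rewrite in_itv; apply/andP; split; [|apply: ltW].
  rewrite /f !indicE; congr (_%:R); congr nat_of_bool.
  rewrite -/L -/h in h1 h2.
  suff H : (t <= x ord0 i) = (t <= ctr b k x ord0 i).
    apply/idP/idP => /set_mem tx; apply/mem_set.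
      by rewrite /= -H.
    by rewrite /= H.
  apply/idP/idP => tx; rewrite leNgt; apply/negP => tx'; apply: nt;
    clearbody h; apply/andP; split; lra.
apply: (@le_trans _ _ (\int[mu]_(x in hbox b) (\1_S x)%:E)%E).
  apply: le_integral_EFin => //.
  apply: measurable_hb; apply: measurable_dist => //; apply: measurable_fun_ctr.
rewrite integral_indic//; apply: (@le_trans _ _ (mu S)).
  by apply: le_measure; rewrite ?inE//; exact: measurableI.
rewrite (@lebesgue_rV_box R n (fun j => [set` J j])); last by move=> j; exact: measurable_itv.
rewrite (bigD1 i)//= /J eqxx lebesgue_measure_itv /= lte_fin ltrD2l gtrN//.
rewrite (eq_bigr (fun=> L%:E)); last first.
  move=> j /negPf ->; rewrite lebesgue_measure_itv /= lte_fin.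
  rewrite ltrD2l gtrN ?divr_gt0//.
  by rewrite -EFinD; congr EFin; lra.
rewrite prodEFin prodr_const -EFinB -EFinM lee_fin.
apply: le_trans (ltW Hk); rewrite cardC1 card_ord.
have -> : L ^+ n = L * L ^+ n.-1 by rewrite -exprS prednK// (leq_ltn_trans (leq0n i)).
rewrite /h; set X := L ^+ _; set Y := 2 ^+ k; rewrite le_eqVlt; apply/orP; left; apply/eqP.
by field; rewrite expf_neq0.
Qed.

(** The sets with approximable indicator form a sigma-algebra: complements come from 1 - f, finite
    unions from maxima, countable unions from L^1 limits. It contains the half-spaces, which
    generate the measurable sets. *)
Lemma appr_indic (A : set Rn) : measurable A -> appr \1_A.
Proof.
pose C := [set A : set Rn | measurable A /\ appr \1_A].
have CC A' : C A' -> C (~` A').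
  move=> [mA aA]; split; first exact: measurableC.
  rewrite (_ : \1_ _ = (fun x => 1 + (-1) * \1_A' x)).
    by apply: apprD; [exact: appr_cst|exact: apprZ].
  apply/funext => x; rewrite !indicE in_setC.
  by case: (_ \in _) => /=; lra.
have C0 : C set0 by split=> //; rewrite indic0; exact: appr_cst.
have CU A1 A2 : C A1 -> C A2 -> C (A1 `|` A2).
  move=> [m1 a1] [m2 a2]; split; first exact: measurableU.
  rewrite (_ : \1_ _ = (fun x => Num.max (\1_A1 x) (\1_A2 x))).
    exact: appr_max.
  apply/funext => x; rewrite !indicE in_setU.
  by case: (_ \in _); case: (_ \in _); rewrite /= maxEle ?lexx ?ler01 ?ler10.
have Csig : sigma_algebra setT C.
  split=> // [A' CA|F CF]; first by rewrite setTD; exact: CC.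
  have mF k : measurable (F k) by have [] := CF k.
  have mU : measurable (\bigcup_k F k) by exact: bigcup_measurable.
  split=> //; apply: appr_lim => [|e e0]; first exact: measurable_indic.
  pose G N := \big[setU/set0]_(i < N) F i.
  have CG N : C (G N) by elim/big_ind : (G N).
  have mG N : measurable (G N) by have [] := CG N.
  (* The part of the box that the first [N] sets miss decreases to the empty set, and the box has
     finite measure, so its measure tends to 0. *)
  pose D N := hbox b `&` (\bigcup_k F k `\` G N).
  have mD N : measurable (D N) by apply: measurableI => //; exact: measurableD.
  have capD : \bigcap_N D N = set0.
    rewrite -subset0 => x Dx; have [_ [[k _ Fx] _]] := Dx 0%N I.
    have [_ [_]] := Dx k.+1 I; apply; rewrite /G -bigcup_mkord.
    by exists k => //=.
  have Dcvg : mu \o D @ \oo --> 0%E.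
    rewrite -(measure0 mu) -capD; apply: nonincreasing_cvg_mu => //.
    - apply: (@le_lt_trans _ _ (mu (hbox b))); last by rewrite mu_hb ltry.
      by apply: le_measure; rewrite ?inE//; exact: subIsetl.
    - by rewrite capD.
    - move=> i j ij; apply/subsetPset; apply: setIS; apply: setDS.
      exact: subset_bigsetU.
  have [N HN] := cvge0_small Dcvg e0.
  exists (\1_(G N)); split; first by have [] := CG N.
  apply: le_trans (HN N (leqnn N)); rewrite /dist1 /= /D setIC -integral_indic//; last exact: measurableD.
  apply: le_integral_EFin => //.
  - by apply: measurable_hb; apply: measurable_dist; exact: measurable_indic.
  - by apply: measurable_hb; apply: measurable_indic; exact: measurableD.
  - move=> x _; rewrite !indicE in_setD.
    have : G N `<=` \bigcup_k F k by apply: bigsetU_bigcup.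
    case: (boolP (x \in G N)) => [xG /(_ _ (set_mem xG))/mem_set ->|_ _] /=.
      by rewrite subrr normr0.
    by rewrite subr0 andbT ger0_norm.
move=> mA; suff : C A by case.
move: A mA; apply: smallest_sub => // A; rewrite -bigcup_seq/= => -[i _ [B mB <-]].
rewrite setTI; pose C' := [set B : set R | C (@rV_coord R n i @^-1` B)].
suff : measurable `<=` C' by apply.
rewrite [X in X `<=` _](_ : _ = (@RGenCInfty.G R).-sigma.-measurable); last first.
  exact: RGenCInfty.measurableE.
apply: smallest_sub.
  have [c0 cC cU] := Csig; split.
  - by rewrite /C' /= preimage_set0.
  - by move=> B'; rewrite /C' /= setTD preimage_setC -setTD; exact: cC.
  - by move=> F CF; rewrite /C' /= preimage_bigcup; exact: cU.
move=> _ [t ->]; rewrite /C' /=.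
rewrite (_ : _ @^-1` _ = [set x : Rn | t <= x ord0 i]); last first.
  by apply/seteqP; split => x /=; rewrite in_itv/= andbT.
split; last exact: appr_ray.
have -> : [set x : Rn | t <= x ord0 i] = (fun x : Rn => x ord0 i) @^-1` `[t, +oo[%classic.
  by apply/seteqP; split => x /=; rewrite in_itv/= andbT.
by rewrite -[X in measurable X]setTI; apply: measurable_coord.
Qed.

Import HBSimple.

(** Simple functions are dense in L^1, and each is a finite combination of indicators of measurable
    sets. *)
Lemma appr_integrable f : measurable_fun setT f ->
  mu.-integrable (hbox b) (EFin \o f) -> appr f.
Proof.
move=> mf intf; apply: appr_lim => // e e0.
have [g [_ _ gf]] := approximation_sfun_integrable mhb intf.
have [N HN] := cvge0_small gf e0.
suff aN : appr (fun x : Rn => g N x).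
  by exists (fun x : Rn => g N x); split; last exact: (HN N (leqnn _)).
have H (h : {sfun Rn >-> R}) (c : nat -> R) k :
    appr (fun x => \sum_(i < k) c i * \1_(h @^-1` [set c i]) x).
  elim: k => [|k IH].
    rewrite (_ : (fun _ => _) = fun=> 0); first exact: appr_cst.
    by apply/funext => x; rewrite big_ord0.
  under eq_fun do rewrite big_ord_recr.
  apply: apprD => //; apply: apprZ; apply: appr_indic.
  by rewrite -[X in measurable X]setTI; exact: measurable_funPT.
rewrite (_ : (fun x : Rn => g N x) = fun x => \sum_(i < size (finmap.enum_fset (fset_set (range (g N)))))
   (finmap.enum_fset (fset_set (range (g N))))`_i *
   \1_((g N) @^-1` [set (finmap.enum_fset (fset_set (range (g N))))`_i]) x).
  exact: (H (g N) (nth 0 (finmap.enum_fset (fset_set (range (g N)))))).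
by apply/funext => x; exact: fimfunEord.
Qed.

End dyadic_approximation.

(** * Smooth approximation of indicator functions of cubes *)

Section flat_exponentials.
Context {R : realType}.
Implicit Types (t : R) (j : nat).

(* [t^-j exp(-1/t)] for [t > 0] and [0] for [t <= 0]; these functions are smooth
   and their span is closed under differentiation. *)
Definition flat j t : R := if 0 < t then t^-1 ^+ j * expR (- t^-1) else 0.

Lemma flat_pos j t : 0 < t -> flat j t = t^-1 ^+ j * expR (- t^-1).
Proof. by rewrite /flat => ->. Qed.

Lemma flat_npos j t : t <= 0 -> flat j t = 0.
Proof. by move=> t0; rewrite /flat ltNge t0. Qed.

Lemma flat_ge0 j t : 0 <= flat j t.
Proof.
rewrite /flat; case: ifP => // t0.
by rewrite mulr_ge0 ?expR_ge0// exprn_ge0// invr_ge0 ltW.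
Qed.

(** With s = 1/t this is s^j <= j! e^s, a single term of the exponential series. *)
Lemma flat_le j t : flat j t <= j`!%:R.
Proof.
rewrite /flat; case: ifPn => [t0|_]; last exact: ler0n.
have i0 : 0 <= t^-1 by rewrite invr_ge0 ltW.
rewrite expRN ler_pdivrMr ?expR_gt0//; case: j => [|j].
  by rewrite expr0 fact0 mul1r -expR0 ler_expR.
rewrite -ler_pdivrMl ?ltr0n ?fact_gt0// mulrC.
by apply: le_trans (expR_ge1Dxn j i0); rewrite lerDr.
Qed.

Lemma flatS j t : t * flat j.+1 t = flat j t.
Proof.
rewrite /flat; case: ifPn => [t0|_]; last by rewrite mulr0.
by rewrite exprS !mulrA divff ?mul1r// gt_eqF.
Qed.

Lemma is_derive_flat j t :
  is_derive t 1 (flat j) (flat j.+2 t - j%:R * flat j.+1 t).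
Proof.
have [t0|t0|t0] := ltrgtP t 0.
- rewrite !(flat_npos _ (ltW t0)) mulr0 subrr.
  apply: (@near_eq_is_derive R R R (cst 0)).
  near=> s; rewrite flat_npos//; apply: ltW; near: s; exact: lt_nbhsl.
- rewrite !(flat_pos _ t0).
  apply: (@near_eq_is_derive R R R
    (((fun s : R => s^-1) ^+ j) * (fun s => expR (- s^-1)))).
    near=> s; rewrite flat_pos//=; last by near: s; exact: lt_nbhsr.
    by rewrite fctE exprfctE.
  have tn0 : t != 0 by rewrite gt_eqF.
  have di : is_derive t 1 (fun s : R => s^-1) (- t ^- 2 *: 1) by apply: is_deriveV.
  have de : is_derive t 1 (fun s : R => expR (- s^-1))
      (expR (- t^-1) * (- (- t ^- 2 *: 1))).
    have dn : is_derive t 1 (fun s : R => - s^-1) (- (- t ^- 2 *: 1)) := is_deriveN di.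
    exact: (is_derive1_comp (is_derive_expR _) dn).
  have Hm := is_deriveM (is_deriveX j di) de; apply: (is_derive_eq Hm).
  rewrite exprfctE /GRing.scale /= !mulr1; case: (j) => [|k]; last first.
    by rewrite /= -!exprVn !exprS; field.
  by rewrite /= -!exprVn; ring.
- rewrite t0 !flat_npos// mulr0 subrr.
  (* At the origin the difference quotient is [flat j.+1 h], which equals [h * flat j.+2 h] and so
     is at most |h| times a constant by [flat_le]. *)
  suff H : h^-1 *: ((flat j \o shift 0) (h *: 1) - flat j 0) @[h --> 0^'] --> (0 : R).
    by apply: DeriveDef; [apply/cvg_ex; exists 0|apply: cvg_lim].
  apply/cvgr0Pnorm_lt => e e0; near=> h.
  rewrite /= addr0 [flat j 0]flat_npos// subr0 /GRing.scale /= mulr1.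
  have -> : h^-1 * flat j h = flat j.+1 h.
    by rewrite -flatS mulrA mulVf ?mul1r//; near: h; exact: nbhs_dnbhs_neq.
  rewrite -flatS ger0_norm; last by rewrite flatS flat_ge0.
  have B0 : 0 < (j.+2)`!%:R + 1 :> R by rewrite ltr_wpDl.
  have H2 : flat j.+2 h <= (j.+2)`!%:R + 1 by rewrite (le_trans (flat_le _ _))// lerDl.
  apply: (@le_lt_trans _ _ (`|h| * ((j.+2)`!%:R + 1))).
    apply: (le_trans (ler_norm _)); rewrite normrM ler_wpM2l//.
    by rewrite ger0_norm ?flat_ge0.
  rewrite -ltr_pdivlMr//; near: h; apply: dnbhs0_lt; exact: divr_gt0.
Unshelve. all: end_near. Qed.

Lemma derivable_flat j t : derivable (flat j) t 1.
Proof. by apply: ex_derive; exact: is_derive_flat. Qed.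

Lemma measurable_flat j : measurable_fun setT (flat j).
Proof.
apply: continuous_measurable_fun => t; apply: differentiable_continuous.
by apply/derivable1_diffP; exact: derivable_flat.
Qed.

End flat_exponentials.

Section smooth_class.
Context {R : realType} {n : nat}.
Local Notation Rn := 'rV[R]_n.

(** An algebra of bounded differentiable functions closed under partial derivatives. Smoothness of a
    member thus follows from first-order differentiability, by induction on the list of
    directions. *)
Inductive flatfun : (Rn -> R) -> Prop :=
| flatfun_cst c : flatfun (fun=> c)
| flatfun_flat j (i : 'I_n) a c : flatfun (fun x => flat j (a * x ord0 i + c))
| flatfunD f g : flatfun f -> flatfun g -> flatfun (fun x => f x + g x)
| flatfunM f g : flatfun f -> flatfun g -> flatfun (fun x => f x * g x).

Lemma flatfun_bounded f : flatfun f -> exists M, forall x, `|f x| <= M.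
Proof.
elim=> [c|j i a c|f' g' _ [M HM] _ [N HN]|f' g' _ [M HM] _ [N HN]].
- by exists `|c|.
- by exists (j`!)%:R => x; rewrite ger0_norm ?flat_ge0 ?flat_le.
- by exists (M + N) => x; rewrite (le_trans (ler_normD _ _))// lerD.
- by exists (M * N) => x; rewrite normrM ler_pM.
Qed.

Lemma measurable_flatfun f : flatfun f -> measurable_fun setT f.
Proof.
elim=> [c|j i a c|f' g' _ mf _ mg|f' g' _ mf _ mg].
- exact: measurable_cst.
- apply: (measurableT_comp (measurable_flat j)).
  apply: measurable_funD; last exact: measurable_cst.
  apply: measurable_funM; first exact: measurable_cst.
  exact: measurable_coord.
- exact: measurable_funD.
- exact: measurable_funM.
Qed.

Lemma differentiable_flatfun f x : flatfun f -> differentiable f x.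
Proof.
move=> sf; elim: sf => [c|j i a c|f' g' _ df _ dg|f' g' _ df _ dg].
- exact: differentiable_cst.
- apply: (@differentiable_comp _ _ _ _ (fun x : Rn => a * x ord0 i + c) (flat j)).
    apply: (@differentiableD _ _ _ (fun x : Rn => a * x ord0 i) (cst c)).
      apply: (@differentiableM _ _ (cst a) (fun x : Rn => x ord0 i)).
        exact: differentiable_cst.
      exact: differentiable_coord.
    exact: differentiable_cst.
  by apply/derivable1_diffP; exact: derivable_flat.
- exact: (differentiableD df dg).
- exact: (differentiableM df dg).
Qed.

Lemma derive_coord (k : 'I_n) (x v : Rn) : 'D_v (fun N : Rn => N ord0 k) x = v ord0 k.
Proof.
apply: cvg_lim => //.
apply: cvg_near_cst.
near=> h. rewrite /= !mxE addrK /GRing.scale /= mulrA mulVf ?mul1r//; near: h; exact: nbhs_dnbhs_neq.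
Unshelve. all: end_near. Qed.

Lemma flatfun_pderiv f i : flatfun f -> flatfun (pderiv i f).
Proof.
elim=> [c|j k a c|f' g' sf df sg dg|f' g' sf df sg dg].
- rewrite (_ : pderiv _ _ = fun=> 0); first exact: flatfun_cst.
  by apply/funext => x; rewrite /pderiv derive_cst.
- rewrite (_ : pderiv _ _ = fun x => (a * (delta_mx ord0 i : Rn) ord0 k) *
     (flat j.+2 (a * x ord0 k + c) + (- j%:R) * flat j.+1 (a * x ord0 k + c))).
    apply: flatfunM; first exact: flatfun_cst.
    apply: flatfunD; first exact: flatfun_flat.
    by apply: flatfunM; [exact: flatfun_cst|exact: flatfun_flat].
  apply/funext => x; rewrite /pderiv; pose h (x : Rn) := a * x ord0 k + c.
  have d1 : differentiable (fun x : Rn => a * x ord0 k) x.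
    apply: (@differentiableM _ _ (cst a) (fun x : Rn => x ord0 k)).
      exact: differentiable_cst.
    exact: differentiable_coord.
  have dh : differentiable h x.
    exact: (@differentiableD _ _ _ (fun x : Rn => a * x ord0 k) (cst c)).
  have dE : differentiable (flat j) (h x).
    by apply/derivable1_diffP; exact: derivable_flat.
  rewrite (deriveE _ (differentiable_comp dh dE)) diff_comp//= diff1E//.
  rewrite -(deriveE _ dh) derive1E (@derive_val _ _ _ _ _ _ _ (is_derive_flat j (h x))).
  rewrite (@deriveD _ _ _ (fun x : Rn => a * x ord0 k) (cst c) x _ (diff_derivable d1)) ?derive_cst ?addr0//.
  rewrite (@deriveM _ _ (cst a) (fun x : Rn => x ord0 k) x _ _
    (diff_derivable (differentiable_coord x ord0 k)))//.
  by rewrite derive_cst scaler0 addr0 derive_coord /GRing.scale /= mulNr.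
- rewrite (_ : pderiv _ _ = fun x => pderiv i f' x + pderiv i g' x).
    exact: flatfunD.
  apply/funext => x; rewrite /pderiv; apply: (@deriveD _ _ _ f' g');
    by apply: diff_derivable; exact: differentiable_flatfun.
- rewrite (_ : pderiv _ _ = fun x => f' x * pderiv i g' x + g' x * pderiv i f' x).
    by apply: flatfunD; apply: flatfunM.
  apply/funext => x; rewrite /pderiv; apply: (@deriveM _ _ f' g');
    by apply: diff_derivable; exact: differentiable_flatfun.
Qed.

Lemma flatfun_pderivs s f : flatfun f -> flatfun (pderivs s f).
Proof. by elim: s => [//|i s IH] sf /=; apply: flatfun_pderiv; exact: IH. Qed.

Lemma flatfun_smooth f : flatfun f -> smooth f.
Proof. by move=> sf s x; apply: differentiable_flatfun; exact: flatfun_pderivs. Qed.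

Lemma compact_cube (c : Rn) l : compact (cube c l).
Proof.
rewrite cubeE; apply: (@rV_compact R n (fun i => [set` `[c ord0 i - l / 2, c ord0 i + l / 2]])) => i.
exact: segment_compact.
Qed.

Lemma closed_cube (c : Rn) l : closed (cube c l).
Proof. by apply: compact_closed; [exact: norm_hausdorff|exact: compact_cube]. Qed.

Lemma pderivs_supp s (f : Rn -> R) c l : (forall x, ~ cube c l x -> f x = 0) ->
  forall x, ~ cube c l x -> pderivs s f x = 0.
Proof.
elim: s => [//|i s IH] f0 x nx /=; rewrite /pderiv.
rewrite (@near_eq_derive _ _ _ _ (cst 0)) ?derive_cst//.
have : nbhs x (~` cube c l).
  by apply: open_nbhs_nbhs; split=> //; apply: closed_openC; exact: closed_cube.
by apply: filterS => y ny /=; rewrite IH.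
Qed.

Lemma flatfun_Cc (f : Rn -> R[i]) c l : flatfun (fun x => complex.Re (f x)) ->
  flatfun (fun x => complex.Im (f x)) -> (forall x, ~ cube c l x -> f x = 0) ->
  Cc_infty f /\ csupp f `<=` cube c l.
Proof.
move=> sr si f0; have supp : csupp f `<=` cube c l.
  rewrite [X in _ `<=` X](closure_id _).1; last exact: closed_cube.
  apply: closure_subset => x /= /eqP fx; apply: contrapT => nx; exact/fx/f0.
split=> //; split; first by split; exact: flatfun_smooth.
by apply: (subclosed_compact _ (@compact_cube c l)) => //; exact: closed_closure.
Qed.

Lemma flatfun_schwartz (f : Rn -> R[i]) c l : flatfun (fun x => complex.Re (f x)) ->
  flatfun (fun x => complex.Im (f x)) -> (forall x, ~ cube c l x -> f x = 0) ->
  schwartz f.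
Proof.
move=> sr si f0; split; first by split; exact: flatfun_smooth.
move=> a s.
have [M HM] := flatfun_bounded (flatfun_pderivs s sr).
have [N HN] := flatfun_bounded (flatfun_pderivs s si).
exists ((\prod_(i < n) (`|c ord0 i| + `|l| / 2) ^+ a i) * (M + N)) => x.
have MN : cabs (cpderivs s f x) <= M + N.
  by apply: (le_trans (cabs_le_ReIm _)); apply: lerD; [exact: HM|exact: HN].
have P0 : 0 <= \prod_(i < n) (`|c ord0 i| + `|l| / 2) ^+ a i.
  by apply: prodr_ge0 => i _; rewrite exprn_ge0// addr_ge0// divr_ge0.
have [cx|nx] := pselect (cube c l x); last first.
  have -> : cpderivs s f x = 0.
    by rewrite /cpderivs !(@pderivs_supp _ _ c l)// => y ny; rewrite f0.
  by rewrite cabs0 mulr0 mulr_ge0//; exact: le_trans (cabs_ge0 _) MN.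
apply: ler_pM => //; first exact: cabs_ge0.
rewrite /monomial normr_prod; apply: ler_prod => i _; rewrite normr_ge0/= normrX.
rewrite lerXn2r ?nnegrE// ?addr_ge0 ?divr_ge0//.
rewrite -[x ord0 i](subrK (c ord0 i)) addrC.
apply: (le_trans (ler_normD _ _)); rewrite lerD2l (le_trans (cx i))//.
by rewrite ler_pM2r ?invr_gt0// ler_norm.
Qed.

Lemma flatfun_prod (I : Type) (s : seq I) (F : I -> Rn -> R) :
  (forall i, flatfun (F i)) -> flatfun (fun x => \prod_(i <- s) F i x).
Proof.
move=> sF; elim: s => [|i s IH].
  rewrite (_ : (fun _ => _) = fun=> 1); first exact: flatfun_cst.
  by apply/funext => x; rewrite big_nil.
by under eq_fun do rewrite big_cons; exact: flatfunM.
Qed.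

(** For each face of the cube there is a factor exp(-1/((N+1) d)), where d is the distance to the
    face, and 0 beyond the face. On the open cube the product tends to 1 as [N] grows. *)
Definition bump (c : Rn) l (N : nat) (x : Rn) : R := \prod_(i < n)
  (flat 0 (N.+1%:R * x ord0 i + N.+1%:R * (l / 2 - c ord0 i)) *
   flat 0 (- N.+1%:R * x ord0 i + N.+1%:R * (c ord0 i + l / 2))).

Lemma bump_flatfun c l N : flatfun (bump c l N).
Proof. by apply: flatfun_prod => i; apply: flatfunM; exact: flatfun_flat. Qed.

Lemma bump_ge0 c l N x : 0 <= bump c l N x.
Proof. by apply: prodr_ge0 => i _; rewrite mulr_ge0 ?flat_ge0. Qed.

Lemma bump_le1 c l N x : bump c l N x <= 1.
Proof.
apply: prodr_ile1 => i _; rewrite mulr_ge0 ?flat_ge0//=.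
by rewrite -[leRHS]mulr1 ler_pM ?flat_ge0//; exact: flat_le.
Qed.

Lemma bump_out c l N x : ~ obox c l x -> bump c l N x = 0.
Proof.
move=> /existsNP[i /negP]; rewrite negb_and -!leNgt => H.
have N0 : 0 < N.+1%:R :> R by [].
apply/eqP/prodf_eq0; exists i => //; rewrite mulf_eq0.
case/orP: H => H; apply/orP; [left|right]; apply/eqP/flat_npos.
  by rewrite -mulrDr pmulr_rle0//; lra.
by rewrite mulNr addrC -mulrBr pmulr_rle0//; lra.
Qed.

(** Inside the open cube the product is exp(-w/(N+1)), where w is the sum of the reciprocal
    distances to the faces; then e^(-a) >= 1 - a. *)
Lemma bump_in c l x : obox c l x -> exists w, forall N, 1 - w / N.+1%:R <= bump c l N x.
Proof.
move=> ox; pose w i := (x ord0 i - c ord0 i + l / 2)^-1 + (c ord0 i + l / 2 - x ord0 i)^-1.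
exists (\sum_(i < n) w i) => N; have N0 : 0 < N.+1%:R :> R by [].
apply: (@le_trans _ _ (expR (- (\sum_(i < n) w i / N.+1%:R)))).
  by rewrite -mulr_suml expR_ge1Dx.
rewrite -sumrN (big_morph _ (@expRD R) (@expR0 R)) le_eqVlt; apply/orP; left; apply/eqP.
apply: eq_bigr => i _; have /andP[a1 a2] := ox i.
have b1 : 0 < x ord0 i - c ord0 i + l / 2 by lra.
have b2 : 0 < c ord0 i + l / 2 - x ord0 i by lra.
rewrite (_ : _ + N.+1%:R * (l / 2 - _) = N.+1%:R * (x ord0 i - c ord0 i + l / 2)); last by ring.
rewrite (_ : - _ * _ + _ = N.+1%:R * (c ord0 i + l / 2 - x ord0 i)); last by ring.
rewrite !flat_pos ?mulr_gt0// !expr0 !mul1r -expRD; congr expR; rewrite /w.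
clearbody w; field; apply/and3P; split; apply: lt0r_neq0; [lra| |lra].
by rewrite ltr_pwDl.
Qed.

End smooth_class.

Section smooth_approximation.
Context {R : realType} {n : nat}.
Local Notation Rn := 'rV[R]_n.
Local Notation mu := (lebesgue_rV R n).

(** Dominated convergence gives L^1 approximation of the indicator of the open cube; the half-open
    cube has the same finite measure, so the difference of the two is null. *)
Lemma smooth_box (c : Rn) l (e : R) : 0 < l -> 0 < e -> exists phi : Rn -> R,
  [/\ flatfun phi, forall x, 0 <= phi x <= 1, forall x, ~ cube c l x -> phi x = 0 &
   (\int[mu]_x `|\1_(hbox (c, l)) x - phi x|%:E <= e%:E)%E].
Proof.
move=> l0 e0.
have mo := @measurable_obox R n c l.
have mu_o : mu (obox c l) = (l ^+ n)%:E by rewrite mu_obox// ltW.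
have [] := @dominated_convergence _ Rn R mu setT measurableT
   (fun N x => (bump c l N x)%:E) (fun x => (\1_(obox c l) x)%:E)
   (fun x => (\1_(obox c l) x)%:E).
- by move=> N; apply/measurable_EFinP; apply: measurable_flatfun; exact: bump_flatfun.
- by apply/measurable_EFinP; exact: measurable_indic.
- apply: aeW => x _; apply: cvg_EFin; first by near=> N.
  have [ox|nx] := pselect (obox c l x); last first.
    rewrite indicE memNset//= (_ : _ \o _ = cst 0); first exact: cvg_cst.
    by apply/funext => N /=; rewrite bump_out.
  rewrite indicE mem_set//=; have [w Hw] := bump_in ox.
  apply/cvgrPdist_le => r r0; near=> N => /=.
  rewrite ger0_norm ?subr_ge0 ?bump_le1// lerBlDl -lerBlDr.
  apply: le_trans (Hw N); rewrite lerD2l lerN2 ler_pdivrMr//.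
  rewrite -ler_pdivrMl//; apply: ltW; rewrite (@lt_le_trans _ _ N%:R) ?ler_nat//.
  near: N; exact: nbhs_infty_gtr.
- apply/integrableP; split; first by apply/measurable_EFinP; exact: measurable_indic.
  under eq_integral do rewrite /= ger0_norm//.
  rewrite integral_indic// setIT; suff: (mu (obox c l) < +oo)%E by [].
  by rewrite mu_o ltry.
- by apply: aeW => x N _; rewrite /= lee_fin indicE ger0_norm ?bump_ge0//;
   have [ox|nx] := pselect (obox c l x); [rewrite mem_set//= bump_le1|rewrite bump_out].
move=> _ cv _; have [N HN] := cvge0_small cv e0.
exists (bump c l N); split.
- exact: bump_flatfun.
- by move=> x; rewrite bump_ge0 bump_le1.
- by move=> x nx; apply: bump_out => ox; apply: nx; exact: (@hbox_cube _ _ (c, l) x (obox_hbox ox)).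
- apply: le_trans (HN N (leqnn N)); rewrite /=.
  have mb : measurable_fun setT (bump c l N) by apply: measurable_flatfun; exact: bump_flatfun.
  have ho := @measurable_hbox R n (c, l).
  have D0 : mu (hbox (c, l) `\` obox c l) = 0%E.
    have hl : mu (hbox (c, l)) = (l ^+ n)%:E by rewrite mu_hbox//= ltW.
    have hlt : (mu (hbox (c, l)) < +oo)%E by rewrite hl ltry.
    have I0 : hbox (c, l) `&` obox c l = obox c l by apply/setIidr; exact: obox_hbox.
    have -> : mu (hbox (c, l) `\` obox c l) =
        (mu (hbox (c, l)) - mu (hbox (c, l) `&` obox c l))%E.
      by apply: measureD => //; exact: hlt.
    by rewrite I0 hl mu_o -EFinB subrr.
  have := @le_integral_EFinD _ _ _ mu setT (fun x => `|\1_(hbox (c, l)) x - bump c l N x|)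
    (fun x => `|bump c l N x - \1_(obox c l) x|) (\1_(hbox (c,l) `\` obox c l)).
  have E : (\int[mu]_x (\1_(hbox (c, l) `\` obox c l) x)%:E = 0)%E.
    by rewrite integral_indic//; [rewrite setIT; exact: D0|exact: measurableD].
  have Hx (x : Rn) : `|\1_(hbox (c, l)) x - bump c l N x| <=
     `|bump c l N x - \1_(obox c l) x| + \1_(hbox (c, l) `\` obox c l) x.
    rewrite !indicE in_setD; have [ox|nx] := pselect (obox c l x).
      have hx := obox_hbox ox.
      by rewrite (mem_set ox) (mem_set hx) /= addr0 distrC.
    rewrite bump_out// (memNset nx) subr0 subrr normr0 add0r andbT.
    by case: (_ \in _); rewrite ?normr1 ?normr0.
  rewrite E adde0; apply => //.
  - by apply: measurable_dist => //; exact: measurable_indic.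
  - by apply: measurable_dist => //; exact: measurable_indic.
  - by apply: measurable_indic; exact: measurableD.
Unshelve. all: end_near. Qed.

End smooth_approximation.

(** * Measure estimates, distances and complex integrals *)

Section measure_bounds.
Context {R : realType} d (T : measurableType d) (m : {measure set T -> \bar R}).

Lemma markov_le (D : set T) (f : T -> R) (a s : R) : measurable D ->
  measurable_fun D f -> (forall x, D x -> 0 <= f x) -> 0 < s ->
  (\int[m]_(x in D) (f x)%:E <= a%:E)%E ->
  (m (D `&` [set x | (s < f x)%R]) <= (a / s)%:E)%E.
Proof.
move=> mD mf f0 s0 fa; set E := D `&` _.
have mE : measurable E.
  have -> : E = D `&` f @^-1` `]s, +oo[%classic.
    by apply/seteqP; split => x [Dx] /=; rewrite ?in_itv /= ?andbT => ?; split => //=;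
      rewrite in_itv /= ?andbT.
  exact: mf.
rewrite (_ : a / s = s^-1 * a); last by rewrite mulrC.
rewrite EFinM lee_pdivlMl//; apply: le_trans fa.
rewrite -integral_cst//; apply: (@le_trans _ _ (\int[m]_(x in E) (f x)%:E)%E).
  apply: le_integral_EFin => //.
  - by apply: measurable_funS mf => //; exact: subIsetl.
  - by move=> x _; exact: ltW.
  - by move=> x [_ /ltW].
apply: ge0_subset_integral => //.
- exact/measurable_EFinP.
- exact: subIsetl.
Qed.

Lemma ae_le_measure (A B : set T) : measurable A -> measurable B ->
  {ae m, forall x, A x -> B x} -> (m A <= m B)%E.
Proof.
move=> mA mB AB.
have H C : measurable C -> m C = (\int[m]_x (\1_C x)%:E)%E.
  by move=> mC; rewrite integral_indic// setIT.
rewrite !H//; apply: ae_ge0_le_integral => //.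
- by apply/measurable_EFinP; exact: measurable_indic.
- by apply/measurable_EFinP; exact: measurable_indic.
- apply: filterS AB => x AB _; rewrite lee_fin !indicE ler_nat.
  by case: (boolP (x \in A)) => // /set_mem/AB/mem_set ->.
Qed.

Lemma ae_le_measureU (A B C : set T) : measurable A -> measurable B -> measurable C ->
  {ae m, forall x, A x -> B x \/ C x} -> (m A <= m B + m C)%E.
Proof.
move=> mA mB mC H; apply: (@le_trans _ _ (m (B `|` C))).
  by apply: ae_le_measure => //; exact: measurableU.
exact: measureU2.
Qed.

(** [A] itself may fail to be measurable; the intersection of the covers for e = 1/(k+1) is a
    measurable null set containing it. *)
Lemma null_small (A : set T) :
  (forall e : R, 0 < e -> exists2 B, measurable B /\ (m B <= e%:E)%E & A `<=` B) ->
  m.-negligible A.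
Proof.
move=> H; have H' k : exists B, [/\ measurable B, (m B <= (k.+1%:R^-1)%:E)%E & A `<=` B].
  by have [|B [? ?] ?] := H k.+1%:R^-1; [rewrite invr_gt0|exists B].
pose F k := sval (cid (H' k)); have HF k := svalP (cid (H' k)).
exists (\bigcap_k F k); split.
- by apply: bigcapT_measurable => k; have [] := HF k.
- apply/eqP; rewrite eq_le measure_ge0 andbT; apply/lee_addgt0Pr => e e0.
  rewrite add0e; have [k ke] : exists k : nat, k.+1%:R^-1 < e.
    exists (Num.truncn e^-1); rewrite -[ltRHS]invrK ltf_pV2 ?posrE ?invr_gt0//.
    exact: truncnS_gt.
  have [mF Fk _] := HF k; apply: (le_trans _ (le_trans Fk _)).
    apply: le_measure; rewrite ?inE//.
      by apply: bigcapT_measurable => j; have [] := HF j.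
    by move=> x; apply.
  by rewrite lee_fin ltW.
- by move=> x Ax k _; have [_ _] := HF k; apply.
Qed.

Definition lvl (s : R) (h : T -> R[i]) := [set x | s < cabs (h x)].

Lemma measurable_lvl s h : cmeasurable setT h -> measurable (lvl s h).
Proof.
move=> mh; rewrite (_ : lvl _ _ = (fun x => cabs (h x)) @^-1` `]s, +oo[%classic).
  by rewrite -[X in measurable X]setTI; apply: measurable_cabs.
by apply/seteqP; split => x /=; rewrite in_itv/= andbT.
Qed.

Lemma lvl_tri (s t : R) (h h1 h2 : T -> R[i]) : cmeasurable setT h ->
  cmeasurable setT h1 -> cmeasurable setT h2 ->
  {ae m, forall x, h x = h1 x + h2 x} ->
  (m (lvl (s + t) h) <= m (lvl s h1) + m (lvl t h2))%E.
Proof.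
move=> mh mh1 mh2 hE; apply: ae_le_measureU; rewrite ?inE; try exact: measurable_lvl.
apply: filterS hE => x hE; rewrite /lvl /= hE => st.
have := cabsD (h1 x) (h2 x); have [|h1s] := ltP s (cabs (h1 x)); first by left.
have [|h2s _] := ltP t (cabs (h2 x)); first by right.
have := cabsD (h1 x) (h2 x); lra.
Qed.

End measure_bounds.

Section euclidean_norm.
Context {R : realType} {n : nat}.
Implicit Types (x y : 'rV[R]_n) (r : R).

Lemma coord_le_enorm x i : `|x ord0 i| <= enorm x.
Proof.
rewrite /enorm -sqrtr_sqr ler_wsqrtr// (bigD1 i)//= lerDl.
by apply: sumr_ge0 => j _; exact: sqr_ge0.
Qed.

Lemma enorm_le x r : 0 <= r -> (forall i, `|x ord0 i| <= r) -> enorm x <= n%:R * r.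
Proof.
move=> r0 H; rewrite /enorm -[leRHS]ger0_norm ?mulr_ge0// -sqrtr_sqr ler_wsqrtr//.
apply: (@le_trans _ _ (\sum_(i < n) r ^+ 2)).
  apply: ler_sum => i _; rewrite -[leLHS]real_normK ?num_real//.
  by rewrite lerXn2r ?nnegrE.
rewrite sumr_const card_ord -[_ *+ n]mulr_natl exprMn ler_wpM2r ?sqr_ge0//.
by rewrite -natrX ler_nat; case: (n) => // k; rewrite expnS leq_pmulr// expn_gt0.
Qed.

(** Distance in the sup norm, because it is compared with cubes; [far_enorm] transfers the lower
    bound to the Euclidean norm of the kernel estimates. *)
Definition far (r : R) x y := exists i, r <= `|x ord0 i - y ord0 i|.

Lemma far_enorm r x y : far r x y -> r <= enorm (x - y).
Proof.
by move=> [i ri]; apply: (le_trans ri); have := coord_le_enorm (x - y) i; rewrite !mxE.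
Qed.

Lemma far_neq r x y : 0 < r -> far r x y -> x != y.
Proof.
move=> r0 [i ri]; apply/eqP => xy; move: ri; rewrite xy subrr normr0.
by rewrite leNgt r0.
Qed.

Lemma far_sym r x y : far r x y -> far r y x.
Proof. by case=> i ri; exists i; rewrite distrC. Qed.

Lemma notin_cube (c x : 'rV[R]_n) l : ~ cube c l x -> far (l / 2) x c.
Proof. by move=> /existsNP[i /negP]; rewrite -ltNge => /ltW ?; exists i. Qed.

End euclidean_norm.

Section complex_integrals.
Context {R : realType} {n : nat}.
Local Notation Rn := 'rV[R]_n.
Local Notation mu := (lebesgue_rV R n).
Implicit Types (f g h : Rn -> R[i]) (D : set Rn).

Definition L1n D f : \bar R := (\int[mu]_(x in D) (cabs (f x))%:E)%E.

Lemma L1n_ge0 D f : (0 <= L1n D f)%E.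
Proof. by apply: integral_ge0 => x _; rewrite lee_fin cabs_ge0. Qed.

Lemma cintegrable_bound D f (g : Rn -> R) : measurable D -> cmeasurable D f ->
  measurable_fun D g -> (forall x, D x -> cabs (f x) <= g x) ->
  (\int[mu]_(x in D) (g x)%:E < +oo)%E -> cintegrable D f.
Proof.
move=> mD [f1 f2] mg fg gi; have g0 x : D x -> 0 <= g x.
  by move=> Dx; apply: le_trans (fg _ Dx); exact: cabs_ge0.
have H (k : Rn -> R) : measurable_fun D k -> (forall x, D x -> `|k x| <= g x) ->
    mu.-integrable D (EFin \o k).
  move=> mk kg; apply/integrableP; split; first exact/measurable_EFinP.
  apply: le_lt_trans gi; apply: ge0_le_integral => //.
  - by apply/measurableT_comp => //; exact/measurable_EFinP.
  - exact/measurable_EFinP.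
split; apply: H => // x Dx; apply: le_trans (fg x Dx).
  exact: Re_le_cabs.
exact: Im_le_cabs.
Qed.

Lemma cintegrable_L1n D f : measurable D -> cmeasurable D f -> (L1n D f < +oo)%E ->
  cintegrable D f.
Proof.
by move=> mD mf fi; apply: (cintegrable_bound mD mf _ _ fi) => //; exact: measurable_cabs.
Qed.

(** The factor 2 arises from bounding the real and imaginary parts separately by [a]. *)
Lemma cabs_cintegral D f (g : Rn -> R) a : measurable D -> cmeasurable D f ->
  measurable_fun D g -> (forall x, D x -> cabs (f x) <= g x) ->
  (\int[mu]_(x in D) (g x)%:E <= a%:E)%E -> cabs (cintegral D f) <= 2 * a.
Proof.
move=> mD mf mg fg ga; have gi := le_lt_trans ga (ltry a).
have [i1 i2] := cintegrable_bound mD mf mg fg gi.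
apply: (le_trans (cabs_le_ReIm _)); rewrite /=.
have H (k : Rn -> R) : mu.-integrable D (EFin \o k) ->
    (forall x, D x -> `|k x| <= g x) -> `|\int[mu]_(x in D) k x| <= a.
  move=> ki kg; rewrite -lee_fin EFin_normr_Rintegral//.
  apply: (le_trans (le_abse_integral mu mD (measurable_int _ ki))).
  apply: le_trans ga; apply: ge0_le_integral => //.
  - by apply/measurableT_comp => //; exact: measurable_int ki.
  - exact/measurable_EFinP.
rewrite (_ : 2 * a = a + a); last by ring.
apply: lerD; apply: H => // x Dx; apply: le_trans (fg x Dx).
  exact: Re_le_cabs.
exact: Im_le_cabs.
Qed.

Lemma cintegral_lin D (c : R[i]) f g : measurable D -> cintegrable D f ->
  cintegrable D g -> cintegral D (fun x => c * f x + g x) = c * cintegral D f + cintegral D g.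
Proof.
move=> mD [f1 f2] [g1 g2]; case: c => a b; rewrite /cintegral.
have Z (k : R) (h : Rn -> R) : mu.-integrable D (EFin \o h) ->
    mu.-integrable D (EFin \o (fun x => k * h x)).
  by move=> ih; have := integrableZl mD k ih.
have ZB (h k : Rn -> R) : mu.-integrable D (EFin \o h) -> mu.-integrable D (EFin \o k) ->
    mu.-integrable D (EFin \o (fun x => h x - k x)).
  by move=> ih ik; exact: (integrableB mD ih ik).
have ZD (h k : Rn -> R) : mu.-integrable D (EFin \o h) -> mu.-integrable D (EFin \o k) ->
    mu.-integrable D (EFin \o (fun x => h x + k x)).
  by move=> ih ik; exact: (integrableD mD ih ik).
have E1 : \int[mu]_(x in D) complex.Re (Complex a b * f x + g x) =
    a * \int[mu]_(x in D) complex.Re (f x) - b * \int[mu]_(x in D) complex.Im (f x)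
    + \int[mu]_(x in D) complex.Re (g x).
  under eq_Rintegral do rewrite ReD ReM /=.
  rewrite RintegralD//; last by apply: ZB; exact: Z.
  by rewrite RintegralB ?RintegralZl//; exact: Z.
have E2 : \int[mu]_(x in D) complex.Im (Complex a b * f x + g x) =
    a * \int[mu]_(x in D) complex.Im (f x) + b * \int[mu]_(x in D) complex.Re (f x)
    + \int[mu]_(x in D) complex.Im (g x).
  under eq_Rintegral do rewrite ImD ImM /=.
  rewrite RintegralD//; last by apply: ZD; exact: Z.
  by rewrite RintegralD ?RintegralZl//; exact: Z.
by rewrite E1 E2.
Qed.

Lemma eq_cintegral D f g : (forall x, D x -> f x = g x) -> cintegral D f = cintegral D g.
Proof.
move=> fg; rewrite /cintegral; congr Complex; apply: eq_Rintegral => x;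
  by rewrite inE => /fg ->.
Qed.

(** A class on which both estimates make sense: such functions lie in L^2, where [T2] is linear and
    bounded, and in L^1, where the weak type inequality is stated. *)
Definition bdint f := [/\ cmeasurable setT f, exists M, forall x, cabs (f x) <= M &
  (L1n setT f < +oo)%E].

Lemma L1nD D f g : measurable D -> cmeasurable D f -> cmeasurable D g ->
  (L1n D (fun x => (f x + g x)%R) <= L1n D f + L1n D g)%E.
Proof.
move=> mD mf mg; apply: le_integral_EFinD => //; try exact: measurable_cabs.
- by apply: measurable_cabs; exact: cmeasurableD.
- by move=> x _; exact: cabs_ge0.
- by move=> x _; exact: cabs_ge0.
- by move=> x _; exact: cabs_ge0.
- by move=> x _; exact: cabsD.
Qed.

Lemma L1nZ D c f : measurable D -> cmeasurable D f ->
  (L1n D (fun x => (c * f x)%R) = (cabs c)%:E * L1n D f)%E.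
Proof.
move=> mD mf; rewrite /L1n; under eq_integral do rewrite cabsM.
by apply: integral_EFinZ => //; [exact: measurable_cabs|move=> x _; exact: cabs_ge0|exact: cabs_ge0].
Qed.

Lemma bdint_lin c f g : bdint f -> bdint g -> bdint (fun x => c * f x + g x).
Proof.
move=> [mf [M HM] fi] [mg [N HN] gi].
have mcf : cmeasurable setT (fun x => c * f x).
  by apply: cmeasurableM => //; exact: cmeasurable_cst.
split.
- exact: cmeasurableD.
- exists (cabs c * M + N) => x; apply: (le_trans (cabsD _ _)); rewrite lerD// cabsM.
  by rewrite ler_wpM2l ?cabs_ge0.
- apply: (le_lt_trans (L1nD measurableT mcf mg)); rewrite L1nZ//.
  by apply: lte_add_pinfty => //; apply: lte_mul_pinfty; rewrite ?lee_fin ?cabs_ge0.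
Qed.

Lemma bdint0 : bdint (fun=> 0).
Proof.
split; first exact: cmeasurable_cst.
- by exists 0 => x; rewrite cabs0.
- by rewrite /L1n; under eq_integral do rewrite cabs0; rewrite integral0.
Qed.

Lemma subE f g : (fun x => f x - g x) = (fun x => -1 * g x + f x).
Proof. by apply/funext => x; rewrite mulN1r addrC. Qed.

Lemma bdintB f g : bdint f -> bdint g -> bdint (fun x => f x - g x).
Proof. by move=> bf bg; rewrite subE; exact: bdint_lin. Qed.

Lemma cLnorm1E f : cLnorm 1 f = L1n setT f.
Proof. by rewrite /cLnorm Lnorm1; under eq_integral do rewrite /= ger0_norm ?cabs_ge0//. Qed.

Lemma cLnorm2E f : (cLnorm 2 f `^ 2 = \int[mu]_x ((cabs (f x)) ^+ 2)%:E)%E.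
Proof.
rewrite /cLnorm poweR_Lnorm; last by rewrite pnatr_eq0.
apply: eq_integral => x _ /=; rewrite ger0_norm ?cabs_ge0//.
by rewrite -powR_mulrn ?cabs_ge0.
Qed.

Lemma L2_bound f M a : cmeasurable setT f -> (forall x, cabs (f x) <= M) ->
  (L1n setT f <= a%:E)%E ->
  (\int[mu]_x ((cabs (f x)) ^+ 2)%:E <= (M * a)%:E)%E.
Proof.
move=> mf HM fa; have M0 : 0 <= M := le_trans (cabs_ge0 _) (HM 0).
apply: (@le_trans _ _ (\int[mu]_x (M * cabs (f x))%:E)%E).
  apply: le_integral_EFin => //.
  - by apply: measurable_funX; exact: measurable_cabs.
  - by apply: measurable_funM => //; exact: measurable_cabs.
  - by move=> x _; rewrite sqr_ge0.
  - by move=> x _; rewrite expr2 ler_wpM2r ?cabs_ge0.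
rewrite integral_EFinZ//; first by rewrite EFinM lee_wpmul2l.
  exact: measurable_cabs.
by move=> x _; exact: cabs_ge0.
Qed.

Lemma bdint_L2 f : bdint f -> in_Lp 2 f.
Proof.
move=> [mf [M HM] fi]; split=> //.
have ff : (L1n setT f <= (fine (L1n setT f))%:E)%E by rewrite fineK// ge0_fin_numE// L1n_ge0.
have H := le_lt_trans (L2_bound mf HM ff) (ltry _).
have := poweR_lty 2^-1 H; rewrite -cLnorm2E -poweRrM mulfV ?pnatr_eq0// poweRe1//.
by rewrite /cLnorm Lnorm_ge0.
Qed.

End complex_integrals.

(** * The operator on bounded integrable functions *)

(** This identifies limits in measure. The sets where |F - G| > 1/(k+1) are negligible by
    [null_small], and their union is the set where the functions differ. *)
Lemma ae_eq_small {R : realType} d (T : measurableType d)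
    (m : {measure set T -> \bar R}) (S : set T) (F G : T -> R[i]) :
  (forall t e : R, 0 < t -> 0 < e -> exists2 B, measurable B /\ (m B <= e%:E)%E &
     {ae m, forall x, S x -> t < cabs (F x - G x) -> B x}) ->
  {ae m, forall x, S x -> F x = G x}.
Proof.
move=> H.
have N t : 0 < t -> m.-negligible [set x | S x /\ t < cabs (F x - G x)].
  move=> t0; apply: null_small => e e0.
  have [B [mB Be] [N [mN N0 BN]]] := H _ _ t0 e0.
  exists (B `|` N); first split.
  - exact: measurableU.
  - apply: (le_trans (measureU2 _ _ _)) => //.
    by rewrite [X in (_ + X)%E]N0 adde0.
  - move=> x [Sx tx]; have [Bx|nBx] := pselect (B x); first by left.
    by right; apply: BN => /= h; exact/nBx/h.
apply: (negligibleS _ (negligible_bigcup (fun k => N k.+1%:R^-1 _))) => [|k].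
  move=> x /= /not_implyP[Sx /eqP]; rewrite -subr_eq0 => FG.
  have c0 : 0 < cabs (F x - G x).
    rewrite lt_neqAle cabs_ge0 andbT eq_sym.
    by apply: contra_neq FG; exact: Normc.eq0_normc.
  exists (Num.truncn (cabs (F x - G x))^-1) => //; split=> //.
  by rewrite -[ltRHS]invrK ltf_pV2 ?posrE ?invr_gt0// truncnS_gt.
by rewrite invr_gt0.
Qed.

Section operators.
Context {R : realType} {n : nat}.
Local Notation Rn := 'rV[R]_n.
Local Notation mu := (lebesgue_rV R n).
Implicit Types (f g h : Rn -> R[i]) (x y : Rn) (S : set Rn).

(** The hypotheses with named constants. The Dini condition enters as a bound [Sth] for the sums of
    theta(2^-k), the form in which summation over dyadic annuli produces it. *)
Record cz_operator (A CK Sth : R) (theta : R -> R) (T2 : (Rn -> R[i]) -> Rn -> R[i])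
    (K : Rn -> Rn -> R[i]) : Prop := CZOperator {
  cz_n : (0 < n)%N;
  cz_lin : forall (c : R[i]) f g, in_Lp 2 f -> in_Lp 2 g ->
    {ae mu, forall x, T2 (fun y => c * f y + g y) x = c * T2 f x + T2 g x};
  cz_A : 0 <= A;
  cz_bd : forall f, in_Lp 2 f ->
    in_Lp 2 (T2 f) /\ (cLnorm 2 (T2 f) <= A%:E * cLnorm 2 f)%E;
  cz_mK : cmeasurable [set xy : Rn * Rn | xy.1 != xy.2] (fun xy => K xy.1 xy.2);
  cz_CK : 0 < CK;
  cz_size : forall x y, x != y -> cabs (K x y) <= CK * enorm (x - y) ^- n;
  cz_smooth : forall x y z, 0 < enorm (x - z) -> enorm (x - z) < enorm (x - y) / 2 ->
    cabs (K x y - K z y) + cabs (K y x - K y z)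
      <= CK * enorm (x - y) ^- n * theta (enorm (x - z) / enorm (x - y));
  cz_rep : forall f, Cc_infty f -> {ae mu, forall x, ~ csupp f x ->
    T2 f x = cintegral setT (fun y => K x y * f y)};
  cz_th0 : forall t, 0 < t -> 0 <= theta t;
  cz_thle : forall s t, 0 < s -> s <= t -> theta s <= theta t;
  cz_S : forall N, \sum_(k < N) theta (2 ^- k) <= Sth
}.

Context {A CK Sth : R} {theta : R -> R} {T2 : (Rn -> R[i]) -> Rn -> R[i]}
  {K : Rn -> Rn -> R[i]}.
Hypothesis cz : cz_operator A CK Sth theta T2 K.

Lemma T2m f : bdint f -> cmeasurable setT (T2 f).
Proof. by move=> bf; have [[]] := cz_bd cz (bdint_L2 bf). Qed.

(** Chebyshev's inequality for the L^2 bound, using that the integral of |f|^2 is at most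
    [M * a]. *)
Lemma T2cheb f M a s : bdint f -> (forall x, cabs (f x) <= M) ->
  (L1n setT f <= a%:E)%E -> 0 < s ->
  (mu (lvl s (T2 f)) <= (A ^+ 2 * (M * a) / s ^+ 2)%:E)%E.
Proof.
move=> bf HM fa s0; have [mf _ _] := bf; have mT := T2m bf.
have [_ le] := cz_bd cz (bdint_L2 bf).
have E : lvl s (T2 f) = setT `&` [set x | s ^+ 2 < cabs (T2 f x) ^+ 2].
  rewrite setTI; apply/seteqP; split => x; rewrite /lvl /=;
    by rewrite ltr_pXn2r ?nnegrE ?cabs_ge0 ?(ltW s0).
rewrite E; apply: markov_le => //.
- by apply: measurable_funX; exact: measurable_cabs.
- by move=> x _; exact: sqr_ge0.
- exact: exprn_gt0.
- rewrite -cLnorm2E; apply: (@le_trans _ _ ((A%:E * cLnorm 2 f) `^ 2)%E).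
    apply: gt0_ler_poweR => //; rewrite in_itv/= leey andbT.
      exact: Lnorm_ge0.
    by rewrite mule_ge0 ?lee_fin ?(cz_A cz)//; exact: Lnorm_ge0.
  rewrite poweRM ?lee_fin ?(cz_A cz)//; last exact: Lnorm_ge0.
  rewrite cLnorm2E poweR_EFin powR_mulrn ?(cz_A cz)// [leRHS]EFinM.
  by apply: lee_wpmul2l; [rewrite lee_fin sqr_ge0|exact: L2_bound].
Qed.

Lemma T2B f g : bdint f -> bdint g ->
  {ae mu, forall x, T2 (fun y => f y - g y) x = T2 f x - T2 g x}.
Proof.
move=> bf bg; rewrite subE.
apply: filterS (cz_lin cz (-1) (bdint_L2 bg) (bdint_L2 bf)) => x ->.
by rewrite mulN1r addrC.
Qed.

Lemma T2_0 : {ae mu, forall x, T2 (fun=> 0) x = 0}.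
Proof.
have := cz_lin cz 1 (bdint_L2 bdint0) (bdint_L2 bdint0).
rewrite (_ : (fun _ => _) = fun=> 0); last by apply/funext => x; rewrite mulr0 addr0.
apply: filterS => x /eqP; rewrite mul1r -subr_eq0 opprD addrA subrr sub0r oppr_eq0.
by move/eqP.
Qed.

Lemma measurable_diag : measurable [set xy : Rn * Rn | xy.1 != xy.2].
Proof.
rewrite (_ : mkset _ = ~` [set xy : Rn * Rn | xy.1 = xy.2]); last first.
  by apply/seteqP; split => xy /= /eqP.
apply: measurableC; rewrite (_ : mkset _ = \big[setI/setT]_(i < n)
  ((fun xy : Rn * Rn => xy.1 ord0 i - xy.2 ord0 i) @^-1` [set 0])).
  apply: bigsetI_measurable => i _; rewrite -[X in measurable X]setTI.
  have : measurable_fun setT (fun xy : Rn * Rn => xy.1 ord0 i - xy.2 ord0 i).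
    apply: measurable_funB.
      by apply: (measurableT_comp (@measurable_coord R n i)); exact: measurable_fst.
    by apply: (measurableT_comp (@measurable_coord R n i)); exact: measurable_snd.
  by apply.
rewrite -bigcap_seq; apply/seteqP; split => -[x y] /=.
  by move=> -> i _ /=; rewrite subrr.
move=> H; apply/rowP => i; apply/eqP; rewrite -subr_eq0; apply/eqP.
by apply: (H i); rewrite /= mem_index_enum.
Qed.

(** The kernel is measurable only off the diagonal, so its section is set to 0 at the diagonal
    point. [measurable_Kf] removes this convention for functions vanishing at [x]. *)
Lemma measurable_K x : cmeasurable setT (fun y => if x == y then 0 else K x y).
Proof.
have mx : measurable [set y : Rn | x != y].
  rewrite (_ : mkset _ = pair x @^-1` [set xy : Rn * Rn | xy.1 != xy.2])//.
  by rewrite -[X in measurable X]setTI; apply: pair1_measurable => //; exact: measurable_diag.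
have H (k : Rn * Rn -> R) : measurable_fun [set xy : Rn * Rn | xy.1 != xy.2] k ->
    measurable_fun setT (fun y => if x == y then 0 else k (x, y)).
  move=> mk; have mk' : measurable_fun [set y : Rn | x != y] (fun y => k (x, y)).
    move=> _ Y mY.
    rewrite (_ : _ `&` _ = pair x @^-1` ([set xy : Rn * Rn | xy.1 != xy.2] `&` k @^-1` Y))//.
    rewrite -[X in measurable X]setTI; apply: pair1_measurable => //.
    by apply: mk => //; exact: measurable_diag.
  rewrite (_ : (fun _ => _) = (fun y => k (x, y)) \_ [set y : Rn | x != y]).
    by apply/(measurable_restrictT _ _).1.
  apply/funext => y; rewrite patchE; case: eqP => xy.
    by rewrite memNset//= xy eqxx.
  by rewrite mem_set//=; exact/eqP.
have [k1 k2] := cz_mK cz; split.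
  have := H _ k1; congr measurable_fun; apply/funext => y /=.
  by case: eqP.
have := H _ k2; congr measurable_fun; apply/funext => y /=.
by case: eqP.
Qed.

Lemma measurable_Kf x f : cmeasurable setT f -> f x = 0 ->
  cmeasurable setT (fun y => K x y * f y).
Proof.
move=> mf fx; rewrite (_ : (fun _ => _) = (fun y => (if x == y then 0 else K x y) * f y)).
  by apply: cmeasurableM => //; exact: measurable_K.
by apply/funext => y; case: eqP => // <-; rewrite fx !mulr0.
Qed.

Lemma K_far r x y : 0 < r -> far r x y -> cabs (K x y) <= CK * r ^- n.
Proof.
move=> r0 xy; apply: (le_trans (cz_size cz (far_neq r0 xy))).
have re := far_enorm xy; have e0 := lt_le_trans r0 re.
rewrite ler_wpM2l ?(ltW (cz_CK cz))// lef_pV2 ?posrE ?exprn_gt0//.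
by rewrite lerXn2r ?nnegrE ?(ltW r0) ?(ltW e0).
Qed.

Lemma farxx r x : 0 < r -> ~ far r x x.
Proof. by move=> r0 [ i ]; rewrite subrr normr0 leNgt r0. Qed.

Lemma Kf_bound x f r y : 0 < r -> (f y != 0 -> far r x y) ->
  cabs (K x y * f y) <= CK * r ^- n * cabs (f y).
Proof.
move=> r0 xy; have [->|fy] := eqVneq (f y) 0; first by rewrite mulr0 cabs0 mulr0.
by rewrite cabsM ler_wpM2r ?cabs_ge0//; apply: K_far => //; exact: xy.
Qed.

Lemma Kint x f r a : 0 < r -> cmeasurable setT f -> (L1n setT f <= a%:E)%E ->
  (forall y, f y != 0 -> far r x y) ->
  cintegrable setT (fun y => K x y * f y) /\
  cabs (cintegral setT (fun y => K x y * f y)) <= 2 * (CK * r ^- n * a).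
Proof.
move=> r0 mf fa xf.
have fx : f x = 0 by apply/eqP/negPn/negP => /xf; exact: farxx.
have mK := measurable_Kf mf fx.
have c0 : 0 <= CK * r ^- n.
  by rewrite mulr_ge0 ?(ltW (cz_CK cz))// invr_ge0 exprn_ge0// ltW.
have mg : measurable_fun setT (fun y => CK * r ^- n * cabs (f y)).
  by apply: measurable_funM => //; exact: measurable_cabs.
have le y : setT y -> cabs (K x y * f y) <= CK * r ^- n * cabs (f y).
  by move=> _; apply: Kf_bound => //; exact: xf.
have ia : (\int[mu]_y (CK * r ^- n * cabs (f y))%:E <= (CK * r ^- n * a)%:E)%E.
  rewrite integral_EFinZ//.
  - by rewrite [leRHS]EFinM; apply: lee_wpmul2l.
  - exact: measurable_cabs.
  - by move=> y _; exact: cabs_ge0.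
split; first exact: (cintegrable_bound measurableT mK mg le (le_lt_trans ia (ltry _))).
exact: (cabs_cintegral measurableT mK mg le ia).
Qed.

Lemma bdint_L1n f : bdint f -> (L1n setT f <= (fine (L1n setT f))%:E)%E.
Proof. by move=> [_ _ fi]; rewrite fineK// ge0_fin_numE// L1n_ge0. Qed.

(** Records that the kernel formula holds for [f] on [S]. The separation by [r] bounds the kernel on
    the support of [f], so the integrals converge and depend continuously on [f] in L^1. *)
Definition loc S (r : R) f := [/\ bdint f,
  forall x y, S x -> f y != 0 -> far r x y &
  {ae mu, forall x, S x -> T2 f x = cintegral setT (fun y => K x y * f y)}].

Lemma loc_lin S r c f g : 0 < r -> loc S r f -> loc S r g ->
  loc S r (fun x => c * f x + g x).
Proof.
move=> r0 [bf ff rf] [bg fg rg]; split.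
- exact: bdint_lin.
- move=> x y Sx fgy; have [fy|fy] := eqVneq (f y) 0; last exact: ff.
  by apply: fg => //; apply: contra fgy => /eqP ->; rewrite fy mulr0 addr0.
- have [mf _ _] := bf; have [mg _ _] := bg.
  apply: filterS3 (cz_lin cz c (bdint_L2 bf) (bdint_L2 bg)) rf rg => x -> /= rf rg Sx.
  have [if1 _] := Kint r0 mf (bdint_L1n bf) (ff x ^~ Sx).
  have [ig1 _] := Kint r0 mg (bdint_L1n bg) (fg x ^~ Sx).
  rewrite rf// rg// -cintegral_lin//; apply: eq_cintegral => y _.
  by rewrite mulrDr mulrCA.
Qed.

Lemma loc0 S r : loc S r (fun=> 0).
Proof.
split; first exact: bdint0.
  by move=> x y _; rewrite eqxx.
apply: filterS T2_0 => x -> _; rewrite /cintegral.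
by congr Complex; rewrite (_ : (fun _ => _) = cst 0) ?Rintegral_cst ?mul0r//;
  apply/funext => y; rewrite /= mulr0.
Qed.

End operators.
Arguments loc {R n} T2 K S r f.

(** * Approximation in L^1 by bounded functions and dyadic step functions *)

Lemma tail_small {R : realType} d (T : measurableType d)
    (m : {measure set T -> \bar R}) (f : T -> R) (F : (set T)^nat) (e : R) :
  measurable_fun setT f -> (forall x, 0 <= f x) ->
  (\int[m]_x (f x)%:E < +oo)%E -> (forall k, measurable (F k)) ->
  nondecreasing_seq F -> \bigcup_k F k = setT -> 0 < e ->
  exists N, forall k, (N <= k)%N -> (\int[m]_(x in ~` F k) (f x)%:E <= e%:E)%E.
Proof.
move=> mf f0 fi mF ndF UF e0.
pose I k := (\int[m]_(x in F k) (f x)%:E)%E.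
have cv : I @ \oo --> (\int[m]_x (f x)%:E)%E.
  rewrite -UF; apply: ge0_nondecreasing_set_cvg_integral => //.
  - by move=> k; apply/measurable_EFinP; exact: measurable_funTS.
  - by move=> k x _; rewrite lee_fin.
pose J := fine (\int[m]_x (f x)%:E)%E.
have I0 D : (0 <= \int[m]_(x in D) (f x)%:E)%E by apply: integral_ge0 => x _; rewrite lee_fin.
have JE : (\int[m]_x (f x)%:E = J%:E)%E by rewrite fineK// ge0_fin_numE.
have [N HN] : exists N, forall k, (N <= k)%N -> ((J - e)%:E <= I k)%E.
  have JeJ : (J - e < J)%R by rewrite ltrBlDr ltrDl.
  rewrite JE in cv; have [N _ HN] := cv _ (@nbhs_open_ereal_gt R J (fun=> J - e) JeJ).
  by exists N => k Nk; apply: ltW; exact: (HN k).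
exists N => k Nk; have := HN k Nk.
have : (\int[m]_x (f x)%:E = I k + \int[m]_(x in ~` F k) (f x)%:E)%E.
  rewrite -ge0_integral_setU ?setUv//.
  - exact: measurableC.
  - exact/measurable_EFinP.
  - by move=> x _; rewrite lee_fin.
  - by apply/disj_setPCl.
rewrite JE; have fik : (I k <= J%:E)%E.
  rewrite -JE; apply: ge0_subset_integral => //; first exact/measurable_EFinP.
  by move=> x _; rewrite lee_fin.
have -> : I k = (fine (I k))%:E.
  by rewrite fineK// ge0_fin_numE//; [exact: le_lt_trans fik (ltry _)|exact: I0].
case: (\int[m]_(x in ~` F k) (f x)%:E)%E => [r| |] //.
by rewrite -EFinD => -[->]; rewrite !lee_fin; lra.
Qed.

Section approximation_in_L1.
Context {R : realType} {n : nat}.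
Local Notation Rn := 'rV[R]_n.
Local Notation mu := (lebesgue_rV R n).
Implicit Types (f g h : Rn -> R[i]) (x y : Rn) (S : set Rn) (b Q : box R n).

Lemma L1n_indic D f : measurable D ->
  L1n setT (fun x => f x * (\1_D x)%:C%C) = L1n D f.
Proof.
move=> mD; rewrite /L1n [RHS]integral_mkcond; apply: eq_integral => x _.
rewrite patchE cabsM cabs_real indicE; case: (_ \in _); rewrite /= ?normr1 ?normr0 ?mulr1 ?mulr0//.
Qed.

Lemma truncation f (e : R) : cmeasurable setT f -> (L1n setT f < +oo)%E -> 0 < e ->
  exists g, bdint g /\ (L1n setT (fun x => (f x - g x)%R) <= e%:E)%E.
Proof.
move=> mf fi e0; have mc := measurable_cabs mf.
pose F (k : nat) := [set x | cabs (f x) <= k%:R].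
have mF k : measurable (F k).
  rewrite (_ : F k = (fun x => cabs (f x)) @^-1` `]-oo, k%:R]%classic).
    by rewrite -[X in measurable X]setTI; exact: mc.
  by apply/seteqP; split => x /=; rewrite in_itv.
have ndF : nondecreasing_seq F.
  by move=> i j ij; apply/subsetPset => x /= h; apply: (le_trans h); rewrite ler_nat.
have UF : \bigcup_k F k = setT.
  apply/seteqP; split=> // x _; exists (Num.truncn (cabs (f x))).+1 => //=.
  by apply: ltW; exact: truncnS_gt.
have [N HN] := tail_small mc (fun x => cabs_ge0 (f x)) fi mF ndF UF e0.
exists (fun x => f x * (\1_(F N) x)%:C%C); split; first split.
- exact: cmeasurable_indic.
- exists N%:R => x; rewrite cabsM cabs_real indicE; case: (boolP (x \in F N)) => [/set_mem h|_].
    by rewrite normr1 mulr1.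
  by rewrite normr0 mulr0.
- rewrite L1n_indic//; apply: le_lt_trans fi; apply: ge0_subset_integral => //.
    by apply/measurable_EFinP; exact: mc.
  by move=> x _; rewrite lee_fin cabs_ge0.
- apply: le_trans (HN N (leqnn N)); rewrite -[leRHS]L1n_indic; last exact: measurableC.
  rewrite (_ : (fun x => f x - _) = (fun x => f x * (\1_(~` F N) x)%:C%C)) ?lexx//.
  apply/funext => x; rewrite !indicE in_setC; case: (_ \in _) => /=.
    by rewrite mulr1 subrr mulr0.
  by rewrite mulr0 subr0 mulr1.
Qed.

Lemma tail_box f (e : R) : cmeasurable setT f -> (L1n setT f < +oo)%E -> 0 < e ->
  exists L0 : R, forall L, L0 <= L -> (L1n (~` hbox (0%R : Rn, L)) f <= e%:E)%E.
Proof.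
move=> mf fi e0; have mc := measurable_cabs mf.
pose F (k : nat) : set Rn := hbox (0, k%:R).
have mF k : measurable (F k) by exact: measurable_hbox.
have sub (L L' : R) : L <= L' -> hbox (0 : Rn, L) `<=` hbox (0, L').
  by move=> LL x H i; have := H i; rewrite /= !mxE => /andP[? ?]; apply/andP; split; lra.
have ndF : nondecreasing_seq F.
  by move=> i j ij; apply/subsetPset; apply: sub; rewrite ler_nat.
have UF : \bigcup_k F k = setT.
  apply/seteqP; split=> // x _; pose B := \sum_(i < n) `|x ord0 i|.
  exists (Num.truncn (2 * B)).+1 => // i; rewrite /= !mxE.
  have xB : `|x ord0 i| <= B.
    by rewrite /B (bigD1 i)//= lerDl; apply: sumr_ge0.
  have := truncnS_gt (2 * B); move: xB; rewrite ler_norml => /andP[? ?] ?.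
  by apply/andP; split; lra.
have [N HN] := tail_small mc (fun x => cabs_ge0 (f x)) fi mF ndF UF e0.
exists N%:R => L NL; apply: le_trans (HN N (leqnn N)).
apply: ge0_subset_integral; try exact: measurableC.
- by apply: measurableC; exact: measurable_hbox.
- by apply/measurable_EFinP; exact: measurable_funTS.
- by move=> x _; rewrite lee_fin cabs_ge0.
- by apply: subsetC; exact: sub.
Qed.

(** The value on a subcube is [Z] at its centre. The form as a finite sum is the one to which
    linearity of the operator applies; [cstepE] gives the pointwise form. *)
Definition cstep Q k (Z : Rn -> R[i]) : Rn -> R[i] :=
  fun x => \sum_(b <- gen Q k) Z b.1 * (\1_(hbox b) x)%:C%C.

Lemma cstepE Q k Z x : 0 < Q.2 ->
  cstep Q k Z x = Z (ctr Q k x) * (\1_(hbox Q) x)%:C%C.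
Proof.
move=> Q0; rewrite -(indic_gen k x Q0) rmorph_sum mulr_sumr /cstep.
apply: eq_big_seq => b bk; rewrite indicE; case: (boolP (x \in hbox b)) => [/set_mem bx|_].
  by rewrite (ctr_gen Q0 bk bx).
by rewrite /= !mulr0.
Qed.

Lemma measurable_cstep Q k Z : cmeasurable setT (cstep Q k Z).
Proof.
rewrite /cstep; elim: (gen Q k) => [|b s IH].
  under eq_fun do rewrite big_nil; exact: cmeasurable_cst.
under eq_fun do rewrite big_cons; apply: cmeasurableD => //.
by apply: cmeasurable_indic; [exact: cmeasurable_cst|exact: measurable_hbox].
Qed.

Lemma step_approx Q f M (e : R) : 0 < Q.2 -> cmeasurable setT f ->
  (forall x, cabs (f x) <= M) -> 0 < e ->
  exists k0, forall k, (k0 <= k)%N -> exists Z, (forall c, cabs (Z c) <= 2 * M) /\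
    (L1n (hbox Q) (fun x => (f x - cstep Q k Z x)%R) <= e%:E)%E.
Proof.
move=> Q0 [mr mi] HM e0; have M0 : 0 <= M := le_trans (cabs_ge0 _) (HM 0).
have mQ := measurable_hbox Q.
have muQ : (mu (hbox Q) < +oo)%E by rewrite mu_hbox ?ltry// ltW.
(* Clamping the approximants to [-M, M] keeps them bounded and, since the parts of [f] already lie
   there, does not increase the distance to [f]. *)
pose clamp (t : R) := Num.max (- M) (Num.min M t).
have clampM t : `|clamp t| <= M.
  by rewrite ler_norml /clamp le_max lexx ge_max ge_min lexx/= andbT; lra.
have clamp_near a t : `|a| <= M -> `|a - clamp t| <= `|a - t|.
  rewrite ler_norml => /andP[? ?]; have := ler_norm (a - t); have := ler_norm (t - a).
  rewrite (distrC t a) /clamp => ? ?; case: (lerP M t) => h1;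
    [case: (lerP (- M) M)|case: (lerP (- M) t)] => h2;
    rewrite ler_norml; apply/andP; split; lra.
have ap (h : Rn -> R) : measurable_fun setT h -> (forall x, `|h x| <= M) -> appr Q h.
  move=> mh hM; apply: appr_integrable => //; apply/integrableP; split.
    by apply/measurable_EFinP; exact: measurable_funTS.
  apply: (@le_lt_trans _ _ (\int[mu]_(x in hbox Q) cst M%:E x)%E).
    apply: ge0_le_integral => //; last by move=> x _; rewrite /= lee_fin.
    by apply/measurableT_comp => //; apply/measurable_EFinP; exact: measurable_funTS.
  by rewrite integral_cst// lte_mul_pinfty// ltry.
have e2 : 0 < e / 2 by lra.
have [_ /(_ _ e2)[k1 [g1 [s1 d1]]]] := ap _ mr (fun x => le_trans (Re_le_cabs _) (HM x)).
have [_ /(_ _ e2)[k2 [g2 [s2 d2]]]] := ap _ mi (fun x => le_trans (Im_le_cabs _) (HM x)).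
exists (maxn k1 k2) => k; rewrite geq_max => /andP[k1k k2k].
exists (fun c => Complex (clamp (g1 c)) (clamp (g2 c))); split.
  move=> c; apply: (le_trans (cabs_le_ReIm _)) => /=.
  by rewrite (_ : 2 * M = M + M) ?lerD//; ring.
have [mg1 c1] := step_le Q0 k1k s1; have [mg2 c2] := step_le Q0 k2k s2.
rewrite [e in leRHS](splitr e) EFinD; apply: (le_trans _ (leeD d1 d2)).
apply: le_integral_EFinD => //.
- apply: measurable_cabs; apply: cmeasurableB.
    by split; exact: measurable_funTS.
  have [m1 m2] := measurable_cstep Q k (fun c => Complex (clamp (g1 c)) (clamp (g2 c))).
  by split; exact: measurable_funTS.
- by apply: measurable_dist; exact: measurable_funTS.
- by apply: measurable_dist; exact: measurable_funTS.
- by move=> x _; exact: cabs_ge0.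
- move=> x Qx; rewrite cstepE// c1// c2// indicE mem_set// mulr1.
  apply: (le_trans (cabs_le_ReIm _)); case: (f x) (HM x) => a b abM /=.
  by apply: lerD; apply: clamp_near; apply: le_trans abM; [exact: (Re_le_cabs (Complex a b))|exact: (Im_le_cabs (Complex a b))].
Qed.

End approximation_in_L1.

(** * The kernel formula for step functions *)

Section box_locality.
Context {R : realType} {n : nat}.
Local Notation Rn := 'rV[R]_n.
Local Notation mu := (lebesgue_rV R n).
Implicit Types (f g h : Rn -> R[i]) (x y : Rn) (S : set Rn) (b Q : box R n) (r s t : R).

Context {A CK Sth : R} {theta : R -> R} {T2 : (Rn -> R[i]) -> Rn -> R[i]}
  {K : Rn -> Rn -> R[i]}.
Hypothesis cz : cz_operator A CK Sth theta T2 K.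

Lemma bdint_meas f : bdint f -> cmeasurable setT f. Proof. by case. Qed.

Definition cind b : Rn -> R[i] := fun x => (\1_(hbox b) x)%:C%C.

Lemma cabs_indic (D : set Rn) x : cabs (\1_D x)%:C%C = \1_D x :> R.
Proof. by rewrite cabs_real ger0_norm. Qed.

Lemma L1n_cind b : 0 <= b.2 -> L1n setT (cind b) = (b.2 ^+ n)%:E.
Proof.
move=> b0; rewrite -mu_hbox// /L1n; under eq_integral do rewrite cabs_indic.
by rewrite integral_indic// ?setIT//; exact: measurable_hbox.
Qed.

Lemma bdint_cind b : 0 <= b.2 -> bdint (cind b).
Proof.
move=> b0; split.
- by apply: cmeasurable_real; apply: measurable_indic; exact: measurable_hbox.
- by exists 1 => x; rewrite cabs_indic indicE lern1; case: (_ \in _).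
- by rewrite L1n_cind// ltry.
Qed.

Lemma KintB x f g r : 0 < r -> bdint f -> bdint g ->
  (forall y, f y != 0 -> far r x y) -> (forall y, g y != 0 -> far r x y) ->
  cintegral setT (fun y => K x y * (f y - g y)) =
  cintegral setT (fun y => K x y * f y) - cintegral setT (fun y => K x y * g y).
Proof.
move=> r0 bf bg ff fg; have [mf _ _] := bf; have [mg _ _] := bg.
have [i1 _] := Kint cz r0 mf (bdint_L1n bf) ff.
have [i2 _] := Kint cz r0 mg (bdint_L1n bg) fg.
rewrite (@eq_cintegral _ _ _ _ (fun y => -1 * (K x y * g y) + K x y * f y)).
  by rewrite cintegral_lin// mulN1r addrC.
by move=> y _; rewrite mulrBr mulN1r addrC.
Qed.

(** The formula is known for smooth functions supported in the closed cube. Approximating the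
    indicator by one of them in L^1, the images under [T2] are close in measure and the kernel
    integrals are uniformly close on [S]. *)
Lemma loc_box S r b : 0 < r -> 0 < b.2 ->
  (forall x y, S x -> cube b.1 b.2 y -> far r x y) -> loc T2 K S r (cind b).
Proof.
move=> r0 b0 Sb; have bc := bdint_cind (ltW b0).
have cS x y : S x -> cind b y != 0 -> far r x y.
  move=> Sx; rewrite /cind indicE; case: (boolP (y \in hbox b)) => [/set_mem yb _|_].
    by apply: Sb => //; exact: hbox_cube.
  by rewrite eqxx.
split=> //; apply: ae_eq_small => t e t0 e0.
pose C1 := 2 * (CK * r ^- n); have C10 : 0 <= C1.
  by rewrite mulr_ge0// mulr_ge0 ?(ltW (cz_CK cz))// invr_ge0 exprn_ge0// ltW.
pose C2 := A ^+ 2 / (t / 2) ^+ 2; have C20 : 0 <= C2.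
  by rewrite divr_ge0 ?sqr_ge0.
(* The first bound makes the two kernel integrals differ by at most t/2; the second gives the set
   where [T2] of the difference exceeds t/2 measure at most e. The added 1 keeps the denominators
   positive. *)
pose eta := Num.min (t / 2 / (C1 + 1)) (e / (C2 + 1)).
have eta0 : 0 < eta by rewrite lt_min !divr_gt0// ltr_wpDl.
have eta1 : C1 * eta <= t / 2.
  rewrite (le_trans (ler_wpM2r (ltW eta0) (_ : C1 <= C1 + 1))) ?lerDl//.
  by rewrite mulrC -ler_pdivlMr ?ltr_wpDl// ge_min lexx.
have eta2 : C2 * eta <= e.
  rewrite (le_trans (ler_wpM2r (ltW eta0) (_ : C2 <= C2 + 1))) ?lerDl//.
  by rewrite mulrC -ler_pdivlMr ?ltr_wpDl// ge_min lexx orbT.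
have [phi [sphi phi01 phiS dphi]] := smooth_box b.1 b0 eta0.
pose F : Rn -> R[i] := fun x => (phi x)%:C%C.
have mphi := measurable_flatfun sphi.
have F1 x : cabs (F x) <= 1 by rewrite cabs_real; have /andP[? ?] := phi01 x; rewrite ger0_norm.
have dF x : cabs (cind b x - F x) = `|\1_(hbox b) x - phi x|.
  by rewrite -cabs_real; congr cabs; rewrite /cind /F rmorphB.
have LF : (L1n setT (fun x => (cind b x - F x)%R) <= eta%:E)%E.
  rewrite /L1n; under eq_integral do rewrite dF.
  by apply: le_trans dphi; case: (b) b0.
have mF : cmeasurable setT F by exact: cmeasurable_real.
have bF : bdint F.
  split=> //; first by exists 1.
  have : (L1n setT F <= L1n setT (fun x => (cind b x - F x)%R) + L1n setT (cind b))%E.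
    have [mc _ _] := bc.
    apply: le_integral_EFinD => //; try exact: measurable_cabs.
    - by apply: measurable_cabs; exact: cmeasurableB.
    - by move=> x _; exact: cabs_ge0.
    - by move=> x _; exact: cabs_ge0.
    - by move=> x _; exact: cabs_ge0.
    - by move=> x _; rewrite cabsBC; exact: cabs_le_add.
  move/le_lt_trans; apply; rewrite lte_add_pinfty//; first exact: le_lt_trans LF (ltry _).
  by have [] := bc.
have [CF suppF] : Cc_infty F /\ csupp F `<=` cube b.1 b.2.
  apply: flatfun_Cc => //; first exact: flatfun_cst.
  by move=> x nx; rewrite /F phiS.
have FS x y : S x -> F y != 0 -> far r x y.
  move=> Sx Fy; apply: Sb => //; apply: contrapT => ny; move: Fy.
  by rewrite /F phiS// eqxx.
exists (lvl (t / 2) (T2 (fun x => cind b x - F x))); first split.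
- by apply: measurable_lvl; apply: (T2m cz); exact: bdintB.
- have bd1 x : cabs (cind b x - F x) <= 1.
    rewrite dF; have /andP[? ?] := phi01 x; rewrite indicE; case: (_ \in _) => /=;
      by rewrite ler_norml; apply/andP; split; lra.
  apply: (le_trans (T2cheb cz (bdintB bc bF) bd1 LF _)); first by lra.
  by rewrite lee_fin mul1r mulrAC.
- apply: filterS2 (T2B cz bc bF) (cz_rep cz CF) => x TE rep Sx.
  have nsx : ~ csupp F x.
    by move=> /suppF cx; exact: farxx r0 (Sb _ _ Sx cx).
  rewrite /lvl /= TE (rep nsx) => tx.
  have FSx y : cind b y - F y != 0 -> far r x y.
    have [cy|cy] := eqVneq (cind b y) 0; last by move=> _; exact: cS cy.
    by rewrite cy sub0r oppr_eq0; exact: FS.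
  have [_] := Kint cz r0 (cmeasurableB (bdint_meas bc) mF) LF FSx.
  rewrite (KintB r0 bc bF (cS x ^~ Sx) (FS x ^~ Sx)).
  set I1 := cintegral _ _; set I2 := cintegral _ _; rewrite mulrA -/C1 => H.
  have : cabs (T2 (cind b) x - I1) <= cabs (T2 (cind b) x - I2) + cabs (I1 - I2).
    by rewrite (cabsBC I1); apply: le_trans (cabsD _ _); rewrite addrA subrK.
  by move: tx H; rewrite -/I1; lra.
Qed.

(** Separation is demanded only of cubes on which [Z] is nonzero; [ext_locality] uses this after
    setting [Z] to 0 on cubes away from the support. *)
Lemma loc_cstep S r Q k (Z : Rn -> R[i]) : 0 < r -> 0 < Q.2 ->
  (forall b x y, b \in gen Q k -> Z b.1 != 0 -> S x -> cube b.1 b.2 y -> far r x y) ->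
  loc T2 K S r (cstep Q k Z).
Proof.
move=> r0 Q0 H; rewrite /cstep.
have H' b : b \in gen Q k -> 0 < b.2 /\
    (Z b.1 != 0 -> forall x y, S x -> cube b.1 b.2 y -> far r x y).
  by move=> bk; split=> [|Zb x y]; [exact: gen_side_gt0 bk|exact: H].
elim: (gen Q k) H' => [|b s IH] H'.
  under eq_fun do rewrite big_nil; exact: loc0 cz S r.
under eq_fun do rewrite big_cons.
have ls : loc T2 K S r (fun x => \sum_(b <- s) Z b.1 * (\1_(hbox b) x)%:C%C).
  by apply: IH => b' b's; apply: H'; rewrite inE b's orbT.
have [b0 Zb] := H' b (mem_head _ _).
have [Z0|Z0] := eqVneq (Z b.1) 0; last first.
  exact: (loc_lin cz (Z b.1) r0 (loc_box r0 b0 (Zb Z0)) ls).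
by rewrite Z0; under eq_fun do rewrite mul0r add0r.
Qed.

End box_locality.

(** * Weak type (1,1) *)

Section annuli.
Context {R : realType} {n : nat}.
Local Notation Rn := 'rV[R]_n.
Local Notation mu := (lebesgue_rV R n).

Lemma nneseries_bound (u : nat -> R) (B : R) : (forall k, 0 <= u k) ->
  (forall N, \sum_(k < N) u k <= B) -> (\sum_(k <oo) (u k)%:E <= B%:E)%E.
Proof.
move=> u0 uB; apply: lime_le.
  by apply: is_cvg_nneseries => k _ _; rewrite lee_fin.
by apply: nearW => N; rewrite sumEFin lee_fin big_mkord.
Qed.

Lemma le_cube (c : Rn) (l l' : R) : l <= l' -> cube c l `<=` cube c l'.
Proof. by move=> ll x H i; apply: (le_trans (H i)); rewrite ler_pM2r ?invr_gt0. Qed.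

Lemma annulus_exists (c x : Rn) (l0 : R) : 0 < l0 -> ~ cube c l0 x ->
  exists k, cube c (2 ^+ k.+1 * l0) x /\ ~ cube c (2 ^+ k * l0) x.
Proof.
move=> l00 nx; pose B := \sum_(i < n) `|x ord0 i - c ord0 i|.
have ex : exists k, `[< cube c (2 ^+ k * l0) x >].
  exists (Num.truncn (2 * B / l0)).+1; apply/asboolP => i.
  have xB : `|x ord0 i - c ord0 i| <= B.
    by rewrite /B (bigD1 i)//= lerDl; apply: sumr_ge0.
  apply: (le_trans xB); set k := Num.truncn _.
  have h1 : 2 * B / l0 < k.+1%:R by exact: truncnS_gt.
  have h2 : k.+1%:R <= 2 ^+ k.+1 :> R by rewrite -natrX ler_nat ltnW// ltn_expl.
  have : 2 * B <= 2 ^+ k.+1 * l0 by rewrite -ler_pdivrMr//; exact: le_trans (ltW h1) h2.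
  by lra.
case: (ex_minnP ex) => -[|k] /asboolP ck kmin; first by move: ck; rewrite expr0 mul1r.
exists k; split=> // ck'; have /kmin : `[< cube c (2 ^+ k * l0) x >] by exact/asboolP.
by rewrite ltnn.
Qed.

(** The common pattern of the estimates away from a cube: on the k-th annulus [phi] is bounded by a
    constant times [h], and the integral of [h] over the annulus by the one over the whole larger
    cube. It serves for atoms (h = 1), for the oscillation of T g and for the outer part of T f. *)
Lemma annuli_integral (c : Rn) (l0 : R) (D : set Rn) (phi h : Rn -> R) (g a : nat -> R) B :
  0 < l0 -> measurable D -> (forall x, D x -> ~ cube c l0 x) ->
  measurable_fun D phi -> (forall x, D x -> 0 <= phi x) ->
  measurable_fun setT h -> (forall x, 0 <= h x) -> (forall k, 0 <= g k) ->
  (forall k, 0 <= a k) ->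
  {ae mu, forall x, D x -> forall k, cube c (2 ^+ k.+1 * l0) x ->
     ~ cube c (2 ^+ k * l0) x -> phi x <= g k * h x} ->
  (forall k, (\int[mu]_(x in cube c (2 ^+ k.+1 * l0)) (h x)%:E <= (a k)%:E)%E) ->
  (forall N, \sum_(k < N) g k * a k <= B) ->
  (\int[mu]_(x in D) (phi x)%:E <= B%:E)%E.
Proof.
move=> l00 mD Dc mphi phi0 mh h0 g0 a0 le ha SB.
pose C k := cube c (2 ^+ k.+1 * l0).
have mC k : measurable (C k) by exact: measurable_cube.
pose G k x := g k * (h x * \1_(C k) x).
have mG k : measurable_fun setT (G k).
  by apply: measurable_funM => //; apply: measurable_funM => //; exact: measurable_indic.
have G0 k x : 0 <= G k x by rewrite !mulr_ge0.
apply: (@le_trans _ _ (\int[mu]_(x in D) (\sum_(k <oo) (G k x)%:E))%E).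
  apply: ae_ge0_le_integral => //.
  - exact/measurable_EFinP.
  - by move=> x _; apply: nneseries_ge0 => k _ _; rewrite lee_fin.
  - apply: ge0_emeasurable_sum => k; first by move=> x _ _; rewrite lee_fin.
    by move=> _; apply/measurable_EFinP; exact: measurable_funTS.
  - apply: filterS le => x le Dx; have [k [ck nck]] := annulus_exists l00 (Dc _ Dx).
    apply: (@le_trans _ _ (\sum_(i < k.+1) (G i x)%:E)%E); last first.
      by rewrite -(big_mkord xpredT (fun i => (G i x)%:E)); apply: nneseries_lim_ge => i _ _; rewrite lee_fin.
    rewrite sumEFin lee_fin; apply: (le_trans (le Dx k ck nck)).
    rewrite big_ord_recr /= /G indicE mem_set// mulr1 lerDr.
    by apply: sumr_ge0 => i _; exact: G0.
rewrite integral_nneseries//; last 2 first.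
- by move=> k; apply/measurable_EFinP; exact: measurable_funTS.
- by move=> k x _; rewrite lee_fin.
apply: (@le_trans _ _ (\sum_(k <oo) (g k * a k)%:E)%E); last first.
  by apply: nneseries_bound => // k; rewrite mulr_ge0.
apply: lee_nneseries => [k _ _|k _].
  by apply: integral_ge0 => x _; rewrite lee_fin.
apply: (@le_trans _ _ (\int[mu]_x (G k x)%:E)%E).
  apply: ge0_subset_integral => //; first exact/measurable_EFinP.
  by move=> x _; rewrite lee_fin.
rewrite /G integral_EFinZ//.
- rewrite EFinM; apply: lee_wpmul2l; first by rewrite lee_fin.
  apply: le_trans (ha k); rewrite [leRHS]integral_mkcond le_eqVlt; apply/orP; left; apply/eqP.
  apply: eq_integral => x _; rewrite patchE indicE; case: (_ \in _) => /=.
    by rewrite mulr1.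
  by rewrite mulr0.
- by apply: measurable_funM => //; exact: measurable_indic.
- by move=> x _; rewrite mulr_ge0.
Qed.

End annuli.

Section atoms.
Context {R : realType} {n : nat}.
Local Notation Rn := 'rV[R]_n.
Local Notation mu := (lebesgue_rV R n).
Implicit Types (f g h : Rn -> R[i]) (x y c : Rn) (S : set Rn) (b Q : box R n) (r s t : R).

Context {A CK Sth : R} {theta : R -> R} {T2 : (Rn -> R[i]) -> Rn -> R[i]}
  {K : Rn -> Rn -> R[i]}.
Hypothesis cz : cz_operator A CK Sth theta T2 K.

(** The value 2n + 1 is chosen for the smoothness condition. If y is in the cube of half side r
    about c and x is outside its dilation, then |c - y| <= n r < (2n + 1) r / 2 <= |c - x| / 2. *)
Definition dil : R := 2 * n%:R + 1.

Lemma dil_ge1 : 1 <= dil.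
Proof. by rewrite /dil lerDr mulr_ge0. Qed.

Lemma dil_gt0 : 0 < dil. Proof. exact: lt_le_trans dil_ge1. Qed.

Definition osc (k : nat) (l : R) : R := CK * (2 ^+ k * l) ^- n * theta (2 ^- k).

Lemma osc_ge0 k l : 0 < l -> 0 <= osc k l.
Proof.
move=> l0; rewrite !mulr_ge0 ?(ltW (cz_CK cz))//.
  by rewrite invr_ge0 exprn_ge0// mulr_ge0 ?exprn_ge0 ?(ltW l0).
by apply: (cz_th0 cz); rewrite invr_gt0 exprn_gt0.
Qed.

(** On the k-th annulus the argument of theta is at most n r / (2^k (2n + 1) r) <= 2^-k, and theta
    is monotone; [osc] is the resulting bound. *)
Lemma kernel_smooth c x y r k : 0 < r -> (forall i, `|c ord0 i - y ord0 i| <= r) ->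
  far (2 ^+ k * (dil * r)) x c ->
  cabs (K x y - K x c) <= osc k (dil * r) /\ cabs (K y x - K c x) <= osc k (dil * r).
Proof.
move=> r0 cy fx; have dr0 : 0 < dil * r by rewrite mulr_gt0 ?dil_gt0.
have o0 := osc_ge0 k dr0.
have [<-|yc] := eqVneq c y; first by rewrite !subrr cabs0.
have e1 : 0 < enorm (c - y).
  have [i ci] : exists i, c ord0 i != y ord0 i.
    by apply/existsP; apply: contraNT yc => /existsPn H; apply/eqP/rowP => i; apply/eqP/negPn/H.
  apply: lt_le_trans (coord_le_enorm (c - y) i); rewrite !mxE normr_gt0 subr_eq0//.
have e2 : enorm (c - y) <= n%:R * r.
  by apply: enorm_le => [|i]; [exact: ltW|rewrite !mxE].
have e3 : 2 ^+ k * (dil * r) <= enorm (c - x) by apply: far_enorm; exact: far_sym.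
have k1 : 1 <= 2 ^+ k :> R by rewrite exprn_ege1// ler1n.
have e4 : dil * r <= 2 ^+ k * (dil * r) by rewrite ler_peMl// ltW.
have e5 : dil * r = 2 * (n%:R * r) + r by rewrite /dil; ring.
have e6 : 0 < 2 ^+ k * (dil * r) by rewrite mulr_gt0// exprn_gt0.
have H : cabs (K c x - K y x) + cabs (K x c - K x y) <= osc k (dil * r).
  apply: (le_trans (cz_smooth cz e1 _)); first by lra.
  have e7 : 0 < enorm (c - x) by exact: lt_le_trans e3.
  rewrite /osc -!mulrA ler_wpM2l ?(ltW (cz_CK cz))//; apply: ler_pM.
  - by rewrite invr_ge0 exprn_ge0// ltW.
  - by apply: (cz_th0 cz); rewrite divr_gt0.
  - rewrite lef_pV2 ?posrE ?exprn_gt0//.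
    by rewrite lerXn2r ?nnegrE ?(ltW e6) ?(ltW e7).
  - apply: (cz_thle cz); first by rewrite divr_gt0.
    rewrite ler_pdivrMr// -ler_pdivrMl ?invr_gt0 ?exprn_gt0// invrK.
    apply: le_trans e3; rewrite ler_wpM2l ?exprn_ge0//; lra.
by split; rewrite cabsBC; apply: le_trans H; rewrite ?lerDl ?lerDr cabs_ge0.
Qed.

Lemma far_in_cube c x y r : 0 < r -> (forall i, `|c ord0 i - y ord0 i| <= r) ->
  ~ cube c (dil * (2 * r)) x -> far ((dil - 1) * r) x y.
Proof.
move=> r0 cy /notin_cube[i xi]; exists i.
have := ler_normB (x ord0 i - y ord0 i) (c ord0 i - y ord0 i).
rewrite opprB addrA subrK; have := cy i.
rewrite (_ : dil * (2 * r) / 2 = dil * r) in xi; last by field.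
by rewrite mulrBl mul1r; lra.
Qed.

(* Zero-mean functions supported in a cube: off a dilated cube the cancellation
   allows to replace the kernel by its oscillation. *)
Lemma atom_bound b f w : 0 < b.2 -> bdint f -> (forall x, ~ hbox b x -> f x = 0) ->
  cintegral setT f = 0 -> (L1n setT f <= w%:E)%E ->
  (forall S r, 0 < r -> (forall x y, S x -> cube b.1 b.2 y -> far r x y) ->
     loc T2 K S r f) ->
  (\int[mu]_(x in ~` cube b.1 (dil * b.2)) (cabs (T2 f x))%:E <=
     (2 * 4 ^+ n * CK * Sth * w)%:E)%E.
Proof.
move=> b0 bf f0 If Lf locf; set c := b.1; pose r := b.2 / 2.
have br : b.2 = 2 * r by rewrite /r; field.
have r0 : 0 < r by rewrite /r; lra.
have w0 : 0 <= w by rewrite -lee_fin; exact: le_trans (L1n_ge0 _ _) Lf.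
have by_ y : cube b.1 b.2 y -> forall i, `|c ord0 i - y ord0 i| <= r.
  by move=> H i; rewrite distrC; exact: H.
have d1 : 0 < (dil - 1) * r.
  by rewrite mulr_gt0// /dil addrK mulr_gt0// ltr0n (cz_n cz).
set E := ~` cube c (dil * b.2).
have fE x y : E x -> cube b.1 b.2 y -> far ((dil - 1) * r) x y.
  by move=> Ex yb; apply: (far_in_cube r0 (by_ _ yb)); rewrite -br.
have [_ fE' locE] := locf E _ d1 fE.
have l00 : 0 < dil * b.2 by rewrite mulr_gt0 ?dil_gt0.
have mT := T2m cz bf; have mf := bdint_meas bf.
apply: (@annuli_integral _ _ c (dil * b.2) _ _ (fun=> 1)
  (fun k => 2 * (osc k (dil * r) * w)) (fun k => (2 ^+ k.+1 * (dil * b.2)) ^+ n)) => //.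
- by apply: measurableC; exact: measurable_cube.
- by apply: measurable_funTS; exact: measurable_cabs.
- by move=> x _; exact: cabs_ge0.
- by move=> k; rewrite mulr_ge0// mulr_ge0// osc_ge0// mulr_gt0 ?dil_gt0.
- by move=> k; rewrite exprn_ge0// mulr_ge0 ?exprn_ge0// ltW.
- apply: filterS locE => x locE Ex k _ /notin_cube fx; rewrite mulr1 locE//.
  have fx' : far (2 ^+ k * (dil * r)) x c.
    by case: fx => i fx; exists i; apply: le_trans fx; rewrite br; lra.
  have [iK _] := Kint cz d1 mf Lf (fE' x ^~ Ex).
  have cif : cintegrable setT f by apply: cintegrable_L1n => //; exact: le_lt_trans Lf (ltry _).
  (* The mean of [f] is 0, so the constant [K x c] may be subtracted from the kernel. *)
  have -> : cintegral setT (fun y => K x y * f y) =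
      cintegral setT (fun y => (K x y - K x c) * f y).
    rewrite [RHS](@eq_cintegral _ _ _ _ (fun y => - K x c * f y + K x y * f y)).
      by rewrite cintegral_lin// If mulr0 add0r.
    by move=> y _; rewrite mulrBl mulNr addrC.
  apply: (@cabs_cintegral _ _ _ _ (fun y => osc k (dil * r) * cabs (f y))) => //.
  + rewrite (_ : (fun y => _) = (fun y => K x y * f y - K x c * f y)).
      apply: cmeasurableB; last by apply: cmeasurableM => //; exact: cmeasurable_cst.
      apply: measurable_Kf => //; first exact: cz.
      by apply/eqP/negPn/negP => /(fE' _ _ Ex); exact: farxx.
    by apply/funext => y; rewrite mulrBl.
  + by apply: measurable_funM => //; exact: measurable_cabs.
  + move=> y _; have [yb|/f0 ->] := pselect (hbox b y); last by rewrite mulr0 cabs0 mulr0.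
    rewrite cabsM ler_wpM2r ?cabs_ge0//.
    by have [] := kernel_smooth r0 (by_ _ (hbox_cube yb)) fx'.
  + rewrite integral_EFinZ//.
    * by rewrite [leRHS]EFinM; apply: lee_wpmul2l => //; rewrite lee_fin osc_ge0// mulr_gt0 ?dil_gt0.
    * exact: measurable_cabs.
    * by move=> y _; exact: cabs_ge0.
    * by rewrite osc_ge0// mulr_gt0 ?dil_gt0.
- move=> k; have -> : (\int[mu]_(x in cube c (2 ^+ k.+1 * (dil * b.2))) 1%:E =
      mu (cube c (2 ^+ k.+1 * (dil * b.2))))%E.
    by rewrite integral_cst ?mul1e//; exact: measurable_cube.
  by rewrite mu_cube// mulr_ge0 ?exprn_ge0// ltW.
(* The cube of side 2^(k+1) (2n + 1) (2r) is four times as wide as the length 2^k (2n + 1) r in the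
   kernel bound: volume and kernel size cancel up to 4^n, leaving theta(2^-k). *)
- move=> N; rewrite (eq_bigr (fun k : 'I_N => 2 * 4 ^+ n * CK * w * theta (2 ^- k))).
    rewrite -mulr_sumr (_ : 2 * 4 ^+ n * CK * Sth * w = 2 * 4 ^+ n * CK * w * Sth); last by ring.
    by rewrite ler_wpM2l ?(cz_S cz)// !mulr_ge0 ?exprn_ge0 ?(ltW (cz_CK cz)).
  move=> k _; rewrite /osc br.
  rewrite (_ : 2 ^+ k.+1 * (dil * (2 * r)) = 4 * (2 ^+ k * (dil * r))); last by rewrite exprS; ring.
  set X := 2 ^+ k * (dil * r); rewrite (exprMn n 4 X).
  have X0 : X != 0 by rewrite gt_eqF// !mulr_gt0 ?exprn_gt0 ?dil_gt0.
  by field; rewrite expf_neq0.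
Qed.

End atoms.

Arguments dil {R} n.

Section Pall.
Context {T : Type}.
Implicit Types (P : T -> Prop) (s : seq T).

(* [T] is not an [eqType] below, hence no quantification over [x \in s]. *)
Definition Pall P s : Prop := foldr (fun x A => P x /\ A) True s.

Lemma Pall_cat P s1 s2 : Pall P s1 -> Pall P s2 -> Pall P (s1 ++ s2).
Proof. by elim: s1 => [//|x s IH] [Px Ps] P2; split=> //; exact: IH. Qed.

Lemma Pall_flatten P (I : Type) (F : I -> seq T) (r : seq I) :
  (forall i, Pall P (F i)) -> Pall P (flatten [seq F i | i <- r]).
Proof. by move=> H; elim: r => [//|i r IH] /=; apply: Pall_cat. Qed.

End Pall.

(** * The Calderón-Zygmund decomposition of step functions *)

Section CZ_decomposition.
Context {R : realType} {n : nat}.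
Local Notation Rn := 'rV[R]_n.
Local Notation mu := (lebesgue_rV R n).
Implicit Types (f g h : Rn -> R[i]) (x y c : Rn) (S : set Rn) (b Q : box R n) (r s t : R).

Context {A CK Sth : R} {theta : R -> R} {T2 : (Rn -> R[i]) -> Rn -> R[i]}
  {K : Rn -> Rn -> R[i]}.
Hypothesis cz : cz_operator A CK Sth theta T2 K.

Lemma gen_sub_cube b k b' : 0 < b.2 -> b' \in gen b k ->
  cube b'.1 b'.2 `<=` cube b.1 b.2.
Proof.
elim: k b => [|k IH] b l0; first by rewrite inE => /eqP ->.
move=> /genS[e /IH]; rewrite /= divr_gt0// => /(_ isT) /subset_trans; apply.
move=> x H i; have := H i; rewrite !mxE !ler_norml => /andP[].
by case: (e i) => ? ?; apply/andP; split; lra.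
Qed.

(** The L^1 norm of [cstep Q k Z] ([L1n_cstep]) as a finite real sum, which splits over the children
    of [Q]. *)
Definition mass Q k (Z : Rn -> R[i]) : R := \sum_(b <- gen Q k) cabs (Z b.1) * b.2 ^+ n.

Lemma mass_ge0 Q k Z : 0 < Q.2 -> 0 <= mass Q k Z.
Proof.
move=> Q0; rewrite /mass big_seq; apply: sumr_ge0 => b bk.
by rewrite mulr_ge0 ?cabs_ge0// exprn_ge0// ltW// (gen_side_gt0 Q0 bk).
Qed.

Lemma massS Q k Z : mass Q k.+1 Z = \sum_e mass (kid Q e) k Z.
Proof. exact: big_genS. Qed.

Lemma L1n_supp f (D : set Rn) : measurable D -> (forall x, ~ D x -> f x = 0) ->
  L1n setT f = L1n D f.
Proof.
move=> mD f0; rewrite -[RHS]L1n_indic//; congr L1n; apply/funext => x.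
rewrite indicE; case: (boolP (x \in D)) => [_|/negP xD] /=; first by rewrite mulr1.
by rewrite f0 ?mul0r// => Dx; apply: xD; exact/mem_set.
Qed.

Lemma cstep_out Q k Z x : 0 < Q.2 -> ~ hbox Q x -> cstep Q k Z x = 0.
Proof. by move=> Q0 nx; rewrite cstepE// indicE memNset// mulr0. Qed.

Lemma L1n_cstep Q k Z : 0 < Q.2 -> L1n setT (cstep Q k Z) = (mass Q k Z)%:E.
Proof.
move=> Q0; have mQ := measurable_hbox Q.
have mc := measurable_cabs (measurable_cstep Q k Z).
rewrite (@L1n_supp _ (hbox Q))//; last by move=> x; exact: cstep_out.
rewrite /L1n (ge0_integral_gen _ k)//; last 2 first.
- by apply/measurable_EFinP; exact: measurable_funTS.
- by move=> x _; rewrite lee_fin cabs_ge0.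
rewrite /mass -sumEFin; apply: eq_big_seq => b bk.
have b0 := gen_side_gt0 Q0 bk.
rewrite (eq_integral (cst (cabs (Z b.1))%:E)); last first.
  move=> x /set_mem bx; have Qx := gen_sub Q0 bk bx.
  by rewrite cstepE// (ctr_gen Q0 bk bx) indicE mem_set// mulr1.
rewrite integral_cst; last exact: measurable_hbox.
by rewrite EFinM -mu_hbox// ltW.
Qed.

Lemma cintegral_cind b : 0 <= b.2 -> cintegral setT (cind b) = (b.2 ^+ n)%:C%C.
Proof.
move=> b0; rewrite /cintegral; congr Complex; last first.
  by rewrite (_ : (fun _ => _) = cst 0) ?Rintegral_cst ?mul0r.
rewrite /Rintegral /= integral_indic//; last exact: measurable_hbox.
by rewrite setIT; exact: (congr1 fine (mu_hbox b0)).
Qed.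

Lemma cstep_facts Q k Z : 0 < Q.2 -> bdint (cstep Q k Z) /\
  cintegral setT (cstep Q k Z) = \sum_(b <- gen Q k) Z b.1 * (b.2 ^+ n)%:C%C.
Proof.
move=> Q0; rewrite /cstep.
have H' b : b \in gen Q k -> 0 < b.2 by exact: gen_side_gt0.
elim: (gen Q k) H' => [|b s IH] H'.
  under eq_fun do rewrite big_nil; rewrite big_nil; split; first exact: bdint0.
  by rewrite /cintegral /= Rintegral_cst// mul0r.
have [|b1 b2] := IH; first by move=> b' b's; apply: H'; rewrite inE b's orbT.
have b0 : 0 <= b.2 by apply: ltW; apply: H'; exact: mem_head.
have bc := bdint_cind b0.
under eq_fun do rewrite big_cons.
split; first exact: (bdint_lin (Z b.1) bc b1).
have ci f : bdint f -> cintegrable setT f by move=> [mf _ fi]; exact: cintegrable_L1n.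
rewrite big_cons -b2 -cintegral_cind//.
exact: (cintegral_lin (Z b.1) measurableT (ci _ bc) (ci _ b1)).
Qed.

Lemma cabs_sum (I : Type) (s : seq I) (F : I -> R[i]) :
  cabs (\sum_(i <- s) F i) <= \sum_(i <- s) cabs (F i).
Proof.
elim: s => [|i s IH]; first by rewrite !big_nil cabs0.
by rewrite !big_cons; apply: (le_trans (cabsD _ _)); rewrite lerD2l.
Qed.

Lemma bdint_sum (I : Type) (s : seq I) (F : I -> Rn -> R[i]) (a : I -> R) :
  (forall i, bdint (F i)) -> (forall i, (L1n setT (F i) <= (a i)%:E)%E) ->
  bdint (fun x => \sum_(i <- s) F i x) /\
  (L1n setT (fun x => (\sum_(i <- s) F i x)%R) <= (\sum_(i <- s) a i)%:E)%E.
Proof.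
move=> bF aF; elim: s => [|i s [b1 b2]].
  under eq_fun do rewrite big_nil; split; first exact: bdint0.
  by rewrite /L1n; under eq_integral do rewrite cabs0; rewrite integral0 big_nil.
have E : (fun x => \sum_(j <- i :: s) F j x) = (fun x => 1 * F i x + \sum_(j <- s) F j x).
  by apply/funext => x; rewrite big_cons mul1r.
rewrite E; split; first exact: bdint_lin.
rewrite big_cons EFinD; apply: le_trans (leeD (aF i) b2).
have -> : (fun x => 1 * F i x + \sum_(j <- s) F j x) = (fun x => F i x + \sum_(j <- s) F j x).
  by apply/funext => x; rewrite mul1r.
by apply: L1nD => //; exact: bdint_meas.
Qed.

Definition atom : Type := (box R n * (Rn -> R[i]) * R)%type.

(** The number [w] is the mass of the decomposed function on the cube. It controls the L^1 norm of
    the atom and, through [lam], the volume of the cube, so one sum of the [w] bounds both the error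
    and the exceptional set. *)
Definition is_atom (lam : R) (p : atom) : Prop := let: (b, f, w) := p in
  [/\ 0 < b.2 /\ bdint f, (forall x, ~ hbox b x -> f x = 0) /\ cintegral setT f = 0,
   (L1n setT f <= (2 * w)%:E)%E, lam * b.2 ^+ n <= w &
   forall S r, 0 < r -> (forall x y, S x -> cube b.1 b.2 y -> far r x y) ->
     loc T2 K S r f].

Lemma atom_cstep b k Z lam : 0 < b.2 -> lam * b.2 ^+ n <= mass b k Z ->
  exists m : R[i], cabs m * b.2 ^+ n <= mass b k Z /\
   is_atom lam (b, fun x => cstep b k Z x - m * cind b x, mass b k Z).
Proof.
move=> b0 lm; have bn : 0 < b.2 ^+ n by rewrite exprn_gt0.
have [bs is_] := cstep_facts k Z b0; have bc := bdint_cind (ltW b0).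
set f := cstep b k Z in bs is_ *.
pose m : R[i] := (\sum_(b' <- gen b k) Z b'.1 * (b'.2 ^+ n)%:C%C) * ((b.2 ^+ n)^-1)%:C%C.
have mm : cabs m * b.2 ^+ n <= mass b k Z.
  rewrite /m cabsM cabs_real ger0_norm ?invr_ge0 ?(ltW bn)// -mulrA mulVf ?gt_eqF// mulr1.
  apply: (le_trans (cabs_sum _ _)); rewrite /mass big_seq [leRHS]big_seq.
  apply: ler_sum => b' b'k; rewrite cabsM cabs_real ger0_norm// exprn_ge0// ltW//.
  exact: gen_side_gt0 b'k.
exists m; split=> //.
have E : (fun x => f x - m * cind b x) = (fun x => - m * cind b x + f x).
  by apply/funext => x; rewrite mulNr addrC.
split.
- by split=> //; rewrite E; exact: bdint_lin.
- split=> [x nx|]; first by rewrite /f cstep_out// /cind indicE memNset// mulr0 subr0.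
  rewrite E cintegral_lin//; last 2 first.
  - by apply: cintegrable_L1n => //; [exact: bdint_meas|have [] := bc].
  - by apply: cintegrable_L1n => //; [exact: bdint_meas|have [] := bs].
  rewrite is_ cintegral_cind ?(ltW b0)// /m mulNr -mulrA -rmorphM mulVf ?gt_eqF//.
  by rewrite mulr1 addrC subrr.
- have mc : cmeasurable setT (fun x => - m * cind b x).
    by apply: cmeasurableM; [exact: cmeasurable_cst|exact: bdint_meas].
  rewrite E; apply: (le_trans (L1nD measurableT mc (bdint_meas bs))).
  rewrite L1nZ//; last exact: bdint_meas.
  rewrite cabsN L1n_cind ?(ltW b0)// L1n_cstep// -EFinM -EFinD lee_fin; lra.
- by [].
- move=> S r r0 Sb; rewrite E; apply: loc_lin; [exact: cz|exact: r0|exact: (loc_box cz r0 b0 Sb)|].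
  by apply: (loc_cstep cz) => // b' x y b'k _ Sx yb'; exact: (Sb _ _ Sx (gen_sub_cube b0 b'k yb')).
Qed.

(** A stopping time run as a recursion on [k]: a child of average above [lam] is selected, any other
    child is decomposed further. At generation 0 the function is constant on the cube, so its
    average bounds it there and the recursion ends. *)
Lemma cz_dec k Q Z lam : 0 < Q.2 -> 0 < lam -> mass Q k Z <= lam * Q.2 ^+ n ->
  exists g (s : seq atom),
  [/\ forall x, cstep Q k Z x = g x + \sum_(p <- s) p.1.2 x,
      bdint g /\ (forall x, cabs (g x) <= 2 ^+ n * lam),
      forall x, ~ hbox Q x -> g x = 0,
      (L1n setT g <= (mass Q k Z)%:E)%E &
      Pall (is_atom lam) s /\ \sum_(p <- s) p.2 <= mass Q k Z].
Proof.
move=> + lam0; have n1 : 1 <= 2 ^+ n :> R by rewrite exprn_ege1// ler1n.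
elim: k Q => [|k IH] Q Q0 mQ.
  exists (cstep Q 0 Z), [::]; split.
  - by move=> x; rewrite big_nil addr0.
  - split; first by have [] := cstep_facts 0 Z Q0.
    move=> x; rewrite cstepE// cabsM cabs_indic.
    move: mQ; rewrite /mass big_seq1 ler_pM2r ?exprn_gt0// => mQ.
    rewrite (@le_trans _ _ (cabs (Z Q.1)))//; last first.
      by apply: (le_trans mQ); rewrite ler_peMl// ltW.
    by rewrite ler_piMr ?cabs_ge0// indicE lern1; case: (_ \in _).
  - by move=> x; exact: cstep_out.
  - by rewrite L1n_cstep.
  - by split=> //; rewrite big_nil mass_ge0.
have k0 e : 0 < (kid Q e).2 by rewrite /= divr_gt0.
have H e : exists gs : (Rn -> R[i]) * seq atom,
  [/\ forall x, cstep (kid Q e) k Z x = gs.1 x + \sum_(p <- gs.2) p.1.2 x,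
      bdint gs.1 /\ (forall x, cabs (gs.1 x) <= 2 ^+ n * lam),
      forall x, ~ hbox (kid Q e) x -> gs.1 x = 0,
      (L1n setT gs.1 <= (mass (kid Q e) k Z)%:E)%E &
      Pall (is_atom lam) gs.2 /\ \sum_(p <- gs.2) p.2 <= mass (kid Q e) k Z].
  have [me|me] := leP (mass (kid Q e) k Z) (lam * (kid Q e).2 ^+ n).
    by have [g [s ?]] := IH _ (k0 e) me; exists (g, s).
  have [m [mm am]] := atom_cstep (k0 e) (ltW me).
  have bc := bdint_cind (ltW (k0 e)).
  have Em : (fun x => m * cind (kid Q e) x) = (fun x => m * cind (kid Q e) x + 0).
    by apply/funext => x; rewrite addr0.
  (* The parent was not selected, and its volume is 2^n times that of the child. *)
  have m2 : cabs m <= 2 ^+ n * lam.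
    have kn : 0 < (kid Q e).2 ^+ n by rewrite exprn_gt0.
    rewrite -(ler_pM2r kn); apply: (le_trans mm).
    have mle : mass (kid Q e) k Z <= mass Q k.+1 Z.
      rewrite massS (bigD1 e)//= lerDl; apply: sumr_ge0 => e' _; exact: mass_ge0.
    apply: (le_trans mle); apply: (le_trans mQ).
    rewrite [2 ^+ n * lam]mulrC -mulrA -exprMn.
    by rewrite (_ : 2 * (kid Q e).2 = Q.2)//= mulrCA divff ?mulr1.
  exists (fun x => m * cind (kid Q e) x,
    [:: (kid Q e, fun x => cstep (kid Q e) k Z x - m * cind (kid Q e) x, mass (kid Q e) k Z)]).
  split => /=.
  - by move=> x; rewrite big_seq1/= addrC subrK.
  - split; first by rewrite Em; apply: bdint_lin => //; exact: bdint0.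
    move=> x; rewrite cabsM cabs_indic; apply: le_trans m2.
    by rewrite ler_piMr ?cabs_ge0// indicE lern1; case: (_ \in _).
  - by move=> x nx; rewrite /cind indicE memNset// mulr0.
  - by rewrite L1nZ ?L1n_cind ?(ltW (k0 e))//; exact: bdint_meas.
  - by split=> //; rewrite big_seq1.
have [G HG] := choice H.
exists (fun x => \sum_e (G e).1 x), (flatten [seq (G e).2 | e <- index_enum {ffun 'I_n -> bool}]).
have [bS LS] := @bdint_sum _ (index_enum {ffun 'I_n -> bool}) (fun e => (G e).1)
  (fun e => mass (kid Q e) k Z) (fun e => let: And5 _ (conj a _) _ _ _ := HG e in a)
  (fun e => let: And5 _ _ _ a _ := HG e in a).
split.
- move=> x; rewrite big_flatten big_map -big_split /= /cstep big_genS.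
  by apply: eq_bigr => e _; have [<- _ _ _ _] := HG e.
- split=> // x; rewrite (bigD1 (orth Q x))//= big1 ?addr0.
    by have [_ [_ ->]] := HG (orth Q x).
  move=> e /eqP ne; have [_ _ -> //] := HG e.
  by move=> /(hbox_kid Q0).
- move=> x nx; rewrite big1// => e _; have [_ _ -> //] := HG e.
  by move=> /(kid_sub Q0).
- by rewrite massS.
- split; first by apply: Pall_flatten => e; have [_ _ _ _ []] := HG e.
  rewrite big_flatten big_map massS; apply: ler_sum => e _.
  by have [_ _ _ _ []] := HG e.
Qed.

End CZ_decomposition.

Arguments is_atom {R n} T2 K lam p.

Section weak_type.
Context {R : realType} {n : nat}.
Local Notation Rn := 'rV[R]_n.
Local Notation mu := (lebesgue_rV R n).
Implicit Types (f g h : Rn -> R[i]) (x y c : Rn) (S : set Rn) (b Q : box R n) (r s t : R).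

Context {A CK Sth : R} {theta : R -> R} {T2 : (Rn -> R[i]) -> Rn -> R[i]}
  {K : Rn -> Rn -> R[i]}.
Hypothesis cz : cz_operator A CK Sth theta T2 K.

Definition dilated (p : atom (R := R) (n := n)) : set Rn := cube p.1.1.1 (dil n * p.1.1.2).


Definition exceptional (s : seq (atom (R := R) (n := n))) : set Rn :=
  foldr (fun p E => dilated p `|` E) set0 s.

Lemma measurable_exceptional (s : seq atom) : measurable (exceptional s).
Proof.
elim: s => [|p s IH]; first exact: measurable0.
have mp : measurable (dilated p) by exact: measurable_cube.
exact: measurableU mp IH.
Qed.

Lemma mu_exceptional lam (s : seq atom) : 0 < lam -> Pall (is_atom T2 K lam) s ->
  (mu (exceptional s) <= (dil n ^+ n / lam * \sum_(p <- s) p.2)%:E)%E.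
Proof.
move=> lam0; elim: s => [_|[[b f] w] s IH [[[b0 _] _ _ bw _] /IH Hs]].
  by rewrite big_nil mulr0 measure0.
rewrite big_cons mulrDr EFinD /=.
apply: (le_trans (measureU2 _ _ _)); [exact: measurable_cube|exact: measurable_exceptional|].
apply: leeD => //; rewrite /dilated /= mu_cube ?mulr_ge0 ?(ltW dil_gt0) ?(ltW b0)//.
rewrite lee_fin exprMn -mulrA ler_wpM2l ?exprn_ge0 ?(ltW dil_gt0)//.
by rewrite mulrC ler_pdivlMr// mulrC.
Qed.

Lemma atoms_T2 lam (s : seq atom) : Pall (is_atom T2 K lam) s ->
  bdint (fun x => \sum_(p <- s) p.1.2 x) /\
  {ae mu, forall x, T2 (fun x => \sum_(p <- s) p.1.2 x) x = \sum_(p <- s) T2 p.1.2 x}.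
Proof.
elim: s => [_|[[b f] w] s IH [[[b0 bf] _ _ _ _] /IH[bs Ts]]].
  rewrite (_ : (fun x => _) = fun=> 0); last by apply/funext => x; rewrite big_nil.
  split; first exact: bdint0.
  by apply: filterS (T2_0 cz) => x ->; rewrite big_nil.
have E : (fun x => \sum_(p <- (b, f, w) :: s) p.1.2 x) =
   (fun x => 1 * f x + \sum_(p <- s) p.1.2 x).
  by apply/funext => x; rewrite big_cons mul1r.
rewrite E; split; first exact: bdint_lin.
apply: filterS2 Ts (cz_lin cz 1 (bdint_L2 bf) (bdint_L2 bs)) => x Ts ->.
by rewrite big_cons mul1r Ts.
Qed.

Lemma atoms_L1 lam (s : seq atom) D : Pall (is_atom T2 K lam) s -> measurable D ->
  D `<=` ~` exceptional s ->
  cmeasurable setT (fun x => \sum_(p <- s) T2 p.1.2 x) /\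
  (L1n D (fun x => (\sum_(p <- s) T2 p.1.2 x)%R) <=
     (4 * 4 ^+ n * CK * Sth * \sum_(p <- s) p.2)%:E)%E.
Proof.
move=> + mD; elim: s => [_ _|[[b f] w] s IH [[[b0 bf] [f0 If] Lf bw locf] /IH Hs] DE].
  under eq_fun do rewrite big_nil; split; first exact: cmeasurable_cst.
  rewrite /L1n (eq_integral (cst 0%E)); last by move=> x _; rewrite cabs0.
  by rewrite integral0 big_nil mulr0.
have [|ms Ls] := Hs; first by move=> x /DE /= nx ex; apply: nx; right.
have mT := T2m cz bf.
have E : (fun x => \sum_(p <- (b, f, w) :: s) T2 p.1.2 x) =
   (fun x => T2 f x + \sum_(p <- s) T2 p.1.2 x).
  by apply/funext => x; rewrite big_cons.
rewrite E; split; first exact: cmeasurableD.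
rewrite big_cons mulrDr EFinD.
have mS h : cmeasurable setT h -> cmeasurable D h.
  by move=> [? ?]; split; exact: measurable_funTS.
apply: (le_trans (L1nD mD (mS _ mT) (mS _ ms))); apply: leeD => //=.
have := atom_bound cz b0 bf f0 If Lf locf.
rewrite (_ : 4 * 4 ^+ n * CK * Sth * w = 2 * 4 ^+ n * CK * Sth * (2 * w)); last by ring.
apply: le_trans; apply: ge0_subset_integral => //.
- by apply: measurableC; exact: measurable_cube.
- by apply/measurable_EFinP; apply: measurable_funTS; exact: measurable_cabs.
- by move=> x _; rewrite lee_fin cabs_ge0.
- by move=> x /DE /= nx ex; apply: nx; left.
Qed.

(** The three terms come from the L^2 bound for the good part, the volume of the dilated cubes, and
    the integral of the images of the atoms off those cubes. *)
Definition Cstep : R := A ^+ 2 * 2 ^+ n + dil n ^+ n + 4 * 4 ^+ n * CK * Sth.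

Lemma Sth_ge0 : 0 <= Sth.
Proof. by have := cz_S cz 0; rewrite big_ord0. Qed.

Lemma Cstep_ge0 : 0 <= Cstep.
Proof.
have h1 : 0 <= A ^+ 2 * 2 ^+ n by apply: mulr_ge0; [exact: sqr_ge0|exact: exprn_ge0].
have h2 : 0 <= dil n ^+ n :> R by apply: exprn_ge0; exact: ltW dil_gt0.
have h3 : 0 <= 4 * 4 ^+ n * CK * Sth.
  apply: mulr_ge0; last exact: Sth_ge0.
  by apply: mulr_ge0; [rewrite mulr_ge0// exprn_ge0|exact: ltW (cz_CK cz)].
by rewrite /Cstep !addr_ge0.
Qed.

Lemma weak11_cstep Q k Z t : 0 < Q.2 -> 0 < t -> mass Q k Z <= t * Q.2 ^+ n ->
  (mu (lvl (t + t) (T2 (cstep Q k Z))) <= (Cstep * mass Q k Z / t)%:E)%E.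
Proof.
move=> Q0 t0 mQ; have [g [s [fE [bg gM] g0 Lg [ats ws]]]] := cz_dec cz Q0 t0 mQ.
have W0 := mass_ge0 k Z Q0; set W := mass Q k Z in mQ Lg ws W0 *.
have [bs Ts] := atoms_T2 ats.
have mE := measurable_exceptional s; have mEC := measurableC mE.
have [ms Ls] := atoms_L1 ats mEC (@subset_refl _ _).
have [bf _] := cstep_facts k Z Q0.
have := @lvl_tri _ _ _ mu t t (T2 (cstep Q k Z)) (T2 g) (fun x => \sum_(p <- s) T2 p.1.2 x)
  (T2m cz bf) (T2m cz bg) ms.
have -> : cstep Q k Z = (fun x => 1 * g x + \sum_(p <- s) p.1.2 x).
  by apply/funext => x; rewrite fE mul1r.
move=> /(_ _)/le_trans; apply.
  apply: filterS2 Ts (cz_lin cz 1 (bdint_L2 bg) (bdint_L2 bs)) => x Ts ->.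
  by rewrite mul1r Ts.
have h1 : (mu (lvl t (T2 g)) <= (A ^+ 2 * 2 ^+ n * W / t)%:E)%E.
  apply: (le_trans (T2cheb cz bg gM Lg t0)); rewrite lee_fin le_eqVlt; apply/orP; left; apply/eqP.
  by field; rewrite gt_eqF.
have h2 : (mu (exceptional s) <= (dil n ^+ n * W / t)%:E)%E.
  apply: (le_trans (mu_exceptional t0 ats)); rewrite lee_fin mulrAC ler_pM2r ?invr_gt0//.
  by rewrite ler_wpM2l ?exprn_ge0 ?(ltW dil_gt0).
have h3 : (mu (~` exceptional s `&` [set x | (t < cabs (\sum_(p <- s) T2 p.1.2 x))%R]) <=
    (4 * 4 ^+ n * CK * Sth * W / t)%:E)%E.
  apply: markov_le => //.
  - by apply: measurable_funTS; exact: measurable_cabs.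
  - by move=> x _; exact: cabs_ge0.
  - apply: (le_trans Ls); rewrite lee_fin ler_wpM2l//.
    by rewrite !mulr_ge0 ?exprn_ge0 ?(ltW (cz_CK cz)) ?Sth_ge0.
have -> : Cstep * W / t = A ^+ 2 * 2 ^+ n * W / t + (dil n ^+ n * W / t + 4 * 4 ^+ n * CK * Sth * W / t).
  by rewrite /Cstep; field; rewrite gt_eqF.
rewrite EFinD [X in (_ <= _ + X)%E]EFinD; apply: leeD => //.
have ml := measurable_lvl t ms.
apply: (le_trans _ (leeD h2 h3)); apply: (le_trans _ (measureU2 _ _ _)) => //.
- apply: le_measure; rewrite ?inE//.
    by apply: measurableU => //; apply: measurableI.
  move=> x tx; have [ex|nx] := pselect (exceptional s x); first by left.
  by right.
- by apply: measurableI.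
Qed.

(** The factor 4 reflects the use of [weak11_cstep] with t = s/4, half of the level s being reserved
    for the approximation error. *)
Definition C11 : R := 4 * Cstep.

Lemma lee_addgt0_lin (x : \bar R) (a c : R) : 0 <= c ->
  (forall e, 0 < e -> e <= 1 -> (x <= (a + c * e)%:E)%E) -> (x <= a%:E)%E.
Proof.
move=> c0 H; apply/lee_addgt0Pr => e e0; pose d := Num.min 1 (e / (c + 1)).
have c1 : 0 < c + 1 by rewrite ltr_wpDl.
have d0 : 0 < d by rewrite lt_min ltr01 divr_gt0.
apply: (le_trans (H d d0 _)); first by rewrite ge_min lexx.
rewrite -EFinD lee_fin lerD2l; apply: (@le_trans _ _ ((c + 1) * d)).
  by rewrite ler_wpM2r ?(ltW d0)// lerDl.
by rewrite mulrC -ler_pdivlMr// ge_min lexx orbT.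
Qed.

(** The side of [Q] can be made large, so that the root is not selected in the decomposition, and
    the mesh small, so that cubes meeting the support stay near it. *)
Lemma bdint_step_approx f M a L1 rho e : bdint f -> (forall x, cabs (f x) <= M) ->
  (L1n setT f <= a%:E)%E -> 0 < e -> 0 < rho ->
  exists Q k Z, [/\ 0 < Q.2 /\ Q.2 / 2 ^+ k <= rho, L1 <= Q.2, forall x, cabs (cstep Q k Z x) <= 2 * M,
    mass Q k Z <= a + e & (L1n setT (fun x => (f x - cstep Q k Z x)%R) <= e%:E)%E].
Proof.
move=> bf HM fa e0 rho0; have mf := bdint_meas bf; have [_ _ fi] := bf.
have e2 : 0 < e / 2 by lra.
have [L0 HL0] := tail_box mf fi e2.
pose L := Num.max L0 (Num.max L1 1).
have L0L : L0 <= L by rewrite le_max lexx.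
have L1L : L1 <= L by rewrite !le_max lexx orbT.
have Lp : 0 < L by rewrite !lt_max ltr01 !orbT.
pose Q : box R n := (0, L).
have [k0 Hk0] := @step_approx _ _ Q f M _ Lp mf HM e2.
pose k1 := maxn k0 (Num.truncn (L / rho)).+1.
have k1rho : L / 2 ^+ k1 <= rho.
  rewrite ler_pdivrMr ?exprn_gt0// mulrC -ler_pdivrMr//.
  apply: (le_trans (ltW (truncnS_gt _))); set j := (Num.truncn _).+1.
  apply: (@le_trans _ _ (2 ^+ j)); first by rewrite -natrX ler_nat ltnW// ltn_expl.
  by apply: ler_weXn2l; [rewrite ler1n|exact: leq_maxr].
have [Z [ZM Ze]] := Hk0 k1 (leq_maxl _ _).
have M0 : 0 <= M := le_trans (cabs_ge0 _) (HM 0).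
have mQ := measurable_hbox Q.
have mc := measurable_cstep Q k1 Z.
have Lfc : (L1n setT (fun x => (f x - cstep Q k1 Z x)%R) <= e%:E)%E.
  rewrite /L1n -(setUv (hbox Q)) ge0_integral_setU//; last 4 first.
  - exact: measurableC.
  - rewrite setUv; apply/measurable_EFinP; apply: measurable_cabs; exact: cmeasurableB.
  - by move=> x _; rewrite lee_fin cabs_ge0.
  - by apply/disj_setPCl.
  rewrite [e in leRHS](splitr e) EFinD; apply: leeD => //.
  apply: le_trans (HL0 L L0L); rewrite le_eqVlt; apply/orP; left; apply/eqP.
  by apply: eq_integral => x /set_mem nx; rewrite cstep_out ?subr0.
exists Q, k1, Z; split=> //.
- move=> x; rewrite cstepE// cabsM cabs_indic; apply: le_trans (ZM (ctr Q k1 x)).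
  by rewrite ler_piMr ?cabs_ge0// indicE lern1; case: (_ \in _).
- rewrite -lee_fin -L1n_cstep// EFinD; apply: le_trans (leeD fa Lfc).
  apply: le_integral_EFinD => //; try exact: measurable_cabs.
  + by apply: measurable_cabs; exact: cmeasurableB.
  + by move=> x _; exact: cabs_ge0.
  + by move=> x _; exact: cabs_ge0.
  + by move=> x _; exact: cabs_ge0.
  + by move=> x _; rewrite addrC cabsBC; exact: cabs_le_add.
Qed.

Theorem weak11 f a s : bdint f -> (L1n setT f <= a%:E)%E -> 0 < s ->
  (mu (lvl s (T2 f)) <= (C11 * a / s)%:E)%E.
Proof.
move=> bf fa s0; have [_ [M HM] _] := bf.
have M0 : 0 <= M := le_trans (cabs_ge0 _) (HM 0).
have a0 : 0 <= a by rewrite -lee_fin; exact: le_trans (L1n_ge0 _ _) fa.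
have C0 := Cstep_ge0.
apply: (@lee_addgt0_lin _ _ (C11 / s + A ^+ 2 * (3 * M) * 4 / s ^+ 2)) => [|e e0 e1].
  apply: addr_ge0; apply: divr_ge0; [exact: mulr_ge0|exact: ltW| |exact: sqr_ge0].
  by apply: mulr_ge0 => //; apply: mulr_ge0; [exact: sqr_ge0|exact: mulr_ge0].
(* The side is at least 1 and at least (a + 1)/(s/4); since n > 0 this gives a + 1 <= (s/4) |Q|, as
   [weak11_cstep] requires. The error has sup norm at most 3M and L^1 norm at most e, hence a
   contribution of order e. *)
have [Q [k [Z [[Q0 _] LQ cM mQ Lfc]]]] :=
  bdint_step_approx (Num.max 1 ((a + 1) / (s / 4))) bf HM fa e0 ltr01.
have s4 : 0 < s / 4 by lra.
have mQ' : mass Q k Z <= s / 4 * Q.2 ^+ n.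
  apply: (le_trans mQ); apply: (@le_trans _ _ (a + 1)); first by rewrite lerD2l.
  move: LQ; rewrite ge_max => /andP[Q1 Q2].
  rewrite mulrC -ler_pdivrMr//; apply: (le_trans Q2).
  by rewrite -[leLHS]expr1; apply: ler_weXn2l => //; exact: cz_n cz.
have [bc _] := cstep_facts k Z Q0; have bd := bdintB bf bc.
have := @lvl_tri _ _ _ mu (s / 4 + s / 4) (s / 2) (T2 f) _ _ (T2m cz bf) (T2m cz bc) (T2m cz bd).
rewrite (_ : s / 4 + s / 4 + s / 2 = s); last by field.
move=> /(_ _)/le_trans; apply.
  apply: filterS (T2B cz bf bc) => x ->; by rewrite addrC subrK.
have bound x : cabs (f x - cstep Q k Z x) <= 3 * M.
  by apply: (le_trans (cabsB _ _)); have := HM x; have := cM x; lra.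
apply: (@le_trans _ _ ((C11 * (a + e) / s)%:E + (A ^+ 2 * (3 * M * e) / (s / 2) ^+ 2)%:E)%E).
  apply: leeD; last by apply: T2cheb => //; [exact: cz|lra].
  apply: (le_trans (weak11_cstep Q0 s4 mQ')); rewrite lee_fin /C11.
  rewrite (_ : 4 * Cstep * (a + e) / s = Cstep * (a + e) / (s / 4)); last by field; rewrite gt_eqF.
  by rewrite ler_pM2r ?invr_gt0// ler_wpM2l.
rewrite -EFinD lee_fin le_eqVlt; apply/orP; left; apply/eqP.
by field; rewrite gt_eqF.
Qed.

End weak_type.

(** * Extension to L^1 *)

Section schwartz_density.
Context {R : realType} {n : nat}.
Local Notation Rn := 'rV[R]_n.
Local Notation mu := (lebesgue_rV R n).
Implicit Types (f g h : Rn -> R[i]) (x y c : Rn) (r s t : R).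

(** The sigma-algebra is generated by the coordinates, not by the open sets. A continuous function
    is the limit of its values at centres of dyadic cubes, taken in boxes of side N + 1 with mesh (N
    + 1)/4^N. *)
Lemma continuous_measurable_rV (f : Rn -> R) : continuous f -> measurable_fun setT f.
Proof.
move=> cf; pose Q N : box R n := (0, N.+1%:R).
apply: (@measurable_fun_cvg _ _ R setT (fun N => f \o ctr (Q N) (2 * N))).
  by move=> N; exact: measurable_fun_ctr.
move=> x _; suff C : (fun N => ctr (Q N) (2 * N) x) @ \oo --> (x : Rn).
  exact: (cvg_comp _ _ C (cf x)).
apply/cvg_ballP => e e0; near=> N.
have Q0 : 0 < (Q N).2 by rewrite /= ltr0n.
have xQ : hbox (Q N) x.
  move=> i; rewrite /= mxE.
  have : 2 * (\sum_(j < n) `|x ord0 j|) < N.+1%:R.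
    by apply: (@lt_le_trans _ _ N%:R); [near: N; exact: nbhs_infty_gtr|rewrite ler_nat].
  have : `|x ord0 i| <= \sum_(j < n) `|x ord0 j| by rewrite (bigD1 i)//= lerDl sumr_ge0.
  by rewrite ler_norml => /andP[? ?] ?; apply/andP; split; lra.
have Ne : e^-1 < N%:R by near: N; exact: nbhs_infty_gtr.
split=> // i j; rewrite (ord1 i) /ball /=.
apply: (le_lt_trans (ctr_near (2 * N) j Q0 xQ)) => /=.
rewrite ltr_pdivrMr ?exprn_gt0//.
have N1 : N.+1%:R <= 2 ^+ N :> R by rewrite -natrX ler_nat ltn_expl.
have : 1 < e * N.+1%:R.
  by rewrite -ltr_pdivrMl// mulr1 (lt_le_trans Ne)// ler_nat.
have -> : 2 ^+ (2 * N) = 2 ^+ N * 2 ^+ N :> R by rewrite mulnC exprM expr2.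
move=> eN; apply: (@lt_le_trans _ _ (e * N.+1%:R * 2 ^+ N)).
  by rewrite (le_lt_trans N1)// ltr_pMl// exprn_gt0.
by rewrite mulrA ler_wpM2r ?exprn_ge0// ler_wpM2l// ltW.
Unshelve. all: end_near. Qed.

Lemma schwartz_bounded f : schwartz f -> cmeasurable setT f /\ exists M, forall x, cabs (f x) <= M.
Proof.
move=> [[sr si] H]; split; last first.
  have [M HM] := H (fun=> 0%N) [::]; exists M => x; apply: le_trans (HM x).
  by rewrite /monomial big1 ?normr1 ?mul1r// /cpderivs /=; case: (f x) => a b; exact: lexx.
by split; apply: continuous_measurable_rV => x; apply: differentiable_continuous;
  [exact: (sr [::])|exact: (si [::])].
Qed.

(** A concrete class of Schwartz functions, stable under linear combinations and dense in L^1
    ([test_dense]). *)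
Definition test_fun f := [/\ flatfun (fun x => complex.Re (f x)),
  flatfun (fun x => complex.Im (f x)) &
  exists l : R, forall x, ~ cube (0 : Rn) l x -> f x = 0].

Lemma test_fun_schwartz f : test_fun f -> schwartz f.
Proof. by move=> [fr fi [l fl]]; exact: flatfun_schwartz fl. Qed.

Lemma test_fun_bdint f : test_fun f -> bdint f.
Proof.
move=> tf; have [mf [M HM]] := schwartz_bounded (test_fun_schwartz tf).
have [_ _ [l fl]] := tf; split=> //; first by exists M.
pose L := Num.max l 0.
have fL x : ~ cube (0 : Rn) L x -> f x = 0.
  by move=> nx; apply: fl => cx; apply: nx; apply: le_cube cx; rewrite le_max lexx.
rewrite (@L1n_supp _ _ _ (cube (0 : Rn) L))//; last exact: measurable_cube.
have mc : measurable (cube (0 : Rn) L) by exact: measurable_cube.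
apply: (@le_lt_trans _ _ (\int[mu]_(x in cube (0%R : Rn) L) (cst M%:E) x)%E).
  apply: ge0_le_integral => //.
  - by move=> x _; rewrite lee_fin cabs_ge0.
  - by apply/measurable_EFinP; apply: measurable_funTS; exact: measurable_cabs.
  - by move=> x _; rewrite lee_fin.
rewrite integral_cst// lte_mul_pinfty//.
  by rewrite lee_fin; exact: le_trans (cabs_ge0 _) (HM 0).
suff : (mu (cube (0%R : Rn) L) < +oo)%E by [].
by rewrite mu_cube ?ltry// le_max lexx orbT.
Qed.

Lemma test_fun_lin (c : R[i]) f g : test_fun f -> test_fun g ->
  test_fun (fun x => c * f x + g x).
Proof.
move=> [fr fi [l fl]] [gr gi [l' gl]]; split.
- under eq_fun do rewrite ReD ReM; apply: flatfunD => //.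
  under eq_fun do rewrite -mulNr.
  by apply: flatfunD; apply: flatfunM => //; exact: flatfun_cst.
- under eq_fun do rewrite ImD ImM; apply: flatfunD => //.
  by apply: flatfunD; apply: flatfunM => //; exact: flatfun_cst.
- exists (Num.max l l') => x nx; rewrite fl ?gl ?mulr0 ?addr0// => cx; apply: nx;
    by apply: le_cube cx; rewrite le_max lexx ?orbT.
Qed.

Lemma test_fun_cind b e : 0 < b.2 -> 0 < e -> exists f, test_fun f /\
  (L1n setT (fun x => (cind b x - f x)%R) <= e%:E)%E.
Proof.
move=> b0 e0; have [phi [sphi phi01 phiS dphi]] := smooth_box b.1 b0 e0.
exists (fun x => (phi x)%:C%C); split; first split.
- exact: sphi.
- exact: flatfun_cst.
- exists (2 * (\sum_(j < n) `|b.1 ord0 j|) + b.2) => x nx; rewrite phiS// => cx.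
  apply: nx => i; rewrite !mxE subr0; have := cx i.
  have : `|b.1 ord0 i| <= \sum_(j < n) `|b.1 ord0 j| by rewrite (bigD1 i)//= lerDl sumr_ge0.
  have := ler_normD (x ord0 i - b.1 ord0 i) (b.1 ord0 i); rewrite subrK; lra.
- apply: le_trans dphi; rewrite le_eqVlt; apply/orP; left; apply/eqP.
  apply: eq_integral => x _; rewrite -cabs_real /cind rmorphB.
  by case: (b).
Qed.

Lemma L1n_tri f g h : cmeasurable setT f -> cmeasurable setT g -> cmeasurable setT h ->
  (L1n setT (fun x => (f x - h x)%R) <=
   L1n setT (fun x => (f x - g x)%R) + L1n setT (fun x => (g x - h x)%R))%E.
Proof.
move=> mf mg mh; have m1 := cmeasurableB mf mg; have m2 := cmeasurableB mg mh.
apply: le_trans (L1nD measurableT m1 m2); rewrite le_eqVlt; apply/orP; left; apply/eqP.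
by apply: eq_integral => x _; rewrite addrA subrK.
Qed.

Lemma L1nC f g : L1n setT (fun x => f x - g x) = L1n setT (fun x => g x - f x).
Proof. by apply: eq_integral => x _; rewrite cabsBC. Qed.

Lemma test_fun_cstep Q k (Z : Rn -> R[i]) e : 0 < Q.2 -> 0 < e ->
  exists f, test_fun f /\ (L1n setT (fun x => (cstep Q k Z x - f x)%R) <= e%:E)%E.
Proof.
move=> Q0; rewrite /cstep; have H' b : b \in gen Q k -> 0 < b.2 by exact: gen_side_gt0.
elim: (gen Q k) H' e => [|b s IH] H' e e0.
  exists (fun=> 0); split.
    by split; [exact: flatfun_cst|exact: flatfun_cst|exists 0].
  rewrite /L1n; under eq_integral do rewrite big_nil subrr cabs0.
  by rewrite integral0 lee_fin ltW.
have e2 : 0 < e / 2 by lra.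
have [|f [tf fe]] := IH _ _ e2; first by move=> b' b's; apply: H'; rewrite inE b's orbT.
have z0 : 0 < cabs (Z b.1) + 1 by rewrite ltr_wpDl ?cabs_ge0.
have b0 := H' b (mem_head _ _).
have [g [tg ge]] := test_fun_cind b0 (divr_gt0 e2 z0).
exists (fun x => Z b.1 * g x + f x); split; first exact: test_fun_lin.
have mg := bdint_meas (test_fun_bdint tg); have mf := bdint_meas (test_fun_bdint tf).
have mc := bdint_meas (bdint_cind (ltW b0)).
have ms : cmeasurable setT (fun x => \sum_(b <- s) Z b.1 * (\1_(hbox b) x)%:C%C).
  elim: (s) => [|b' s' IH'].
    by under eq_fun do rewrite big_nil; exact: cmeasurable_cst.
  under eq_fun do rewrite big_cons; apply: cmeasurableD => //.
  by apply: cmeasurable_indic; [exact: cmeasurable_cst|exact: measurable_hbox].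
have m1 := cmeasurableM (cmeasurable_cst setT (Z b.1)) (cmeasurableB mc mg).
have m2 := cmeasurableB ms mf.
rewrite [e in leRHS](splitr e) EFinD.
have h1 : (L1n setT (fun x => (Z b.1 * (cind b x - g x))%R) <= (e / 2)%:E)%E.
  rewrite L1nZ//; last exact: cmeasurableB.
  apply: (@le_trans _ _ ((cabs (Z b.1))%:E * (e / 2 / (cabs (Z b.1) + 1))%:E)%E).
    by apply: lee_wpmul2l => //; rewrite lee_fin cabs_ge0.
  rewrite -EFinM lee_fin mulrCA ler_piMr ?(ltW e2)// ler_pdivrMr// mul1r lerDl//.
apply: le_trans (leeD h1 fe); apply: le_trans (L1nD measurableT m1 m2).
rewrite le_eqVlt; apply/orP; left; apply/eqP; apply: eq_integral => x _.
by rewrite big_cons /cind mulrBr opprD addrACA.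
Qed.

End schwartz_density.

Section extension_to_L1.
Context {R : realType} {n : nat}.
Local Notation Rn := 'rV[R]_n.
Local Notation mu := (lebesgue_rV R n).
Implicit Types (f g h : Rn -> R[i]) (x y c : Rn) (S : set Rn) (b Q : box R n) (r s t : R).

Context {A CK Sth : R} {theta : R -> R} {T2 : (Rn -> R[i]) -> Rn -> R[i]}
  {K : Rn -> Rn -> R[i]}.
Hypothesis cz : cz_operator A CK Sth theta T2 K.

Local Notation C1 := (@C11 R n A CK Sth).

Lemma C11_ge0 : 0 <= C1.
Proof. by rewrite /C11 mulr_ge0//; exact: Cstep_ge0 cz. Qed.

Definition cint f := cmeasurable setT f /\ (L1n setT f < +oo)%E.

Lemma cintB f g : cint f -> cint g -> cint (fun x => f x - g x).
Proof.
move=> [mf fi] [mg gi]; split; first exact: cmeasurableB.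
rewrite subE; have m1 : cmeasurable setT (fun x => -1 * g x).
  by apply: cmeasurableM => //; exact: cmeasurable_cst.
apply: (le_lt_trans (L1nD measurableT m1 mf)); rewrite L1nZ//.
by rewrite lte_add_pinfty// lte_mul_pinfty// lee_fin cabs_ge0.
Qed.

Lemma bdint_dense g e rho L1 : cint g -> 0 < e -> 0 < rho ->
  exists Q k Z, [/\ 0 < Q.2, Q.2 / 2 ^+ k <= rho, L1 <= Q.2 &
    (L1n setT (fun x => (cstep Q k Z x - g x)%R) <= e%:E)%E].
Proof.
move=> [mg gi] e0 rho0; have e2 : 0 < e / 2 by lra.
have [g1 [bg1 d1]] := truncation mg gi e2.
have [mg1 [M HM] _] := bg1.
have [Q [k [Z [[Q0 Qr] LQ _ _ d2]]]] :=
  bdint_step_approx L1 bg1 HM (bdint_L1n bg1) e2 rho0.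
exists Q, k, Z; split=> //; rewrite L1nC.
apply: (le_trans (L1n_tri mg mg1 (measurable_cstep Q k Z))).
by rewrite [e in leRHS](splitr e) EFinD leeD.
Qed.

Lemma test_dense g e : cint g -> 0 < e -> exists f, test_fun f /\
  (L1n setT (fun x => (f x - g x)%R) <= e%:E)%E.
Proof.
move=> ig e0; have [mg gi] := ig; have e2 : 0 < e / 2 by lra.
have [Q [k [Z [Q0 _ _ d1]]]] := bdint_dense 1 ig e2 ltr01.
have [f [tf d2]] := test_fun_cstep k Z Q0 e2; exists f; split=> //.
have mf := bdint_meas (test_fun_bdint tf).
apply: (le_trans (L1n_tri mf (measurable_cstep Q k Z) mg)).
by rewrite [e in leRHS](splitr e) EFinD leeD// L1nC.
Qed.

(* [h] is the value at [g] of the continuous extension of [T2] to [L^1], in the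
   quantitative form given by the weak type (1,1) estimate. *)
Definition ext (C : R) g h := [/\ cint g, cmeasurable setT h &
  forall f a s, bdint f -> (L1n setT (fun x => (f x - g x)%R) <= a%:E)%E -> 0 < s ->
    (mu (lvl s (fun x => (T2 f x - h x)%R)) <= (C * a / s)%:E)%E].

Lemma T2B_weak f g a s : bdint f -> bdint g ->
  (L1n setT (fun x => (f x - g x)%R) <= a%:E)%E -> 0 < s ->
  (mu (lvl s (fun x => (T2 f x - T2 g x)%R)) <= (C1 * a / s)%:E)%E.
Proof.
move=> bf bg fga s0; apply: le_trans (weak11 cz (bdintB bf bg) fga s0).
apply: ae_le_measure.
- by apply: measurable_lvl; apply: cmeasurableB; exact: (T2m cz).
- by apply: measurable_lvl; apply: (T2m cz); exact: bdintB.
- by apply: filterS (T2B cz bf bg) => x; rewrite /lvl /= => ->.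
Qed.

Lemma halves_bound a d e s : 0 < s -> C1 * (a + e) / (s / 2) + d * e / (s / 2) =
  2 * C1 * a / s + (2 * C1 / s + 2 * d / s) * e.
Proof. by move=> s0; field; rewrite gt_eqF. Qed.

(** For a test function phi near [g], split T2 f - h into T2 (f - phi) and T2 phi - h. The level is
    halved, which doubles the weak type constant, and the error tends to 0. *)
Lemma L1_value_ext g h : is_L1_value T2 g h -> ext (2 * C1) g h.
Proof.
move=> [[mg gi] mh H]; have ig : cint g by split=> //; rewrite -cLnorm1E.
split=> // f a s bf fga s0; have C0 := C11_ge0.
apply: (@lee_addgt0_lin _ _ _ (2 * C1 / s + 2 * 1 / s)) => [|e e0 _].
  by rewrite addr_ge0// divr_ge0// ?(ltW s0)// mulr_ge0.
have [d d0 Hd] := H _ e0; pose e' := Num.min e (d / 2).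
have e'0 : 0 < e' by rewrite lt_min e0; lra.
have [phi [tphi phig]] := test_dense ig e'0.
have bphi := test_fun_bdint tphi; have mf := bdint_meas bf; have mphi := bdint_meas bphi.
have sphi := test_fun_schwartz tphi.
have e'e : e' <= e by rewrite ge_min lexx.
have phid : (cLnorm 1 (fun x => (phi x - g x)%R) < d%:E)%E.
  rewrite cLnorm1E (le_lt_trans phig)// lte_fin.
  by apply: (@le_lt_trans _ _ (d / 2)); [rewrite ge_min lexx orbT|lra].
have wd := Hd _ sphi phid.
have s2 : 0 < s / 2 by lra.
have mT := T2m cz bf; have mTp := T2m cz bphi.
have fphi : (L1n setT (fun x => (f x - phi x)%R) <= (a + e)%:E)%E.
  apply: (le_trans (L1n_tri mf mg mphi)); rewrite EFinD leeD// L1nC.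
  by apply: le_trans phig _; rewrite lee_fin.
rewrite -halves_bound// EFinD [s in lvl s _](splitr s).
apply: (le_trans (@lvl_tri _ _ _ mu (s / 2) (s / 2) _ (fun x => T2 f x - T2 phi x)
  (fun x => T2 phi x - h x) _ _ _ _)).
- exact: cmeasurableB.
- exact: cmeasurableB.
- exact: cmeasurableB.
- by apply: aeW => x; rewrite addrA subrK.
apply: leeD; first exact: T2B_weak.
rewrite mul1r [e / _]mulrC EFinM lee_pdivlMl//; apply: le_trans wd.
by apply: ereal_sup_ubound; exists (s / 2).
Qed.

(** A Schwartz function is bounded, and integrable if it is near [g]. Then s times the bound C a / s
    is C a for every level s, which bounds the weak norm. *)
Lemma ext_L1_value C g h : 0 <= C -> ext C g h -> is_L1_value T2 g h.
Proof.
move=> C0 [[mg gi] mh H]; split=> //; first by split=> //; rewrite cLnorm1E.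
move=> e e0; pose d := e / (C + 1); have C10 : 0 < C + 1 by rewrite ltr_wpDl.
have d0 : 0 < d by rewrite divr_gt0.
exists d => // f sf fg; have [mf [M HM]] := schwartz_bounded sf.
have fg' : (L1n setT (fun x => (f x - g x)%R) <= d%:E)%E by rewrite -cLnorm1E ltW.
have bf : bdint f.
  split=> //; first by exists M.
  have mfg := cmeasurableB mf mg.
  have -> : L1n setT f = L1n setT (fun x => (f x - g x) + g x).
    by apply: eq_integral => x _; rewrite subrK.
  apply: (le_lt_trans (L1nD measurableT mfg mg)); rewrite lte_add_pinfty//.
  exact: le_lt_trans fg' (ltry _).
apply: ub_ereal_sup => _ [s s0 ->]; apply: (@le_trans _ _ (s%:E * (C * d / s)%:E)%E).
  by apply: lee_wpmul2l; [rewrite lee_fin ltW|exact: H].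
rewrite -EFinM lee_fin mulrCA divff ?gt_eqF// mulr1 /d mulrCA ler_piMr ?(ltW e0)//.
by rewrite ler_pdivrMr// mul1r lerDl.
Qed.

Lemma ext_weak C g h a s : ext C g h -> (L1n setT g <= a%:E)%E -> 0 < s ->
  (mu (lvl s h) <= (C * a / s)%:E)%E.
Proof.
move=> [[mg gi] mh H] ga s0.
have E : L1n setT (fun x => 0 - g x) = L1n setT g.
  by apply: eq_integral => x _; rewrite sub0r cabsN.
have ga0 : (L1n setT (fun x => (0 - g x)%R) <= a%:E)%E by rewrite E.
apply: le_trans (H _ _ _ bdint0 ga0 s0); apply: ae_le_measure.
- exact: measurable_lvl.
- by apply: measurable_lvl; apply: cmeasurableB => //; apply: (T2m cz); exact: bdint0.
- by apply: filterS (T2_0 cz) => x; rewrite /lvl /= => ->; rewrite sub0r cabsN.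
Qed.

(** For a test function phi near [g1], phi - f is near [g2], and T2 f - (h1 - h2) = (T2 phi - h1) +
    (h2 - T2 (phi - f)). The two hypotheses are applied at level s/2. *)
Lemma ext_sub C g1 h1 g2 h2 : 0 <= C -> ext C g1 h1 -> ext C g2 h2 ->
  ext (4 * C) (fun x => g1 x - g2 x) (fun x => h1 x - h2 x).
Proof.
move=> C0 [ig1 mh1 H1] [ig2 mh2 H2]; split; [exact: cintB|exact: cmeasurableB|].
move=> f a s bf fa s0; have a0 : 0 <= a by rewrite -lee_fin; exact: le_trans (L1n_ge0 _ _) fa.
have [mg1 _] := ig1; have [mg2 _] := ig2; have mf := bdint_meas bf.
apply: (@lee_addgt0_lin _ _ _ (4 * C / s)) => [|e e0 _].
  by rewrite divr_ge0// ?(ltW s0)// mulr_ge0.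
have [phi [tphi phig]] := test_dense ig1 e0.
have bphi := test_fun_bdint tphi; have bpf := bdintB bphi bf; have mphi := bdint_meas bphi.
have s2 : 0 < s / 2 by lra.
have d2 : (L1n setT (fun x => (phi x - f x - g2 x)%R) <= (a + e)%:E)%E.
  have mg12 := cmeasurableB mg1 mg2.
  have -> : L1n setT (fun x => phi x - f x - g2 x) =
     L1n setT (fun x => phi x - g1 x + (g1 x - g2 x - f x)).
    by apply: eq_integral => x _; congr (cabs _)%:E; ring.
  apply: (le_trans (L1nD measurableT (cmeasurableB mphi mg1) (cmeasurableB mg12 mf))).
  by rewrite addrC EFinD leeD// L1nC.
have := leeD (H1 _ _ _ bphi phig s2) (H2 _ _ _ bpf d2 s2).
have E : C * e / (s / 2) + C * (a + e) / (s / 2) = 2 * C * a / s + 4 * C / s * e.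
  by field; rewrite gt_eqF.
rewrite -EFinD E => /(le_trans _) H; apply: le_trans (H _ _) _; last first.
  rewrite lee_fin lerD2r ler_pM2r ?invr_gt0// ler_wpM2r// ler_wpM2r//; lra.
rewrite [s in lvl s _](splitr s).
have mTp := T2m cz bphi; have mTf := T2m cz bf; have mTpf := T2m cz bpf.
have -> : lvl (s / 2) (fun x => T2 (fun x => phi x - f x) x - h2 x) =
   lvl (s / 2) (fun x => h2 x - T2 (fun x => phi x - f x) x).
  by apply/seteqP; split => x; rewrite /lvl /= cabsBC.
apply: lvl_tri.
- by apply: cmeasurableB => //; exact: cmeasurableB.
- exact: cmeasurableB.
- exact: cmeasurableB.
- by apply: filterS (T2B cz bphi bf) => x ->; ring.
Qed.

(** The kernel formula passes from step functions to L^1 as in [loc_box], provided that the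
    approximants stay away from [S]. *)
Lemma ext_locality C g h S r : 0 <= C -> ext C g h -> 0 < r ->
  (forall x y, S x -> g y != 0 -> far r x y) ->
  {ae mu, forall x, S x -> h x = cintegral setT (fun y => K x y * g y)}.
Proof.
move=> C0 [ig mh H] r0 Sg; have [mg gi] := ig; apply: ae_eq_small => t e t0 e0.
have r2 : 0 < r / 2 by lra.
pose C2 := 2 * (CK * (r / 2) ^- n); have C20 : 0 <= C2.
  by rewrite mulr_ge0// mulr_ge0 ?(ltW (cz_CK cz))// invr_ge0 exprn_ge0// ltW.
have t2 : 0 < t / 2 by lra.
pose eta := Num.min (t / 2 / (C2 + 1)) (e / (C / (t / 2) + 1)).
have C30 : 0 <= C / (t / 2) by rewrite divr_ge0// ltW.
have eta0 : 0 < eta by rewrite lt_min !divr_gt0// ltr_wpDl.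
have eta1 : C2 * eta <= t / 2.
  rewrite (le_trans (ler_wpM2r (ltW eta0) (_ : C2 <= C2 + 1))) ?lerDl//.
  by rewrite mulrC -ler_pdivlMr ?ltr_wpDl// ge_min lexx.
have eta2 : C / (t / 2) * eta <= e.
  rewrite (le_trans (ler_wpM2r (ltW eta0) (_ : _ <= C / (t / 2) + 1))) ?lerDl//.
  by rewrite mulrC -ler_pdivlMr ?ltr_wpDl// ge_min lexx orbT.
have [Q [k [Z [Q0 Qr _ d1]]]] := bdint_dense 1 ig eta0 r2.
(* Cubes on which [g] vanishes identically get the value 0, which does not worsen the approximation.
   The remaining cubes have mesh at most r/2 and meet the support, so they keep distance r/2 from
   [S]. *)
pose Z' c := if `[< exists2 y, hbox (c, Q.2 / 2 ^+ k) y & g y != 0 >] then Z c else 0.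
pose f := cstep Q k Z'; have [bf _] := cstep_facts k Z' Q0.
have genE b : b \in gen Q k -> b = (b.1, Q.2 / 2 ^+ k).
  by move=> bk; rewrite -(gen_side bk); case: (b).
have le x : cabs (f x - g x) <= cabs (cstep Q k Z x - g x).
  have [Qx|nQ] := pselect (hbox Q x); last by rewrite /f !cstep_out.
  rewrite /f !cstepE// /Z'; case: asboolP => // ng; rewrite mul0r sub0r cabsN.
  suff -> : g x = 0 by rewrite cabs0 cabs_ge0.
  apply/eqP/negPn/negP => gx; apply: ng; exists x => //.
  by have [b bk bx] := gen_cover k Q0 Qx; rewrite (ctr_gen Q0 bk bx) -(genE _ bk).
have d2 : (L1n setT (fun x => (f x - g x)%R) <= eta%:E)%E.
  have mf := bdint_meas bf; have mc := measurable_cstep Q k Z.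
  apply: le_trans d1; apply: le_integral_EFin => //; try exact: measurable_cabs.
  - by apply: measurable_cabs; exact: cmeasurableB.
  - by apply: measurable_cabs; exact: cmeasurableB.
  - by move=> x _; exact: cabs_ge0.
have Sf : forall b x y, b \in gen Q k -> Z' b.1 != 0 -> S x -> cube b.1 b.2 y -> far (r / 2) x y.
  move=> b x y bk; rewrite /Z'; case: asboolP; rewrite ?eqxx// => -[z bz gz] _ Sx yb.
  have [i xz] := Sg _ _ Sx gz; exists i; have := yb i; have := hbox_cube bz i.
  rewrite (genE _ bk) /= => h1 h2.
  have := ler_normD (x ord0 i - y ord0 i) (y ord0 i - z ord0 i); rewrite addrA subrK.
  have := ler_normB (y ord0 i - b.1 ord0 i) (z ord0 i - b.1 ord0 i).
  rewrite opprB addrA subrK; lra.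
have [_ ff Kf] := loc_cstep cz r2 Q0 Sf.
exists (lvl (t / 2) (fun x => T2 f x - h x)); first split.
- by apply: measurable_lvl; apply: cmeasurableB => //; exact: (T2m cz).
- apply: (le_trans (H _ _ _ bf d2 t2)); rewrite lee_fin; apply: le_trans eta2.
  by rewrite mulrAC.
- apply: filterS Kf => x Kf Sx tx; rewrite /lvl /= Kf//.
  have fg y : f y - g y != 0 -> far (r / 2) x y.
    have [fy|fy] := eqVneq (f y) 0; last by move=> _; exact: ff.
    rewrite fy sub0r oppr_eq0 => gy; have [i xy] := Sg _ _ Sx gy; exists i.
    by apply: le_trans xy; lra.
  have mf := bdint_meas bf.
  have [_ bnd] := Kint cz r2 (cmeasurableB mf mg) d2 fg.
  have gf y : g y != 0 -> far (r / 2) x y.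
    by move=> gy; have [i xy] := Sg _ _ Sx gy; exists i; apply: le_trans xy; lra.
  have ga : (L1n setT g <= (fine (L1n setT g))%:E)%E by rewrite fineK// ge0_fin_numE// L1n_ge0.
  have [i1 _] := Kint cz r2 mf (bdint_L1n bf) (ff x ^~ Sx).
  have [i2 _] := Kint cz r2 mg ga gf.
  move: bnd; rewrite (@eq_cintegral _ _ _ _ (fun y => -1 * (K x y * g y) + K x y * f y)); last first.
    by move=> y _; rewrite mulrBr mulN1r addrC.
  rewrite cintegral_lin// mulN1r; set I1 := cintegral _ _; set I2 := cintegral _ _.
  rewrite mulrA -/C2 => bnd.
  have : cabs (h x - I1) <= cabs (I2 - h x) + cabs (- I1 + I2).
    rewrite (cabsBC I2); apply: le_trans (cabsD _ _).
    by rewrite (_ : h x - I2 + (- I1 + I2) = h x - I1)//; ring.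
  by move: tx; rewrite -/I1; lra.
Qed.

End extension_to_L1.

Arguments ext {R n} T2 C g h.

Lemma geometric_small {R : realType} (a e : R) : 0 < e -> exists N : nat,
  forall k, (N <= k)%N -> a * 2 ^- k < e.
Proof.
move=> e0; exists (Num.truncn (`|a| / e)).+1; set N := _.+1 => k Nk.
have h1 : `|a| / e < N%:R by exact: truncnS_gt.
have h2 : N%:R <= 2 ^+ k :> R by rewrite -natrX ler_nat (leq_trans Nk)// ltnW// ltn_expl.
have h3 : `|a| < 2 ^+ k * e by rewrite -ltr_pdivrMr//; exact: lt_le_trans h1 h2.
by rewrite ltr_pdivrMr ?exprn_gt0// mulrC (le_lt_trans (ler_norm a)).
Qed.

Section geometric_cauchy.
Context {R : realType} (u : R^nat) (k : nat).
Hypothesis uk : forall j, (k <= j)%N -> `|u j.+1 - u j| <= 2 ^- j.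

Lemma geometric_dist j m : (k <= j)%N -> `|u (j + m)%N - u j| <= 2 * 2 ^- j.
Proof.
move=> kj; apply: (@le_trans _ _ (2 * 2 ^- j - 2 * 2 ^- (j + m))); last first.
  by rewrite gerBl mulr_ge0// invr_ge0 exprn_ge0.
elim: m => [|m IH]; first by rewrite addn0 !subrr normr0.
have := uk (leq_trans kj (leq_addr m j)); rewrite addnS exprS invfM.
have := ler_normD (u (j + m).+1 - u (j + m)%N) (u (j + m)%N - u j).
rewrite addrA subrK; move: IH; set X := 2 ^- (j + m); lra.
Qed.

Lemma geometric_cvg : cvgn u.
Proof.
apply: R_complete; apply: cauchy_exP => e e0.
have [N HN] := @geometric_small R 2 e e0; exists (u (maxn N k)).
exists (maxn N k) => // i /= ki; rewrite /ball /= distrC.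
rewrite -(subnKC ki); apply: (le_lt_trans (geometric_dist _ (leq_maxr _ _))).
by apply: HN; exact: leq_maxl.
Qed.

Lemma geometric_lim j : (k <= j)%N -> `|limn u - u j| <= 2 * 2 ^- j.
Proof.
move=> kj; have cu := geometric_cvg.
have H i : (j <= i)%N -> `|u i - u j| <= 2 * 2 ^- j.
  by move=> ji; rewrite -(subnKC ji); exact: geometric_dist.
rewrite ler_norml; apply/andP; split.
  rewrite lerBrDr; apply: limr_ge => //; exists j => // i /= ji.
  by have := H i ji; rewrite ler_norml => /andP[? _]; lra.
rewrite lerBlDr; apply: limr_le => //; exists j => // i /= ji.
by have := H i ji; rewrite ler_norml => /andP[_ ?]; lra.
Qed.

End geometric_cauchy.

Section extension_existence.
Context {R : realType} {n : nat}.
Local Notation Rn := 'rV[R]_n.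
Local Notation mu := (lebesgue_rV R n).
Implicit Types (f g h : Rn -> R[i]) (x y c : Rn) (S : set Rn) (b Q : box R n) (r s t : R).

Context {A CK Sth : R} {theta : R -> R} {T2 : (Rn -> R[i]) -> Rn -> R[i]}
  {K : Rn -> Rn -> R[i]}.
Hypothesis cz : cz_operator A CK Sth theta T2 K.

Local Notation C1 := (@C11 R n A CK Sth).

(** Approximants at distance 4^-k make the set where consecutive images differ by more than 2^-k of
    measure O(2^-k). By Borel-Cantelli the images converge geometrically off [U k], whose measure
    tends to 0. *)
Lemma ext_exists g : cint g -> exists h, ext T2 (2 * C1) g h.
Proof.
move=> ig; have [mg gi] := ig; have C10 := C11_ge0 cz.
have q0 k : 0 < 4 ^- k :> R by rewrite invr_gt0 exprn_gt0.
have [F HF] := choice (fun k => test_dense ig (q0 k)).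
have bF k : bdint (F k) by apply: test_fun_bdint; have [] := HF k.
have dF k : (L1n setT (fun x => (F k x - g x)%R) <= (4 ^- k)%:E)%E by have [] := HF k.
pose w k := T2 (F k); have mw k : cmeasurable setT (w k) by exact: (T2m cz).
pose D k := lvl (2 ^- k) (fun x => w k.+1 x - w k x).
have mD k : measurable (D k) by apply: measurable_lvl; exact: cmeasurableB.
have e40 k : 4 ^+ k = 2 ^+ k * 2 ^+ k :> R by rewrite -exprMn; congr (_ ^+ _); ring.
have muD k : (mu (D k) <= (2 * C1 * 2 ^- k)%:E)%E.
  have p0 : 0 < 2 ^- k :> R by rewrite invr_gt0 exprn_gt0.
  have dk : (L1n setT (fun x => (F k.+1 x - F k x)%R) <= (4 ^- k + 4 ^- k)%:E)%E.
    apply: (le_trans (L1n_tri (bdint_meas (bF k.+1)) mg (bdint_meas (bF k)))).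
    rewrite EFinD; apply: leeD; last by rewrite L1nC.
    apply: (le_trans (dF _)); rewrite lee_fin lef_pV2 ?posrE ?exprn_gt0//.
    by apply: ler_weXn2l => //; rewrite ler1n.
  apply: (le_trans (T2B_weak cz (bF k.+1) (bF k) dk p0)).
  rewrite lee_fin le_eqVlt; apply/orP; left; apply/eqP.
  by rewrite e40; field; rewrite expf_neq0.
pose U k := \bigcup_j D (k + j)%N.
have mU k : measurable (U k) by exact: bigcup_measurable.
have muU k : (mu (U k) <= (4 * C1 * 2 ^- k)%:E)%E.
  apply: (@le_trans _ _ (\sum_(j <oo) mu (D (k + j)%N))%E).
    by apply: measure_sigma_subadditive.
  apply: (@le_trans _ _ (\sum_(j <oo) (2 * C1 * 2 ^- (k + j))%:E)%E).
    by apply: lee_nneseries => [j _ _|j _]; [exact: measure_ge0|exact: muD].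
  apply: nneseries_bound => [j|N].
    apply: mulr_ge0; [exact: mulr_ge0|by rewrite invr_ge0 exprn_ge0].
  apply: (@le_trans _ _ (4 * C1 * 2 ^- k - 4 * C1 * 2 ^- (k + N))); last first.
    by rewrite gerBl; apply: mulr_ge0; [exact: mulr_ge0|by rewrite invr_ge0 exprn_ge0].
  elim: N => [|N IH]; first by rewrite big_ord0 addn0 subrr.
  rewrite big_ord_recr /= addnS exprS invfM; move: IH; set X := 2 ^- (k + N).
  have -> : 4 * C1 * (2^-1 * X) = 2 * C1 * X by field.
  have -> : 4 * C1 * X = 2 * C1 * X + 2 * C1 * X by ring.
  by lra.
have wU k x : ~ U k x -> forall j, (k <= j)%N -> cabs (w j.+1 x - w j x) <= 2 ^- j.
  move=> nU j kj; rewrite leNgt; apply/negP => lt; apply: nU.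
  by exists (j - k)%N => //; rewrite subnKC.
pose G := \bigcup_k ~` U k; have mG : measurable G by apply: bigcup_measurable => k _; exact: measurableC.
(* Multiplying by the indicator of the set of good points makes the sequences converge everywhere,
   so the limit is measurable on the whole space. *)
pose vr j x := complex.Re (w j x) * \1_G x; pose vi j x := complex.Im (w j x) * \1_G x.
have mvr j : measurable_fun setT (vr j).
  by have [? _] := mw j; apply: measurable_funM => //; exact: measurable_indic.
have mvi j : measurable_fun setT (vi j).
  by have [_ ?] := mw j; apply: measurable_funM => //; exact: measurable_indic.
have part (p : R[i] -> R) k x : (forall z, `|p z| <= cabs z) -> {morph p : z z' / z - z'} ->
    ~ U k x -> forall j, (k <= j)%N -> `|p (w j.+1 x) * \1_G x - p (w j x) * \1_G x| <= 2 ^- j.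
  move=> pc pB nU j kj; have Gx : G x by exists k.
  by rewrite indicE mem_set// !mulr1 -pB (le_trans (pc _))//; exact: wU nU _ kj.
have reB : {morph (@complex.Re R) : z z' / z - z'} by case=> ? ? [? ?].
have imB : {morph (@complex.Im R) : z z' / z - z'} by case=> ? ? [? ?].
have cv (p : R[i] -> R) x : (forall z, `|p z| <= cabs z) -> {morph p : z z' / z - z'} ->
    cvgn (fun j => p (w j x) * \1_G x).
  move=> pc pB; have [[k _ nU]|nG] := pselect (G x).
    exact: geometric_cvg (part p k x pc pB nU).
  by rewrite indicE memNset// (_ : (fun _ => _) = cst 0); [exact: is_cvg_cst|apply/funext => j; rewrite mulr0].
pose hr x := limn (vr ^~ x); pose hi x := limn (vi ^~ x).
pose h x := Complex (hr x) (hi x).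
have mh : cmeasurable setT h.
  split => /=.
    by apply: (@measurable_fun_cvg _ _ R setT vr) => // x _; apply: cv => //; exact: Re_le_cabs.
  by apply: (@measurable_fun_cvg _ _ R setT vi) => // x _; apply: cv => //; exact: Im_le_cabs.
have hw k x : ~ U k x -> cabs (w k x - h x) <= 4 * 2 ^- k.
  move=> nU; have Gx : G x by exists k.
  have E : \1_G x = 1 :> R by rewrite indicE mem_set.
  have Hr : `|hr x - complex.Re (w k x)| <= 2 * 2 ^- k.
    have -> : complex.Re (w k x) = complex.Re (w k x) * \1_G x by rewrite E mulr1.
    exact: (@geometric_lim R (vr ^~ x) k (part _ k x (@Re_le_cabs R) reB nU) k (leqnn k)).
  have Hi : `|hi x - complex.Im (w k x)| <= 2 * 2 ^- k.
    have -> : complex.Im (w k x) = complex.Im (w k x) * \1_G x by rewrite E mulr1.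
    exact: (@geometric_lim R (vi ^~ x) k (part _ k x (@Im_le_cabs R) imB nU) k (leqnn k)).
  rewrite cabsBC; apply: (le_trans (cabs_le_ReIm _)); rewrite reB imB.
  by apply: (le_trans (lerD Hr Hi)); rewrite le_eqVlt; apply/orP; left; apply/eqP; ring.
exists h; split=> // f a s bf fa s0; have mf := bdint_meas bf.
have s2 : 0 < s / 2 by lra.
apply: (@lee_addgt0_lin _ _ _ 1) => // e e0 _.
have [N1 HN1] := @geometric_small R 4 _ s2.
have [N2 HN2] := @geometric_small R (4 * C1 + 2 * C1 / s) _ e0.
pose k := maxn N1 N2.
have dk : (L1n setT (fun x => (f x - F k x)%R) <= (a + 4 ^- k)%:E)%E.
  apply: (le_trans (L1n_tri mf mg (bdint_meas (bF k)))).
  by rewrite EFinD leeD// L1nC.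
have h1 := T2B_weak cz bf (bF k) dk s2.
have h2 : (mu (lvl (s / 2) (fun x => (w k x - h x)%R)) <= (4 * C1 * 2 ^- k)%:E)%E.
  apply: le_trans (muU k); apply: le_measure; rewrite ?inE//.
    by apply: measurable_lvl; exact: cmeasurableB.
  move=> x lx; apply: contrapT => nU; have := hw k x nU.
  have := HN1 k (leq_maxl _ _); move: lx; rewrite /lvl /=; lra.
rewrite [s in lvl s _](splitr s).
apply: (le_trans (@lvl_tri _ _ _ mu (s / 2) (s / 2) _ (fun x => T2 f x - T2 (F k) x)
  (fun x => w k x - h x) _ _ _ _)).
- by apply: cmeasurableB => //; exact: (T2m cz).
- by apply: cmeasurableB; exact: (T2m cz).
- exact: cmeasurableB.
- by apply: aeW => x; rewrite addrA subrK.
apply: (le_trans (leeD h1 h2)); rewrite -EFinD lee_fin mul1r.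
have -> : C1 * (a + 4 ^- k) / (s / 2) = 2 * C1 * a / s + 2 * C1 / s * 4 ^- k.
  have s0n : s != 0 by rewrite gt_eqF.
  have k0n : 4 ^+ k != 0 :> R by rewrite expf_neq0.
  by field; rewrite ?s0n ?k0n.
rewrite -addrA lerD2l; apply: le_trans (ltW (HN2 k (leq_maxr _ _))).
rewrite [leRHS]mulrDl [leRHS]addrC; apply: lerD => //.
apply: ler_wpM2l; first by apply: divr_ge0; [exact: mulr_ge0|exact: ltW].
rewrite lef_pV2 ?posrE ?exprn_gt0// lerXn2r ?nnegrE//.
by rewrite ler_nat.
Qed.

End extension_existence.

(** * Weights *)

Section weighted_measure.
Context {R : realType} {n : nat}.
Local Notation Rn := 'rV[R]_n.
Local Notation mu := (lebesgue_rV R n).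
Context (u : Rn -> R).
Hypothesis mu_ : measurable_fun setT u.

(* Weights are positive only almost everywhere; replacing [u] by its positive
   part yields a measure. *)
Definition pospart : Rn -> R := fun x => Num.max (u x) 0.

Lemma measurable_pospart : measurable_fun setT pospart.
Proof. by apply: measurable_maxr. Qed.

Lemma pospart_ge0 x : 0 <= pospart x.
Proof. by rewrite /pospart le_max lexx orbT. Qed.

End weighted_measure.

Section density_measure.
Context {R : realType} {n : nat}.
Local Notation Rn := 'rV[R]_n.
Local Notation mu := (lebesgue_rV R n).
Context (u : Rn -> R) (mu_ : measurable_fun setT u).

(** The proof of measurability is an argument because the measure instance depends on it. *)
Definition dens of measurable_fun setT u : set Rn -> \bar R := fun D =>
  (\int[mu]_(x in D) (pospart u x)%:E)%E.

Let dens0 : dens mu_ set0 = 0%E.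
Proof. exact: integral_set0. Qed.

Let dens_ge0 D : (0 <= dens mu_ D)%E.
Proof. by apply: integral_ge0 => x _; rewrite lee_fin pospart_ge0. Qed.

Let dens_sigma_additive : semi_sigma_additive (dens mu_).
Proof.
move=> F mF tF mUF; rewrite /dens ge0_integral_bigcup//.
- by apply: is_cvg_ereal_nneg_natsum => k _; exact: dens_ge0.
- by apply/measurable_EFinP; apply: measurable_funTS; exact: measurable_pospart.
- by move=> x _; rewrite lee_fin pospart_ge0.
Qed.

HB.instance Definition _ := isMeasure.Build _ _ _ (dens mu_)
  dens0 dens_ge0 dens_sigma_additive.

End density_measure.

Section hoelder_weights.
Context {R : realType} {n : nat}.
Local Notation Rn := 'rV[R]_n.
Local Notation mu := (lebesgue_rV R n).
Implicit Types (u v : Rn -> R) (B : set Rn).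

Lemma conj_exponent_facts (p : R) : 1 < p ->
  let p' := conj_exponent p in [/\ 0 < p', p^-1 + p'^-1 = 1, p' / p * p'^-1 = p^-1 & 0 < p^-1].
Proof.
move=> p1; have p0 : 0 < p by rewrite (lt_trans ltr01).
have ip : 0 < p^-1 by rewrite invr_gt0.
have p1i : 0 < 1 - p^-1 by rewrite subr_gt0 invf_lt1.
split=> //; rewrite /conj_exponent; first by rewrite invr_gt0.
  by rewrite invrK addrC subrK.
by rewrite mulrAC divff ?mul1r// gt_eqF// invr_gt0.
Qed.

(* Hoelder's inequality for [g v^(1/p)] and [v^(-1/p)]. With [v = 1] this is
   Jensen's inequality. *)
Lemma hoelder_weight (p : R) v B (m U C : R) (g : Rn -> R) (Gp : R) :
  1 < p -> measurable_fun setT v -> {ae mu, forall x, 0 < v x} ->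
  measurable B -> 0 < m -> 0 < U -> 0 <= C ->
  ((U / m)%:E `^ p^-1 * ((m^-1)%:E * \int[mu]_(x in B)
     (v x `^ (- (conj_exponent p / p)))%:E) `^ (conj_exponent p)^-1 <= C%:E)%E ->
  measurable_fun setT g -> (forall x, 0 <= g x) ->
  (\int[mu]_(x in B) (g x `^ p * pospart v x)%:E <= Gp%:E)%E ->
  (\int[mu]_(x in B) (g x)%:E <= (C * m * (Gp / U) `^ p^-1)%:E)%E.
Proof.
move=> p1 mv v0 mB m0 U0 C0 H mg g0 Hg.
have [p'0 pp' pE ip0] := conj_exponent_facts p1; set p' := conj_exponent p in H p'0 pp' pE *.
have p'i : p'^-1 != 0 by rewrite invr_eq0 gt_eqF.
have p0 : 0 < p by rewrite (lt_trans ltr01).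
have Um : 0 < (U / m) `^ p^-1 by rewrite powR_gt0// divr_gt0.
set W := (\int[mu]_(x in B) (v x `^ (- (p' / p)))%:E)%E in H.
have W0 : (0 <= W)%E by apply: integral_ge0 => x _; rewrite lee_fin powR_ge0.
(* If the integral of v^(-p'/p) were infinite, so would be the left side of the hypothesis, since
   its first factor is positive. *)
have [w w0 WE] : exists2 w, 0 <= w & W = w%:E.
  case: W W0 H => [w| |] // w0; first by exists w.
  rewrite gt0_muley ?lte_fin ?invr_gt0// poweRyr ?p'i//.
  by rewrite gt0_muley ?lte_fin// leye_eq.
have Gp0 : 0 <= Gp.
  rewrite -lee_fin; apply: le_trans Hg; apply: integral_ge0 => x _.
  by rewrite lee_fin mulr_ge0 ?powR_ge0 ?pospart_ge0.
pose f1 x := g x * pospart v x `^ p^-1 * \1_B x.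
pose f2 x := v x `^ (- p^-1) * \1_B x.
have mpv := measurable_pospart mv.
have mf1 : measurable_fun setT f1.
  apply: measurable_funM; last exact: measurable_indic.
  by apply: measurable_funM => //; apply: (measurableT_comp (@measurable_powR R p^-1)).
have mf2 : measurable_fun setT f2.
  apply: measurable_funM; last exact: measurable_indic.
  by apply: (measurableT_comp (@measurable_powR R (- p^-1))).
have := hoelder mu mf1 mf2 p0 p'0 pp'.
rewrite Lnorm1 unlock /=.
have -> : (\int[mu]_x `|((f1 x * f2 x)%R)%:E| = \int[mu]_(x in B) (g x)%:E)%E.
  rewrite [RHS]integral_mkcond; apply: ae_eq_integral => //.
  - apply/measurableT_comp => //; apply/measurable_EFinP; exact: measurable_funM.
  - by apply/(measurable_restrictT _ mB); apply/measurable_EFinP; exact: measurable_funTS.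
  - apply: filterS v0 => x v0 _; rewrite patchE /f1 /f2 indicE.
    case: (x \in B) => /=; last by rewrite !mulr0 normr0.
    rewrite !mulr1 /pospart max_l ?ltW// -mulrA -powRD; last by apply/implyP => _; rewrite gt_eqF.
    by rewrite subrr powRr0 mulr1 ger0_norm.
move=> Hh; apply: (le_trans Hh).
have -> : (\int[mu]_x (`|f1 x| `^ p)%:E = \int[mu]_(x in B) (g x `^ p * pospart v x)%:E)%E.
  rewrite [RHS]integral_mkcond; apply: eq_integral => x _; rewrite patchE /f1 indicE.
  case: (x \in B) => /=; last by rewrite mulr0 normr0 powR0// gt_eqF.
  rewrite mulr1 ger0_norm ?mulr_ge0 ?powR_ge0// powRM ?powR_ge0// -powRrM mulVf ?gt_eqF//.
  by rewrite powRr1 ?pospart_ge0.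
have -> : (\int[mu]_x (`|f2 x| `^ p')%:E = w%:E)%E.
  rewrite -WE /W [RHS]integral_mkcond; apply: eq_integral => x _; rewrite patchE /f2 indicE.
  case: (x \in B) => /=; last by rewrite mulr0 normr0 powR0// gt_eqF.
  rewrite mulr1 ger0_norm ?powR_ge0// -powRrM; congr (_ `^ _)%:E.
  by rewrite mulNr mulrC.
rewrite poweR_EFin.
have H1 : ((\int[mu]_(x in B) (g x `^ p * pospart v x)%:E) `^ p^-1 <= (Gp `^ p^-1)%:E)%E.
  rewrite -poweR_EFin; apply: gt0_ler_poweR => //; first exact: ltW.
    rewrite in_itv/= leey andbT; apply: integral_ge0 => x _.
    by rewrite lee_fin mulr_ge0 ?powR_ge0 ?pospart_ge0.
  by rewrite in_itv/= leey andbT lee_fin.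
apply: (@le_trans _ _ ((Gp `^ p^-1)%:E * (w `^ p'^-1)%:E)%E).
  by apply: lee_wpmul2r => //; rewrite lee_fin powR_ge0.
rewrite -EFinM lee_fin.
have H2 : (U / m) `^ p^-1 * (w / m) `^ p'^-1 <= C.
  by move: H; rewrite WE -EFinM lee_fin [m^-1 * w]mulrC.
have m1 : m = m `^ p^-1 * m `^ p'^-1.
  rewrite -powRD ?pp' ?powRr1 ?(ltW m0)//.
  by apply/implyP => _; rewrite gt_eqF.
have mp0 : 0 < m `^ p^-1 by rewrite powR_gt0.
have mp'0 : 0 < m `^ p'^-1 by rewrite powR_gt0.
have Up0 : 0 < U `^ p^-1 by rewrite powR_gt0.
move: H2; rewrite !powRM ?invr_ge0 ?(ltW m0) ?(ltW U0)// => H2.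
have -> : (U^-1) `^ p^-1 = (U `^ p^-1)^-1.
  by rewrite -(powR_inv1 (ltW U0)) -powRrM mulrC powRrM powR_inv1 ?powR_ge0.
have inv (z : R) : (m^-1) `^ z = (m `^ z)^-1.
  by rewrite -(powR_inv1 (ltW m0)) -powRrM mulrC powRrM powR_inv1 ?powR_ge0.
rewrite !inv in H2.
have H3 : U `^ p^-1 * w `^ p'^-1 <= C * m.
  rewrite [in leRHS]m1 -ler_pdivrMr ?mulr_gt0//; apply: le_trans H2.
  by rewrite le_eqVlt; apply/orP; left; apply/eqP; field; rewrite !gt_eqF.
rewrite [leRHS](_ : _ = Gp `^ p^-1 * (C * m / U `^ p^-1)); last by field; rewrite gt_eqF.
by rewrite ler_wpM2l ?powR_ge0// ler_pdivlMr// mulrC.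
Qed.

End hoelder_weights.

Section weight_facts.
Context {R : realType} {n : nat}.
Local Notation Rn := 'rV[R]_n.
Local Notation mu := (lebesgue_rV R n).
Implicit Types (u v : Rn -> R) (D E B : set Rn) (c x : Rn) (l : R).

Lemma integral_pos (f : Rn -> R) D : measurable_fun setT f -> (forall x, 0 <= f x) ->
  {ae mu, forall x, 0 < f x} -> measurable D -> (0 < mu D)%E ->
  (0 < \int[mu]_(x in D) (f x)%:E)%E.
Proof.
move=> mf f0 fpos mD D0; rewrite lt_neqAle integral_ge0 ?andbT; last first.
  by move=> x _; rewrite lee_fin.
apply/eqP => /esym I0.
have mfD : measurable_fun D (EFin \o f) by apply/measurable_EFinP; exact: measurable_funTS.
have E0 : ae_eq mu D (EFin \o f) (cst 0%E).
  apply/(ae_eq_integral_abs mu mD mfD).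
  by rewrite -I0; apply: eq_integral => x _ /=; rewrite ger0_norm.
have : mu.-negligible D.
  have : {ae mu, forall x, ~ D x}.
    by apply: filterS2 fpos E0 => x fx Ex Dx; have [fx0] := Ex Dx; move: fx; rewrite fx0 ltxx.
  by apply: negligibleS => x Dx /=; apply: contrapT => /contrapT; apply.
by move=> /(negligibleP mu mD) D00; move: D0; rewrite [X in (_ < X)%E]D00 ltxx.
Qed.

Lemma wmeasE u (mu_ : measurable_fun setT u) D : {ae mu, forall x, 0 < u x} ->
  measurable D -> (\int[mu]_(x in D) (u x)%:E)%E = dens mu_ D.
Proof.
move=> u0 mD; apply: ae_eq_integral => //.
- by apply/measurable_EFinP; exact: measurable_funTS.
- by apply/measurable_EFinP/measurable_funTS; exact: measurable_pospart.
- by apply: filterS u0 => x u0 _; rewrite /pospart max_l ?ltW.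
Qed.

Lemma dens_gt0 u (mu_ : measurable_fun setT u) D : {ae mu, forall x, 0 < u x} ->
  measurable D -> (0 < mu D)%E -> (0 < dens mu_ D)%E.
Proof.
move=> u0 mD D0; apply: integral_pos => //; first exact: measurable_pospart.
  by move=> x; exact: pospart_ge0.
by apply: filterS u0 => x u0; rewrite /pospart lt_max u0.
Qed.

Lemma cube_fin u (mu_ : measurable_fun setT u) c l : weight u -> (dens mu_ (cube c l) < +oo)%E.
Proof.
move=> [_ uint u0]; have /integrableP[_] := uint _ (@compact_cube R n c l).
rewrite -wmeasE//; last exact: measurable_cube.
apply: le_lt_trans; apply: le_trans (lee_abs _) _.
apply: le_trans (le_abse_integral _ _ _) _; first exact: measurable_cube.
  by apply/measurable_EFinP/measurable_funTS.
by apply: le_refl.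
Qed.

Lemma dens_cube u (mu_ : measurable_fun setT u) c l : weight u -> 0 < l ->
  [/\ 0 < fine (dens mu_ (cube c l)) & dens mu_ (cube c l) = (fine (dens mu_ (cube c l)))%:E].
Proof.
move=> wu l0; have [_ _ u0] := wu; have lt := cube_fin mu_ c l wu.
have gt : (0 < dens mu_ (cube c l))%E.
  apply: dens_gt0 => //; first exact: measurable_cube.
  suff : (mu (cube c l) = (l ^+ n)%:E)%E by move=> ->; rewrite lte_fin exprn_gt0.
  by apply: mu_cube; exact: ltW.
by split; [rewrite fine_gt0// gt lt|rewrite fineK// ge0_fin_numE// ltW].
Qed.

Lemma measurable_eball c l : measurable (eball c l).
Proof.
rewrite (_ : eball c l = (fun x => enorm (x - c)) @^-1` `]-oo, l[%classic); last first.
  by apply/seteqP; split => x /=; rewrite in_itv.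
suff m : measurable_fun setT (fun x => enorm (x - c)).
  by rewrite -[X in measurable X]setTI; exact: m.
rewrite /enorm; apply: (@measurableT_comp _ _ _ _ _ _ (@Num.sqrt R)
  _ (fun x : Rn => \sum_(i < n) (x - c) ord0 i ^+ 2)).
  by apply: continuous_measurable_fun; exact: sqrt_continuous.
apply: measurable_sum => i; apply: measurable_funX.
rewrite (_ : (fun _ => _) = fun x : Rn => x ord0 i - c ord0 i).
  by apply: measurable_funB => //; exact: measurable_coord.
by apply/funext => x; rewrite !mxE.
Qed.

Lemma eball_cube c l : eball c l `<=` cube c (2 * l).
Proof.
move=> x cx i; have := coord_le_enorm (x - c) i; rewrite !mxE => /le_trans; apply.
by move: cx; rewrite /eball /= => /ltW; lra.
Qed.

Lemma cube_eball c l : (0 < n)%N -> 0 < l -> cube c l `<=` eball c (n%:R * l).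
Proof.
move=> n0 l0 x cx; rewrite /eball /=.
have : enorm (x - c) <= n%:R * (l / 2).
  by apply: enorm_le => [|i]; [rewrite divr_ge0// ltW|rewrite !mxE; exact: cx].
move/le_lt_trans; apply; rewrite ltr_pM2l ?ltr0n//; lra.
Qed.


(** The A_q conditions concern balls, the proof works with cubes. The ball of radius n l contains
    the cube of side l and lies in the one of side 2 n l, so the volumes are comparable. *)
Lemma eball_facts u (mu_ : measurable_fun setT u) c l : (0 < n)%N -> weight u -> 0 < l ->
  let B := eball c (n%:R * l) in exists m U : R, [/\ 0 < m, m <= (2 * n%:R) ^+ n * l ^+ n,
    0 < U, mu B = m%:E & dens mu_ B = U%:E].
Proof.
move=> n0 wu l0 B; have nR : 0 < n%:R :> R by rewrite ltr0n.
have [_ _ u0] := wu; have mB : measurable B by exact: measurable_eball.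
have lB : cube c l `<=` B by exact: cube_eball.
have nl0 : 0 < 2 * (n%:R * l) by rewrite !mulr_gt0.
have Bl : B `<=` cube c (2 * (n%:R * l)) by exact: eball_cube.
have mC := measurable_cube c l; have mC' := measurable_cube c (2 * (n%:R * l)).
have B1 : ((l ^+ n)%:E <= mu B)%E.
  have <- : mu (cube c l) = (l ^+ n)%:E by apply: mu_cube; exact: ltW.
  by apply: le_measure; rewrite ?inE.
have B2 : (mu B <= ((2 * n%:R) ^+ n * l ^+ n)%:E)%E.
  have <- : mu (cube c (2 * (n%:R * l))) = ((2 * n%:R) ^+ n * l ^+ n)%:E.
    by rewrite -exprMn -mulrA; apply: mu_cube; exact: ltW.
  by apply: le_measure; rewrite ?inE.
have Bf : mu B = (fine (mu B))%:E.
  by rewrite fineK// ge0_fin_numE ?measure_ge0// (le_lt_trans B2) ?ltry.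
have D1 : (dens mu_ B < +oo)%E.
  apply: le_lt_trans (cube_fin mu_ c (2 * (n%:R * l)) wu).
  by apply: le_measure; rewrite ?inE.
have D0 : (0 < dens mu_ B)%E.
  by apply: dens_gt0 => //; apply: lt_le_trans B1; rewrite lte_fin exprn_gt0.
exists (fine (mu B)), (fine (dens mu_ B)); split => //.
- by rewrite -lte_fin -Bf; apply: lt_le_trans B1; rewrite lte_fin exprn_gt0.
- by rewrite -lee_fin -Bf.
- by rewrite fine_gt0// D0.
- by rewrite fineK// ge0_fin_numE// ltW.
Qed.

(** For A_1, the essential infimum over the ball is at most u(E)/|E|. For A_q, the weighted Hölder
    inequality applied to the indicator of [E] gives |E|/|B| <= C (u(E)/u(B))^(1/q). Both are then
    combined with |E| >= (a/M) |B|. *)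
Lemma Ainfty_proportion u (mu_ : measurable_fun setT u) (a : R) : (0 < n)%N -> weight u ->
  A_infty u -> 0 < a -> exists2 C : R, 0 < C & forall c l E, 0 < l -> measurable E ->
    E `<=` cube c l -> ((a * l ^+ n)%:E <= mu E)%E ->
    (dens mu_ (cube c l) <= C%:E * dens mu_ E)%E.
Proof.
move=> n0 wu Au a0; have [mu' _ u0] := wu; pose M : R := (2 * n%:R) ^+ n.
have M0 : 0 < M by rewrite exprn_gt0// mulr_gt0// ltr0n.
suff [C C0 H] : exists2 C : R, 0 < C & forall c l E (m U e d : R), 0 < l -> measurable E ->
    E `<=` eball c (n%:R * l) -> 0 < m -> 0 < U -> mu (eball c (n%:R * l)) = m%:E ->
    dens mu_ (eball c (n%:R * l)) = U%:E -> mu E = e%:E -> dens mu_ E = d%:E ->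
    0 < d -> 0 < e -> a * m <= M * e -> U <= C * d.
  exists C => // c l E l0 mE El aE; have [m [U [m0 mM U0 mB dB]]] := eball_facts mu_ c n0 wu l0.
  have lB := subset_trans El (cube_eball n0 l0).
  have [mC mB'] := (measurable_cube c l, measurable_eball c (n%:R * l)).
  have E0 : (0 < mu E)%E by apply: lt_le_trans aE; rewrite lte_fin mulr_gt0// exprn_gt0.
  have Ef : mu E = (fine (mu E))%:E.
    rewrite fineK// ge0_fin_numE ?measure_ge0//; apply: le_lt_trans (ltry m).
    by rewrite -mB; apply: le_measure; rewrite ?inE.
  have D0 : (0 < dens mu_ E)%E by exact: dens_gt0.
  have Df : dens mu_ E = (fine (dens mu_ E))%:E.
    rewrite fineK// ge0_fin_numE ?measure_ge0//; apply: le_lt_trans (ltry U).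
    by rewrite -dB; apply: le_measure; rewrite ?inE.
  rewrite Df -EFinM; apply: (@le_trans _ _ U%:E).
    by rewrite -dB; apply: le_measure; rewrite ?inE//; exact: cube_eball.
  rewrite lee_fin; apply: (H c l E m U (fine (mu E)) (fine (dens mu_ E))) => //.
  - by rewrite -lte_fin -Df.
  - by rewrite -lte_fin -Ef.
  - have h : a * l ^+ n <= fine (mu E) by rewrite -lee_fin -Ef.
    rewrite -(ler_pM2l a0) in mM; apply: (le_trans mM).
    by rewrite mulrCA; apply: ler_wpM2l => //; exact: ltW.
case: Au => [[C1 A1]|[q q1 [Cq Cq0 Aq]]].
- have c0 : 0 < Num.max C1 1 by rewrite lt_max ltr01 orbT.
  (* The A_1 constant is not assumed positive. *)
  exists (Num.max C1 1 * (M / a)); first by rewrite mulr_gt0// divr_gt0.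
  move=> c l E m U e d l0 mE EB m0 U0 mB dB Ee Ed d0 e0 am.
  have r0 : 0 < n%:R * l by rewrite mulr_gt0// ltr0n.
  have := A1 c _ r0; rewrite /average mB /= (wmeasE mu_ u0); last exact: measurable_eball.
  rewrite dB -EFinM => A1'.
  have essE : (ess_inf_on (eball c (n%:R * l)) u <= (d / e)%:E)%E.
    apply: ub_ereal_sup => y yu; rewrite EFinM lee_pdivlMr//.
    have [y0|y0] := leP y 0%E.
      apply: (@le_trans _ _ 0%E); last by rewrite lee_fin ltW.
      by rewrite mule_le0_ge0// lee_fin ltW.
    rewrite -Ee -Ed -(integral_cst mu mE y) /dens; apply: ae_ge0_le_integral => //.
    + by move=> x _; exact: ltW.
    + by move=> x _; rewrite lee_fin pospart_ge0.
    + by apply/measurable_EFinP/measurable_funTS; exact: measurable_pospart.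
    + apply: filterS yu => x yx Ex; apply: (le_trans (yx (EB _ Ex))).
      by rewrite lee_fin /pospart le_max lexx.
  have : (((m^-1 * U)%R)%:E <= (Num.max C1 1 * (d / e))%:E)%E.
    apply: (le_trans A1'); rewrite EFinM.
    apply: (@le_trans _ _ ((Num.max C1 1)%:E * ess_inf_on (eball c (n%:R * l)) u)%E).
      apply: lee_wpmul2r; last by rewrite lee_fin le_max lexx.
      by apply: ereal_sup_ubound => /=; apply: filterS u0 => x u0 _; rewrite lee_fin ltW.
    by apply: lee_wpmul2l => //; rewrite lee_fin ltW.
  rewrite lee_fin => h.
  have h2 : U <= m * (Num.max C1 1 * (d / e)) by rewrite -ler_pdivrMl.
  apply: (le_trans h2); rewrite -subr_ge0.
  have -> : Num.max C1 1 * (M / a) * d - m * (Num.max C1 1 * (d / e)) =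
     Num.max C1 1 * d / (a * e) * (M * e - a * m) by field; rewrite !gt_eqF.
  by rewrite mulr_ge0 ?subr_ge0// divr_ge0 ?mulr_ge0// ltW.
- exists ((Cq * (M / a)) `^ q); first by apply: powR_gt0; rewrite mulr_gt0// divr_gt0.
  move=> c l E m U e d l0 mE EB m0 U0 mB dB Ee Ed d0 e0 am.
  have r0 : 0 < n%:R * l by rewrite mulr_gt0// ltr0n.
  have mBe : measurable (eball c (n%:R * l)) by exact: measurable_eball.
  have := Aq c _ r0; rewrite /average mB /= (wmeasE mu_ u0)// dB -EFinM [m^-1 * U]mulrC => Aq'.
  have q0 : 0 < q by rewrite (lt_trans ltr01).
  have h1 : (\int[mu]_(x in eball c (n%:R * l)) ((\1_E x : R) `^ q * pospart u x)%:E <= d%:E)%E.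
    rewrite -Ed /dens [leRHS]integral_mkcond [leLHS]integral_mkcond.
    rewrite le_eqVlt; apply/orP; left; apply/eqP; apply: eq_integral => x _.
    rewrite !patchE indicE; have [xE|xE] := boolP (x \in E).
      by rewrite mem_set ?powR1 ?mul1r//; apply: EB; rewrite inE in xE.
    by case: ifP => // _; rewrite powR0 ?gt_eqF// mul0r.
  have m1 : measurable_fun setT (\1_E : Rn -> R) by exact: measurable_indic.
  have := hoelder_weight q1 mu_ u0 mBe m0 U0 (ltW Cq0) Aq' m1
    (fun x => ler0n _ _) h1.
  have -> : (\int[mu]_(x in eball c (n%:R * l)) ((\1_E : Rn -> R) x)%:E = e%:E)%E.
    by rewrite integral_indic// -Ee; congr (mu _); exact: setIidl.
  rewrite lee_fin => e1.
  have h2 : a / M <= Cq * (d / U) `^ q^-1.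
    rewrite ler_pdivrMr// -(ler_pM2r m0); apply: (le_trans am).
    have -> : Cq * (d / U) `^ q^-1 * M * m = M * (Cq * m * (d / U) `^ q^-1) by ring.
    by apply: ler_wpM2l => //; exact: ltW.
  have {h2} : a / M / Cq <= (d / U) `^ q^-1 by rewrite ler_pdivrMr// [leRHS]mulrC.
  have z0 : 0 <= a / M / Cq by rewrite !divr_ge0// ltW.
  move=> /(ge0_ler_powR (ltW q0)) -/(_ z0 (powR_ge0 _ _)).
  rewrite -powRrM mulVf ?gt_eqF// powRr1 ?divr_ge0 ?(ltW d0) ?(ltW U0)// ler_pdivlMr// => h3.
  have z1 : 0 < Cq * (M / a) by rewrite mulr_gt0// divr_gt0.
  have P : (Cq * (M / a)) `^ q * (a / M / Cq) `^ q = 1.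
    rewrite -powRM ?(ltW z1)//.
    have -> : Cq * (M / a) * (a / M / Cq) = 1 by field; rewrite !gt_eqF.
    by rewrite powR1.
  have P0 : 0 < (Cq * (M / a)) `^ q by exact: powR_gt0.
  apply: (@le_trans _ _ ((Cq * (M / a)) `^ q * ((a / M / Cq) `^ q * U))).
    by rewrite mulrA P mul1r.
  by apply: ler_wpM2l => //; exact: ltW.
Qed.

Definition wcube u (mu_ : measurable_fun setT u) c l : R := fine (dens mu_ (cube c l)).

Lemma wcubeE u (mu_ : measurable_fun setT u) c l : weight u -> 0 < l ->
  dens mu_ (cube c l) = (wcube mu_ c l)%:E.
Proof. by move=> wu l0; have [] := dens_cube mu_ c wu l0. Qed.

Lemma wcube_gt0 u (mu_ : measurable_fun setT u) c l : weight u -> 0 < l -> 0 < wcube mu_ c l.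
Proof. by move=> wu l0; have [] := dens_cube mu_ c wu l0. Qed.

Lemma wcube_le u (mu_ : measurable_fun setT u) c c' l l' : weight u -> 0 < l -> 0 < l' ->
  cube c l `<=` cube c' l' -> wcube mu_ c l <= wcube mu_ c' l'.
Proof.
move=> wu l0 l'0 s; rewrite -lee_fin -!wcubeE//; apply: le_measure; rewrite ?inE//;
  exact: measurable_cube.
Qed.

Lemma doubling u (mu_ : measurable_fun setT u) (L : R) : (0 < n)%N -> weight u ->
  A_infty u -> 0 < L -> exists2 C : R, 0 < C & forall c c' l, 0 < l ->
    cube c' l `<=` cube c (L * l) -> wcube mu_ c (L * l) <= C * wcube mu_ c' l.
Proof.
move=> n0 wu Au L0; have a0 : 0 < L ^- n by rewrite invr_gt0 exprn_gt0.
have [C C0 H] := Ainfty_proportion mu_ n0 wu Au a0; exists C => // c c' l l0 s.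
have Ll0 : 0 < L * l by exact: mulr_gt0.
rewrite -lee_fin EFinM -!wcubeE//; apply: H => //; first exact: measurable_cube.
suff -> : (mu (cube c' l) = (l ^+ n)%:E)%E.
  by rewrite lee_fin exprMn mulKf// expf_neq0// gt_eqF.
by apply: mu_cube; exact: ltW.
Qed.

(** Since n > 0, the cube fills at most half of its double. The rest of the double thus carries a
    fixed proportion of the weight, which bounds the share left to the cube. *)
Lemma reverse_doubling u (mu_ : measurable_fun setT u) : (0 < n)%N -> weight u ->
  A_infty u -> exists2 t : R, 0 < t < 1 & forall c l, 0 < l ->
    wcube mu_ c l <= t * wcube mu_ c (2 * l).
Proof.
move=> n0 wu Au; have a0 : 0 < 2^-1 :> R by rewrite invr_gt0.
have [C C0 H] := Ainfty_proportion mu_ n0 wu Au a0; exists (C / (1 + C)).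
  by rewrite divr_gt0 ?addr_gt0// ltr_pdivrMr ?addr_gt0// mul1r ltrDr ltr01.
move=> c l l0; have l20 : 0 < 2 * l by exact: mulr_gt0.
have [m1 m2] := (measurable_cube c l, measurable_cube c (2 * l)).
have s : cube c l `<=` cube c (2 * l) by apply: le_cube; lra.
have mD : measurable (cube c (2 * l) `\` cube c l) by exact: measurableD.
have sub : ((2^-1 * (2 * l) ^+ n)%:E <= mu (cube c (2 * l) `\` cube c l))%E.
  have e1 : mu (cube c l) = (l ^+ n)%:E by apply: mu_cube; exact: ltW.
  have e2 : mu (cube c (2 * l)) = ((2 * l) ^+ n)%:E by apply: mu_cube; exact: ltW.
  have fin : (mu (cube c (2 * l)) < +oo)%E by rewrite e2 ltry.
  have -> : mu (cube c (2 * l) `\` cube c l) = ((2 * l) ^+ n - l ^+ n)%:E.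
    transitivity (mu (cube c (2 * l)) - mu (cube c l))%E; last by rewrite e1 e2.
    by apply: (etrans (measureD m2 m1 fin)); rewrite (setIidr s).
  rewrite lee_fin exprMn.
  have : 2 * l ^+ n <= 2 ^+ n * l ^+ n.
    by apply: ler_wpM2r; [rewrite exprn_ge0// ltW|apply: ler_eXnr => //; rewrite ler1n].
  lra.
have := H c _ _ l20 mD (@subDsetl _ _ _) sub.
have -> : dens mu_ (cube c (2 * l) `\` cube c l) = (wcube mu_ c (2 * l) - wcube mu_ c l)%:E.
  have fin : (dens mu_ (cube c (2 * l)) < +oo)%E by rewrite wcubeE// ltry.
  transitivity (dens mu_ (cube c (2 * l)) - dens mu_ (cube c l))%E; last by rewrite !wcubeE.
  by apply: (etrans (measureD m2 m1 fin)); rewrite (setIidr s).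
(* Adding w(Q) <= w(2Q) to w(2Q) <= C (w(2Q) - w(Q)) gives (1 + C) w(Q) <= C w(2Q). *)
rewrite wcubeE// -EFinM lee_fin => h; rewrite mulrAC ler_pdivlMr ?addr_gt0//.
by have := wcube_le mu_ wu l0 l20 s; move: h; nra.
Qed.

(* Jensen's inequality with the exponent [r] bounds the average of [u]. *)
Lemma bump_estimate u v (mu_ : measurable_fun setT u) (p r C0 : R) : (0 < n)%N -> 1 < p ->
  1 < r -> weight u -> weight v ->
  (forall c l, 0 < l ->
    (average (cube c l) (fun x => (u x `^ r)%R) `^ (r * p)^-1 *
     average (cube c l) (fun x => (v x `^ (- (conj_exponent p / p)))%R)
         `^ (conj_exponent p)^-1 <= C0%:E)%E) ->
  exists2 C : R, 0 < C & forall c l (g : Rn -> R) Gp, 0 < l -> measurable_fun setT g ->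
    (forall x, 0 <= g x) -> (\int[mu]_(x in cube c l) (g x `^ p * pospart v x)%:E <= Gp%:E)%E ->
    (\int[mu]_(x in cube c l) (g x)%:E <= (C * l ^+ n * (Gp / wcube mu_ c l) `^ p^-1)%:E)%E.
Proof.
move=> n0 p1 r1 wu wv H; exists (Num.max C0 1); first by rewrite lt_max ltr01 orbT.
move=> c l g Gp l0 mg g0; have [_ _ u0] := wu; have [mv _ v0] := wv.
have mQ := measurable_cube c l; have m0 : 0 < l ^+ n by rewrite exprn_gt0.
have muQ : mu (cube c l) = (l ^+ n)%:E by apply: mu_cube; exact: ltW.
have [p'0 pp' pE ip0] := conj_exponent_facts p1.
apply: hoelder_weight => //; first exact: wcube_gt0.
  by rewrite le_max ler01 orbT.
have := H c l l0; rewrite /average muQ /=.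
set X := (_ * \int[mu]_(x in _) (u x `^ r)%:E)%E; set Y := (_ * \int[mu]_(x in _) _)%E => HXY.
(* Positivity of the second factor is what makes the integral of u^r finite below. *)
have Y0 : (0 < Y)%E.
  apply: mule_gt0; first by rewrite lte_fin invr_gt0.
  apply: integral_pos => //.
  - by apply: (measurableT_comp (@measurable_powR R _)).
  - by move=> x; exact: powR_ge0.
  - by apply: filterS v0 => x v0; exact: powR_gt0.
  - by rewrite muQ lte_fin.
have Yp0 := poweR_gt0 (conj_exponent p)^-1 Y0.
have r0 : 0 < r by rewrite (lt_trans ltr01).
have rp0 : 0 < (r * p)^-1 by rewrite invr_gt0 mulr_gt0// (lt_trans ltr01).
have [G [G0 GE]] : exists G : R, 0 <= G /\ (\int[mu]_(x in cube c l) (u x `^ r)%:E)%E = G%:E.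
  have : (0 <= \int[mu]_(x in cube c l) (u x `^ r)%:E)%E.
    by apply: integral_ge0 => x _; rewrite lee_fin powR_ge0.
  move: HXY; rewrite /X; case: (\int[mu]_(x in cube c l) _)%E => [G| |] //=; first by exists G.
  rewrite gt0_muley ?lte_fin ?invr_gt0// poweRyr ?gt_eqF//.
  by rewrite gt0_mulye// leye_eq.
have XE : X = (G / l ^+ n)%:E by rewrite /X GE -EFinM mulrC.
have jensen : wcube mu_ c l / l ^+ n <= (G / l ^+ n) `^ r^-1.
  have m1 : measurable_fun (setT : set Rn) (fun=> 1 : R) by [].
  have a1 : {ae mu, forall x : Rn, 0 < (1 : R)} by apply: aeW.
  have m2 : measurable_fun setT (pospart u) by exact: measurable_pospart.
  have h1 : ((l ^+ n / l ^+ n)%:E `^ r^-1 * ((l ^+ n)^-1%:E *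
      \int[mu]_(x in cube c l) (1 `^ (- (conj_exponent r / r)))%:E) `^ (conj_exponent r)^-1
      <= 1%:E)%E.
    have -> : (\int[mu]_(x in cube c l) (1 `^ (- (conj_exponent r / r)))%:E = (l ^+ n)%:E)%E.
      by rewrite powR1 -muQ -[RHS]mul1e; exact: integral_cst.
    rewrite -EFinM mulVf ?gt_eqF// divff ?gt_eqF//.
    by rewrite !powR1 mulr1.
  have h2 : (\int[mu]_(x in cube c l) (pospart u x `^ r * pospart (fun=> 1) x)%:E <= G%:E)%E.
    rewrite -GE; apply: ae_ge0_le_integral => //.
    - by move=> x _; rewrite lee_fin mulr_ge0 ?powR_ge0 ?pospart_ge0.
    - apply/measurable_EFinP/measurable_funTS; apply: measurable_funM.
        by apply: (measurableT_comp (@measurable_powR R r)).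
      exact: measurable_pospart.
    - by move=> x _; rewrite lee_fin powR_ge0.
    - apply/measurable_EFinP/measurable_funTS.
      by apply: (measurableT_comp (@measurable_powR R r)); have [] := wu.
    - apply: filterS u0 => x u0 _.
      by rewrite lee_fin /pospart !max_l ?ler01 ?mulr1// ltW.
  have := hoelder_weight r1 m1 a1 mQ m0 m0 ler01 h1 m2 (pospart_ge0 u) h2.
  rewrite -/(dens mu_ (cube c l)) wcubeE// lee_fin mul1r => h3.
  by rewrite ler_pdivrMr// mulrC.
have w0 := wcube_gt0 mu_ c wu l0.
apply: le_trans (_ : (X `^ (r * p)^-1 * Y `^ (conj_exponent p)^-1 <= _)%E); last first.
  by apply: (le_trans HXY); rewrite lee_fin le_max lexx.
apply: lee_wpmul2r; first exact: poweR_ge0.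
rewrite XE !poweR_EFin lee_fin invfM powRrM.
apply: ge0_ler_powR => //; rewrite ?nnegrE ?powR_ge0//; first exact: ltW.
by rewrite divr_ge0// ltW.
Qed.

End weight_facts.

(** * The Dini condition *)

Section dini_sum.
Context {R : realType}.

(* Compare the sum with the integral over the dyadic intervals. *)
Lemma dini_sum (theta : R -> R) : dini theta ->
  exists S, forall N, \sum_(k < N) theta (2 ^- k) <= S.
Proof.
move=> [th0 thle thI]; pose lam := @lebesgue_measure R.
(* Extension by 0 makes the function monotone on the whole line, hence measurable. *)
pose th (t : R) := if 0 < t then theta t else 0.
have thE t : 0 < t -> th t = theta t by rewrite /th => ->.
have thpos t : 0 <= th t by rewrite /th; case: ifP => // /th0.
have thhomo : {homo th : s t / s <= t}.
  move=> s t st; rewrite /th; case: ifPn => s0; last by case: ifP => // /th0.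
  by rewrite (lt_le_trans s0 st); exact: thle.
have mth : measurable_fun (setT : set R) th by exact: nondecreasing_measurable.
pose f (t : R) := th t * t `^ (-1).
have mf : measurable_fun (setT : set R) f.
  by apply: measurable_funM => //; exact: measurable_powR.
pose J N : set R := [set` `[2 ^- N, 1[].
have p2 k : 0 < 2 ^- k :> R by rewrite invr_gt0 exprn_gt0.
have f0 t : 0 < t -> 0 <= f t by move=> t0; rewrite mulr_ge0// powR_ge0.
have Jpos N t : J N t -> 0 < t by rewrite /J /= in_itv/= => /andP[/(lt_le_trans (p2 N))].
have mfe (D : set R) : measurable D -> measurable_fun D (EFin \o f).
  by move=> mD; apply/measurable_EFinP; exact: measurable_funTS.
have step N : ((\sum_(k < N) theta (2 ^- k.+1) / 2)%:E <= \int[lam]_(t in J N) (f t)%:E)%E.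
  elim: N => [|N IH]; first by rewrite big_ord0; apply: integral_ge0 => t /Jpos /f0.
  have JE : J N.+1 = [set` `[2 ^- N.+1, 2 ^- N[] `|` J N.
    have lt := p2 N; have h : 2 ^- N.+1 <= 2 ^- N :> R.
      by rewrite lef_pV2 ?posrE ?exprn_gt0// ler_weXn2l// ler1n.
    have h1 : 2 ^- N <= 1 :> R by rewrite invf_le1 ?exprn_gt0// exprn_ege1// ler1n.
    apply/seteqP; split => t /=; rewrite /J /= !in_itv/=.
      by move=> /andP[-> t1]; rewrite t1 andbT; case: (ltP t (2 ^- N)); [left|right].
    case=> /andP[a1 a2]; apply/andP; split => //; first exact: lt_le_trans h1.
    exact: le_trans a1.
  rewrite JE ge0_integral_setU; last 5 first.
  - exact: measurable_itv.
  - exact: measurable_itv.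
  - by rewrite -JE; apply: mfe; exact: measurable_itv.
  - by move=> t; rewrite -JE => /Jpos /f0.
  - by apply/disj_set2P; apply/seteqP; split => // t [] /=; rewrite /J /= !in_itv/= => /andP[_ t1] /andP[t2 _]; rewrite ltNge t2 in t1.
  rewrite big_ord_recr /= EFinD addeC; apply: leeD => //.
  set I := [set` _]; have muI : lam I = (2 ^- N.+1)%:E.
    rewrite /lam lebesgue_measure_itv /= lte_fin.
    have E : 2 ^- N = 2 * 2 ^- N.+1 :> R by rewrite exprS invfM mulrA divff ?mul1r.
    have q := p2 N.+1; rewrite E; case: ltP => h; last by rewrite leNgt ltr_pMl// ltr1n in h.
    by rewrite -EFinD; congr EFin; ring.
  have mI : measurable I by exact: measurable_itv.
  (* On the interval from 2^-(N+1) to 2^-N, of length 2^-(N+1), one has theta(t)/t >=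
     theta(2^-(N+1)) 2^N; the product is theta(2^-(N+1))/2. *)
  apply: (@le_trans _ _ (\int[lam]_(t in I) cst (theta (2 ^- N.+1) * 2 ^+ N)%:E t)%E).
    rewrite integral_cst// [X in (_ <= _ * X)%E]muI -EFinM lee_fin exprS.
    by rewrite le_eqVlt; apply/orP; left; apply/eqP; field; rewrite expf_neq0.
  have I0 t : I t -> 0 < t by rewrite /I /= in_itv/= => /andP[/(lt_le_trans (p2 _))].
  apply: ge0_le_integral => //.
  - by move=> t It; rewrite lee_fin mulr_ge0 ?exprn_ge0// th0.
  - by apply: mfe; exact: measurable_itv.
  - move=> t It; have t0 := I0 _ It; move: It; rewrite /I /= in_itv/= => /andP[t1 t2].
    rewrite lee_fin /f thE// powR_inv1 ?(ltW t0)//; apply: ler_pM => //.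
    + by rewrite th0.
    + exact: thle.
    + by rewrite -[leLHS]invrK lef_pV2 ?posrE ?invr_gt0 ?exprn_gt0// ltW.
(* The term k = 0 lies outside the range of integration and is kept apart; the factor 2 undoes the
   halving in [step]. *)
exists (theta 1 + 2 * fine (\int[lam]_(t in `]0%R, 1%R[) (theta t / t)%:E)%E).
set I1 := (\int[lam]_(t in _) _)%E.
have I1E : I1 = (\int[lam]_(t in `]0%R, 1%R[) (f t)%:E)%E.
  apply: eq_integral => t; rewrite inE/= in_itv/= => /andP[t0 _].
  by rewrite /f thE// powR_inv1// ltW.
have I10 : (0 <= I1)%E.
  rewrite I1E; apply: integral_ge0 => t /=; rewrite in_itv/= => /andP[t0 _]; rewrite lee_fin f0//.
have I1f : I1 = (fine I1)%:E by rewrite fineK// ge0_fin_numE.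
case=> [|N].
  by rewrite big_ord0 addr_ge0 ?th0// mulr_ge0// fine_ge0.
rewrite big_ord_recl expr0 invr1 lerD2l.
have : ((\sum_(k < N) theta (2 ^- k.+1) / 2)%:E <= I1)%E.
  apply: (le_trans (step N)); rewrite I1E; apply: ge0_subset_integral => //.
  - exact: measurable_itv.
  - by apply: mfe; exact: measurable_itv.
  - by move=> t /=; rewrite in_itv/= => /andP[t0 _]; rewrite lee_fin f0.
  - move=> t Jt; have t0 := Jpos _ _ Jt; move: Jt; rewrite /J /= !in_itv/= => /andP[_ ->].
    by rewrite t0.
rewrite I1f lee_fin -mulr_suml ler_pdivrMr// mulrC.
by apply: le_trans; apply: ler_sum => i _.
Qed.

End dini_sum.

Lemma theta_CZO_operator (R : realType) (n : nat) (theta : R -> R)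
    (T : ('rV[R]_n -> R[i]) -> ('rV[R]_n -> R[i]) -> R[i])
    (T2 : ('rV[R]_n -> R[i]) -> 'rV[R]_n -> R[i]) (K : 'rV[R]_n -> 'rV[R]_n -> R[i]) :
  (0 < n)%N -> dini theta -> theta_CZO theta T T2 K ->
  exists A CK Sth, cz_operator A CK Sth theta T2 K.
Proof.
move=> n0 dt [_ [lin [A bd] _] [mK [CK [CK0 sz sm]]] rep].
have [S HS] := dini_sum dt; have [th0 thle _] := dt.
exists (Num.max A 0), CK, S; split=> //; first by rewrite le_max lexx orbT.
move=> f f2; have [T2f le] := bd f f2; split=> //; apply: (le_trans le).
by apply: lee_wpmul2r; [exact: Lnorm_ge0|rewrite lee_fin le_max lexx].
Qed.

(** * The good-lambda inequality *)

Section oscillation.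
Context {R : realType} {n : nat}.
Local Notation Rn := 'rV[R]_n.
Local Notation mu := (lebesgue_rV R n).
Implicit Types (f g h : Rn -> R[i]) (x y c : Rn) (S : set Rn) (b Q : box R n) (r s t : R).

Context {A CK Sth : R} {theta : R -> R} {T2 : (Rn -> R[i]) -> Rn -> R[i]}
  {K : Rn -> Rn -> R[i]}.
Hypothesis cz : cz_operator A CK Sth theta T2 K.

Local Notation C1 := (@C11 R n A CK Sth).
Local Notation dil := (@dil R n).

Definition restr S g : Rn -> R[i] := fun y => g y * (\1_S y)%:C%C.

Lemma restr_in S g y : S y -> restr S g y = g y.
Proof. by move=> Sy; rewrite /restr indicE mem_set// mulr1. Qed.

Lemma restr_out S g y : ~ S y -> restr S g y = 0.
Proof. by move=> Sy; rewrite /restr indicE memNset// mulr0. Qed.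

Lemma cabs_restr S g y : cabs (restr S g y) <= cabs (g y).
Proof.
have [Sy|Sy] := pselect (S y); first by rewrite restr_in.
by rewrite restr_out// cabs0 cabs_ge0.
Qed.

Lemma L1n_restr S g : measurable S -> L1n setT (restr S g) = L1n S g.
Proof.
move=> mS; rewrite (@L1n_supp _ _ _ S)//; last by move=> x; exact: restr_out.
by apply: eq_integral => x; rewrite inE => Sx; rewrite restr_in.
Qed.

Lemma cmeasurable_restr S g : measurable S -> cmeasurable setT g -> cmeasurable setT (restr S g).
Proof. by move=> mS mg; exact: cmeasurable_indic. Qed.

Lemma L1n_sub (D1 D2 : set Rn) g : measurable D1 -> measurable D2 -> cmeasurable setT g ->
  D1 `<=` D2 -> (L1n D1 g <= L1n D2 g)%E.
Proof.
move=> m1 m2 mg s; apply: ge0_subset_integral => //.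
  by apply/measurable_EFinP/measurable_funTS; exact: measurable_cabs.
by move=> x _; rewrite lee_fin cabs_ge0.
Qed.

(* The part of [T2 g] coming from afar, frozen at the centre of [b]. *)
Definition frozen g b : R[i] :=
  cintegral setT (fun y => K b.1 y * (g y - restr (cube b.1 (dil * b.2)) g y)).

(** The dilations start at [dil * b.2]: k = 0 controls the local part of [g], the other k its
    annuli. *)
Definition good t g b := forall k, (L1n (cube b.1 (2 ^+ k * (dil * b.2))) g <=
  (t * (2 ^+ k * (dil * b.2)) ^+ n)%:E)%E.

(** On each annulus the oscillation of the kernel is multiplied by at most [t] times the volume of
    the larger cube, and the volumes cancel as in [atom_bound]. *)
Lemma oscillation_bound g b x t : cint g -> 0 < b.2 -> 0 < t -> good t g b -> hbox b x ->
  cabs (cintegral setT (fun y => K x y * (g y - restr (cube b.1 (dil * b.2)) g y)) - frozen g b)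
    <= 2 * (4 ^+ n * CK * t * Sth).
Proof.
move=> [mg gi] b0 t0 gb bx; pose D := cube b.1 (dil * b.2).
have mD : measurable D by exact: measurable_cube.
pose go y := g y - restr D g y.
have mgo : cmeasurable setT go by apply: cmeasurableB => //; exact: cmeasurable_restr.
have go_in y : D y -> go y = 0 by move=> Dy; rewrite /go restr_in// subrr.
have go_out y : ~ D y -> go y = g y by move=> Dy; rewrite /go restr_out// subr0.
have go_le y : cabs (go y) <= cabs (g y).
  by have [Dy|Dy] := pselect (D y); [rewrite go_in// cabs0 cabs_ge0|rewrite go_out].
pose r := b.2 / 2; have r0 : 0 < r by rewrite divr_gt0.
have br : b.2 = 2 * r by rewrite /r; field.
have near z : hbox b z -> forall i, `|b.1 ord0 i - z ord0 i| <= r.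
  by move=> /hbox_cube bz i; rewrite distrC; exact: bz.
have bc : hbox b b.1 by exact: hbox_center.
have inD z : hbox b z -> D z.
  by move=> /hbox_cube; apply: le_cube; rewrite ler_peMl ?dil_ge1// ltW.
pose d := (dil - 1) * r; have d0 : 0 < d.
  by rewrite /d mulr_gt0// /dil addrK mulr_gt0// ltr0n (cz_n cz).
have farD z y : hbox b z -> go y != 0 -> far d z y.
  move=> bz goy; apply: far_sym; apply: (far_in_cube r0 (near _ bz)); rewrite -br.
  by move=> Dy; rewrite go_in// eqxx in goy.
have fin : (L1n setT go <= (fine (L1n setT g))%:E)%E.
  rewrite fineK ?ge0_fin_numE ?L1n_ge0//.
  apply: le_integral_EFin => //; try exact: measurable_cabs.
  by move=> y _; exact: cabs_ge0.
have [ix _] := Kint cz d0 mgo fin (fun y => farD x y bx).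
have [ic _] := Kint cz d0 mgo fin (fun y => farD b.1 y bc).
have -> : cintegral setT (fun y => K x y * go y) - frozen g b =
    cintegral setT (fun y => (K x y - K b.1 y) * go y).
  rewrite [RHS](@eq_cintegral _ _ _ _ (fun y => -1 * (K b.1 y * go y) + K x y * go y)).
    by rewrite cintegral_lin// mulN1r addrC.
  by move=> y _; ring.
have mphi : cmeasurable setT (fun y => (K x y - K b.1 y) * go y).
  rewrite (_ : (fun y => _) = (fun y => K x y * go y - K b.1 y * go y)).
    by apply: cmeasurableB; apply: (measurable_Kf cz) => //; apply: go_in; exact: inD.
  by apply/funext => y; rewrite mulrBl.
apply: (@cabs_cintegral _ _ _ _ (fun y => cabs ((K x y - K b.1 y) * go y))) => //.
  exact: measurable_cabs.
rewrite -/(L1n setT _) (@L1n_supp _ _ _ (~` D)); last 2 first.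
- exact: measurableC.
- by move=> y /contrapT Dy; rewrite go_in// mulr0.
have o0 k : 0 <= @osc R n CK theta k (dil * r) by apply: (osc_ge0 cz); rewrite mulr_gt0// dil_gt0.
apply: (@annuli_integral _ _ b.1 (dil * b.2) _ _ (fun y => cabs (g y))
  (fun k => @osc R n CK theta k (dil * r)) (fun k => t * (2 ^+ k.+1 * (dil * b.2)) ^+ n)) => //.
- by rewrite mulr_gt0// dil_gt0.
- exact: measurableC.
- by apply: measurable_funTS; exact: measurable_cabs.
- by move=> y _; exact: cabs_ge0.
- exact: measurable_cabs.
- by move=> y; exact: cabs_ge0.
- move=> k; rewrite mulr_ge0 ?exprn_ge0 ?mulr_ge0 ?exprn_ge0 ?(ltW t0)//; last exact: ltW.
  exact/ltW/dil_gt0.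
- apply: aeW => y Dy k _ /notin_cube fy; rewrite cabsM; apply: ler_pM; rewrite ?cabs_ge0//.
  have fy' : far (2 ^+ k * (dil * r)) y b.1.
    by case: fy => i fy; exists i; apply: le_trans fy; rewrite br; lra.
  by have [] := kernel_smooth cz r0 (near _ bx) fy'.
- by move=> k; exact: gb.
- move=> N; rewrite (eq_bigr (fun k : 'I_N => 4 ^+ n * CK * t * theta (2 ^- k))).
    by rewrite -mulr_sumr ler_wpM2l ?(cz_S cz)// !mulr_ge0 ?exprn_ge0 ?(ltW (cz_CK cz)) ?(ltW t0).
  move=> k _; rewrite /osc br.
  rewrite (_ : 2 ^+ k.+1 * (dil * (2 * r)) = 4 * (2 ^+ k * (dil * r))); last by rewrite exprS; ring.
  set X := 2 ^+ k * (dil * r); rewrite (exprMn n 4 X).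
  have X0 : X != 0 by rewrite gt_eqF// !mulr_gt0 ?exprn_gt0 ?dil_gt0.
  by field; rewrite expf_neq0.
Qed.

(** Split [h] into the value [h1] at the part of [g] in the dilated cube and the far part. The far
    part differs from [frozen g b] by at most A1 t everywhere on [b], up to null sets, and |h1|
    exceeds A2 t only on a small set by weak type (1,1). *)
Lemma oscillation (e : R) : 0 < e -> exists2 a, 0 < a & forall g h b t,
  ext T2 (2 * C1) g h -> 0 < b.2 -> 0 < t -> good t g b ->
  (mu (hbox b `&` lvl (a * t) (fun x => (h x - frozen g b)%R)) <= (e * b.2 ^+ n)%:E)%E.
Proof.
move=> e0; have C10 := C11_ge0 cz; pose A1 := 2 * (4 ^+ n * CK * Sth).
have A10 : 0 <= A1 by rewrite !mulr_ge0 ?exprn_ge0 ?(ltW (cz_CK cz)) ?(Sth_ge0 cz).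
have dil0 : 0 <= dil by exact/ltW/dil_gt0.
have P0 : 0 <= 2 * C1 * dil ^+ n by apply: mulr_ge0; [exact: mulr_ge0|exact: exprn_ge0].
(* With this choice the weak type bound is at most e |b|; the added 1 keeps A2 positive. *)
pose A2 := (2 * C1 * dil ^+ n + 1) / e; have A20 : 0 < A2 by rewrite divr_gt0// ltr_wpDl.
exists (A1 + A2); first by rewrite ltr_wpDl.
move=> g h b t egh b0 t0 gb; have [ig mh _] := egh; have [mg gi] := ig.
pose D := cube b.1 (dil * b.2); have mD : measurable D by exact: measurable_cube.
have db0 : 0 < dil * b.2 by rewrite mulr_gt0 ?dil_gt0.
have L1 : (L1n setT (restr D g) <= (t * (dil * b.2) ^+ n)%:E)%E.
  by rewrite L1n_restr//; have := gb 0; rewrite expr0 mul1r.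
have ig1 : cint (restr D g).
  by split; [exact: cmeasurable_restr|exact: le_lt_trans L1 (ltry _)].
have [h1 egh1] := ext_exists cz ig1; have [_ mh1 _] := egh1.
pose r := b.2 / 2; have r0 : 0 < r by rewrite divr_gt0.
have br : b.2 = 2 * r by rewrite /r; field.
pose d := (dil - 1) * r; have d0 : 0 < d.
  by rewrite /d mulr_gt0// /dil addrK mulr_gt0// ltr0n (cz_n cz).
have C20 : 0 <= 2 * C1 by exact: mulr_ge0.
have loc := ext_locality cz (mulr_ge0 (ler0n _ 4) C20) (ext_sub cz C20 egh egh1) d0
  (S := hbox b) _.
have {}loc : {ae mu, forall x, hbox b x -> h x - h1 x =
    cintegral setT (fun y => K x y * (g y - restr D g y))}.
  apply: loc => x y bx fy; apply: far_sym.
  have bx' i : `|b.1 ord0 i - x ord0 i| <= r by rewrite distrC; exact: (hbox_cube bx).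
  apply: (far_in_cube r0 bx'); rewrite -br => Dy.
  by move: fy; rewrite restr_in// subrr eqxx.
apply: (@le_trans _ _ (mu (lvl (A2 * t) h1))).
  apply: ae_le_measure.
  - apply: measurableI; first exact: measurable_hbox.
    by apply: measurable_lvl; apply: cmeasurableB => //; exact: cmeasurable_cst.
  - exact: measurable_lvl.
  - apply: filterS loc => x loc [bx]; rewrite /lvl /= => hx.
    have := oscillation_bound ig b0 t0 gb bx; rewrite -loc// => o.
    have := cabsD (h x - h1 x - frozen g b) (h1 x).
    rewrite addrAC subrK addrC => tri.
    have E : (A1 + A2) * t = 2 * (4 ^+ n * CK * t * Sth) + A2 * t by rewrite /A1; ring.
    rewrite E in hx; move: o tri hx; rewrite -!addrA [- frozen g b + h x]addrC; lra.
have A2t : 0 < A2 * t by exact: mulr_gt0.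
apply: (le_trans (ext_weak cz egh1 L1 A2t)); rewrite lee_fin.
have -> : 2 * C1 * (t * (dil * b.2) ^+ n) / (A2 * t) = e * b.2 ^+ n * (2 * C1 * dil ^+ n / (2 * C1 * dil ^+ n + 1)).
  rewrite /A2 exprMn; field; rewrite !gt_eqF// ltr_wpDl//.
rewrite ler_piMr ?mulr_ge0 ?exprn_ge0 ?(ltW e0) ?(ltW b0)//.
by rewrite ler_pdivrMr ?ltr_wpDl// mul1r lerDl.
Qed.

End oscillation.

(** * Vitali covering and the maximal function estimate *)

Section covering.
Context {R : realType} {n : nat}.
Local Notation Rn := 'rV[R]_n.
Local Notation mu := (lebesgue_rV R n).
Implicit Types (b : box R n) (L : seq (box R n)).

Definition cubes L : set Rn := \bigcup_(b in [set` L]) cube b.1 b.2.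

Lemma measurable_cubes L : measurable (cubes L).
Proof. by apply: fin_bigcup_measurable => // b _; exact: measurable_cube. Qed.

Lemma largest_box L : L != [::] -> exists2 b, b \in L & forall b', b' \in L -> b'.2 <= b.2.
Proof.
case: L => // b0 L _; elim: L b0 => [|b1 L IH] b0.
  by exists b0; [exact: mem_head|move=> b'; rewrite inE => /eqP ->].
have [b bL bmax] := IH b1; have [le|lt] := leP b0.2 b.2.
  exists b; first by rewrite inE bL orbT.
  by move=> b'; rewrite inE => /orP[/eqP ->|] //; exact: bmax.
exists b0; first exact: mem_head.
move=> b'; rewrite inE => /orP[/eqP ->|/bmax h] //.
exact: le_trans h (ltW lt).
Qed.

(* Vitali covering for finitely many cubes: select the largest cube, discard
   those meeting it (they lie in its threefold dilation) and repeat. *)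
Lemma vitali_cubes (m M : {measure set Rn -> \bar R}) (C : R) L : 0 <= C ->
  (forall b, b \in L -> 0 < b.2 /\ (m (cube b.1 (3 * b.2)) <= C%:E * M (cube b.1 b.2))%E) ->
  (m (cubes L) <= C%:E * M (cubes L))%E.
Proof.
move=> C0; have [N] := ubnP (size L); elim: N L => // N IH L; rewrite ltnS => LN HL.
have [->|/largest_box[b bL bmax]] := eqVneq L [::].
  by rewrite /cubes set_nil bigcup_set0 measure0 mule_ge0// lee_fin.
have [b0 mb] := HL _ bL.
pose meets b' := `[< exists z, cube b.1 b.2 z /\ cube b'.1 b'.2 z >].
pose L' := [seq b' <- L | ~~ meets b'].
have bb : meets b.
  by apply/asboolP; exists b.1; split => i; rewrite subrr normr0 divr_ge0// ltW.
have sz : (size L' < N)%N.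
  apply: leq_trans LN; rewrite size_filter -(count_predC meets L) -add1n leq_add2r.
  by rewrite -has_count; apply/hasP; exists b.
have IHL' : (m (cubes L') <= C%:E * M (cubes L'))%E.
  by apply: IH => // b'; rewrite mem_filter => /andP[_]; exact: HL.
have [mL mL'] := (measurable_cubes L, measurable_cubes L').
have [m1 m3] := (measurable_cube b.1 b.2, measurable_cube b.1 (3 * b.2)).
have s1 : cubes L `<=` cube b.1 (3 * b.2) `|` cubes L'.
  move=> x [b' /= b'L b'x]; have [/asboolP[z [bz b'z]]|nm] := boolP (meets b'); last first.
    by right; exists b' => //=; rewrite mem_filter nm.
  left=> i; have := bmax _ b'L; have := bz i; have := b'z i; have := b'x i.
  have := ler_normD (x ord0 i - b'.1 ord0 i) (b'.1 ord0 i - z ord0 i).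
  have := ler_normD (x ord0 i - z ord0 i) (z ord0 i - b.1 ord0 i).
  rewrite !addrA !subrK (distrC (b'.1 ord0 i)); lra.
have s2 : cube b.1 b.2 `|` cubes L' `<=` cubes L.
  move=> x [bx|[b' /=]]; first by exists b.
  by rewrite mem_filter => /andP[_ b'L] b'x; exists b'.
have d : [disjoint cube b.1 b.2 & cubes L'].
  apply/disj_set2P/seteqP; split => // x [bx [b' /=]].
  by rewrite mem_filter => /andP[/asboolP nm _] b'x; apply: nm; exists x.
apply: (@le_trans _ _ (m (cube b.1 (3 * b.2) `|` cubes L'))).
  by apply: le_measure; rewrite ?inE//; exact: measurableU.
apply: (@le_trans _ _ (m (cube b.1 (3 * b.2)) + m (cubes L'))%E).
  exact: measureU2.
apply: (@le_trans _ _ (C%:E * (M (cube b.1 b.2) + M (cubes L')))%E).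
  by rewrite ge0_muleDr ?measure_ge0//; exact: leeD.
apply: lee_wpmul2l; first by rewrite lee_fin.
rewrite -measureU//; last by apply/disj_set2P.
by apply: le_measure; rewrite ?inE//; exact: measurableU.
Qed.

End covering.

Section maximal.
Context {R : realType} {n : nat}.
Local Notation Rn := 'rV[R]_n.
Local Notation mu := (lebesgue_rV R n).
Implicit Types (b : box R n) (L : seq (box R n)) (c : Rn) (l : R) (g : Rn -> R[i]).
Local Notation dil := (@dil R n).

(** The form in which the two-weight hypothesis is used from here on; [bump_estimate] derives it. *)
Definition two_weight (p : R) u (mu_ : measurable_fun setT u) (v : Rn -> R) (C : R) :=
  forall c l (g : Rn -> R) Gp, 0 < l -> measurable_fun setT g ->
    (forall x, 0 <= g x) -> (\int[mu]_(x in cube c l) (g x `^ p * pospart v x)%:E <= Gp%:E)%E ->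
    (\int[mu]_(x in cube c l) (g x)%:E <= (C * l ^+ n * (Gp / wcube mu_ c l) `^ p^-1)%:E)%E.

Definition Lpw (p : R) (v : Rn -> R) g (D : set Rn) : \bar R :=
  (\int[mu]_(x in D) (cabs (g x) `^ p * pospart v x)%:E)%E.

(** Realising the weighted integral as a measure provides the additivity over disjoint cubes needed
    in [vitali_cubes]. *)
Lemma Lpw_dens p v g (mv : measurable_fun setT v) : cmeasurable setT g ->
  exists M : {measure set Rn -> \bar R}, forall D, measurable D -> M D = Lpw p v g D.
Proof.
move=> mg; have mw : measurable_fun setT (fun x => cabs (g x) `^ p * pospart v x).
  apply: measurable_funM; last exact: measurable_pospart.
  by apply: (measurableT_comp (@measurable_powR R p)); exact: measurable_cabs.
exists (dens mw) => D mD; apply: eq_integral => x _.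
by rewrite /pospart max_l// mulr_ge0 ?powR_ge0// pospart_ge0.
Qed.

(** A bad box has a dilation on which |g| has average above [t]; there the two-weight bound gives
    u(Q) <= (Cb/t)^p times the integral of |g|^p v over Q. Doubling replaces u(Q) by u(3Q), and
    [vitali_cubes] sums over the dilations. *)
Lemma bad_boxes (p : R) u (mu_ : measurable_fun setT u) (v : Rn -> R) (Cb : R) :
  (0 < n)%N -> 1 < p -> weight u -> A_infty u -> measurable_fun setT v -> 0 < Cb ->
  two_weight p mu_ v Cb ->
  exists2 C : R, 0 < C & forall g L (t W : R), 0 < t -> cmeasurable setT g ->
    (Lpw p v g setT <= W%:E)%E ->
    (forall b, b \in L -> 0 < b.2 /\ ~ good t g b) ->
    (dens mu_ (\bigcup_(b in [set` L]) hbox b) <= (C * (W / t `^ p))%:E)%E.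
Proof.
move=> n0 p1 wu Au mv Cb0 H2; have [Cd Cd0 Hd] := doubling mu_ n0 wu Au (ltr0n R 3).
have p0 : 0 < p by rewrite (lt_trans ltr01).
exists (Cd * Cb `^ p); first by rewrite mulr_gt0 ?powR_gt0.
move=> g L t W t0 mg gW Lbad; have [M ME] := Lpw_dens p mv mg.
have exk b : exists b' : box R n, b \in L ->
    [/\ 0 < b'.2, hbox b `<=` cube b'.1 b'.2 & ((t * b'.2 ^+ n)%:E < L1n (cube b'.1 b'.2) g)%E].
  have [bL|] := boolP (b \in L); last by exists b.
  have [b0 /existsNP[k /negP]] := Lbad b bL; rewrite -ltNge => bad.
  have d1 : 1 <= 2 ^+ k * dil.
    by rewrite mulr_ege1 ?exprn_ege1 ?ler1n ?dil_ge1.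
  exists (b.1, 2 ^+ k * (dil * b.2)) => _; split=> //=.
    by rewrite !mulr_gt0 ?exprn_gt0 ?dil_gt0.
  apply: subset_trans (@hbox_cube _ _ _) _; apply: le_cube.
  by rewrite mulrA ler_peMl// ltW.
have [B HB] := choice exk; pose L' := [seq B b | b <- L].
apply: (@le_trans _ _ (dens mu_ (cubes L'))).
  apply: le_measure; rewrite ?inE.
  - by apply: fin_bigcup_measurable => // b _; exact: measurable_hbox.
  - exact: measurable_cubes.
  - move=> x [b /= bL bx]; have [_ s _] := HB b bL; exists (B b); last exact: s.
    by apply/mapP; exists b.
have C'0 : 0 <= Cd * (Cb `^ p / t `^ p) by rewrite !mulr_ge0 ?invr_ge0 ?powR_ge0// ltW.
apply: (@le_trans _ _ ((Cd * (Cb `^ p / t `^ p))%:E * M (cubes L'))%E); last first.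
  rewrite (_ : Cd * Cb `^ p * (W / t `^ p) = Cd * (Cb `^ p / t `^ p) * W); last by ring.
  rewrite [leRHS]EFinM; apply: lee_wpmul2l; first by rewrite lee_fin.
  apply: le_trans gW; rewrite -ME//; apply: le_measure; rewrite ?inE//.
  exact: measurable_cubes.
apply: vitali_cubes => // b' /mapP[b bL ->]; have [b0 _ bad] := HB b bL.
split=> //; set c := (B b).1; set l := (B b).2.
have mC : measurable (cube c l) by exact: measurable_cube.
have Mf : (M (cube c l) <= W%:E)%E.
  by apply: le_trans gW; rewrite -ME//; apply: le_measure; rewrite ?inE.
have Mr : M (cube c l) = (fine (M (cube c l)))%:E.
  by rewrite fineK// ge0_fin_numE ?measure_ge0// (le_lt_trans Mf) ?ltry.
set G := fine _ in Mr; have G0 : 0 <= G by rewrite fine_ge0// measure_ge0.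
have l30 : 0 < 3 * l by exact: mulr_gt0.
rewrite Mr; apply: (@le_trans _ _ (wcube mu_ c (3 * l))%:E); first by rewrite -wcubeE.
rewrite -EFinM lee_fin; apply: (le_trans (Hd c c l b0 _)).
  by apply: le_cube; rewrite ler_peMl ?ler1n// ltW.
rewrite -mulrA; apply: ler_wpM2l; first exact: ltW.
have w0 := wcube_gt0 mu_ c wu b0.
have h1 : (\int[mu]_(x in cube c l) (cabs (g x) `^ p * pospart v x)%:E <= G%:E)%E.
  by rewrite -Mr ME.
have := H2 c l _ G b0 (measurable_cabs mg) (fun x => cabs_ge0 (g x)) h1.
move=> /(lt_le_trans bad); rewrite lte_fin mulrAC ltr_pM2r ?exprn_gt0// => h2.
have {h2} h3 : t `^ p <= Cb `^ p * (G / wcube mu_ c l).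
  have z0 : 0 <= G / wcube mu_ c l by rewrite divr_ge0// ltW.
  have -> : Cb `^ p * (G / wcube mu_ c l) = (Cb * (G / wcube mu_ c l) `^ p^-1) `^ p.
    rewrite powRM ?powR_ge0 ?(ltW Cb0)// -powRrM mulVf ?powRr1// gt_eqF//.
  by apply: ge0_ler_powR; rewrite ?nnegrE ?mulr_ge0 ?powR_ge0 ?(ltW t0) ?(ltW Cb0) ?(ltW p0)// ltW.
have tp0 : 0 < t `^ p by exact: powR_gt0.
rewrite -mulrA [_^-1 * _]mulrC mulrA ler_pdivlMr// mulrC.
by rewrite mulrA ler_pdivlMr in h3.
Qed.

End maximal.

(** * Sparse cubes and the descent in the dyadic tree *)

Section sparse_boxes.
Context {R : realType} {n : nat}.
Local Notation Rn := 'rV[R]_n.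
Local Notation mu := (lebesgue_rV R n).
Implicit Types (b Q : box R n) (E D : set Rn).

Lemma dens_absolutely_continuous u (mu_ : measurable_fun setT u) Q (e : R) : weight u ->
  0 < e -> exists2 d : R, 0 < d & forall E, measurable E -> E `<=` hbox Q ->
    (mu E < d%:E)%E -> (dens mu_ E <= e%:E)%E.
Proof.
move=> wu e0; have mQ := measurable_hbox Q; have mp := measurable_pospart mu_.
pose f x := pospart u x * \1_(hbox Q) x.
have f0 x : 0 <= f x by rewrite mulr_ge0// pospart_ge0.
have mf : measurable_fun setT f by apply: measurable_funM => //; exact: measurable_indic.
have fi : mu.-integrable setT (EFin \o f).
  apply/integrableP; split; first exact/measurable_EFinP.
  apply: le_lt_trans (cube_fin mu_ Q.1 Q.2 wu).
  rewrite /dens [leRHS]integral_mkcond; apply: ge0_le_integral => //.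
  - by apply/measurableT_comp => //; exact/measurable_EFinP.
  - apply/(measurable_restrictT _ (measurable_cube Q.1 Q.2)).
    by apply/measurable_EFinP; exact: measurable_funTS.
  - move=> x _; rewrite patchE /= ger0_norm// /f indicE.
    case: (boolP (x \in hbox Q)) => xQ; last by rewrite mulr0; case: ifP; rewrite ?lee_fin ?pospart_ge0.
    by rewrite mem_set ?mulr1//; apply: hbox_cube; rewrite inE in xQ.
have [d [d0 Hd]] := integral_normr_continuous fi e0; exists d => // E mE EQ Ed.
have := Hd E mE Ed; rewrite /Rintegral => /ltW.
have Ei : mu.-integrable E (EFin \o f) by apply: integrableS fi.
have -> : dens mu_ E = (\int[mu]_(x in E) `|f x|%:E)%E.
  apply: eq_integral => x; rewrite inE => Ex.
  by rewrite ger0_norm// /f indicE mem_set ?mulr1//; exact: EQ.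
move=> h; rewrite -[leLHS]fineK ?lee_fin//.
have /integrableP[_ lt] := Ei; rewrite ge0_fin_numE//.
by apply: integral_ge0 => x _; rewrite lee_fin.
Qed.

(** The integral is |1 - a| |b ∩ E| + |a| |b \ E|. As [E] fills at most half of [b], the second
    measure is at least the first, and |1 - a| + |a| >= 1. *)
Lemma sparse_box b E (a : R) : 0 < b.2 -> measurable E ->
  (mu (hbox b `&` E) <= (2^-1 * b.2 ^+ n)%:E)%E ->
  (mu (hbox b `&` E) <= \int[mu]_(x in hbox b) `|\1_E x - a|%:E)%E.
Proof.
move=> b0 mE h; have mb := measurable_hbox b.
have m1 := measurableI _ _ mb mE; have m2 := measurableD mb mE.
have mf : measurable_fun setT (fun x : Rn => `|\1_E x - a|).
  by apply: measurableT_comp => //; apply: measurable_funB => //; exact: measurable_indic.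
set X := mu (hbox b `&` E) in h *.
have [x [x0 xE]] : exists x : R, 0 <= x /\ X = x%:E.
  have : (0 <= X)%E by exact: measure_ge0.
  by move: h; case: X => // x; exists x.
have fin : (mu (hbox b) < +oo)%E by rewrite (mu_hbox (ltW b0)) ltry.
have D2 : mu (hbox b `\` E) = (b.2 ^+ n - x)%:E.
  apply: (etrans (measureD mb mE fin)).
  by rewrite EFinB -xE -(mu_hbox (ltW b0)).
rewrite -{1}(setUIDK (hbox b) E) ge0_integral_setU//; last 2 first.
- by rewrite setUIDK; apply/measurable_EFinP; exact: measurable_funTS.
- by apply/disj_set2P; apply/seteqP; split => // y [[_ yE] [_]].
have h1 : (`|1 - a|%:E * X <= \int[mu]_(x in hbox b `&` E) `|\1_E x - a|%:E)%E.
  rewrite /X -integral_cst//; apply: ge0_le_integral => //.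
  - by move=> y _; rewrite lee_fin.
  - by apply/measurable_EFinP; exact: measurable_funTS.
  - by move=> y [_ yE]; rewrite indicE mem_set.
have h2 : (`|a|%:E * (b.2 ^+ n - x)%:E <= \int[mu]_(x in hbox b `\` E) `|\1_E x - a|%:E)%E.
  rewrite -D2 -integral_cst//; apply: ge0_le_integral => //.
  - by move=> y _; rewrite lee_fin.
  - by apply/measurable_EFinP; exact: measurable_funTS.
  - by move=> y [_ yE]; rewrite indicE memNset// sub0r normrN.
apply: le_trans (leeD h1 h2); rewrite xE -!EFinM -EFinD lee_fin.
rewrite xE lee_fin in h.
have := ler_normD (1 - a) a; rewrite subrK normr1.
have := normr_ge0 (1 - a); have := normr_ge0 a.
nra.
Qed.

(* Boxes of a high generation in which [E] is sparse contain little of [E]: on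
   each of them a function constant there cannot approximate the indicator
   function of [E]. *)
Lemma sparse_small u (mu_ : measurable_fun setT u) Q E (e : R) : weight u -> 0 < Q.2 ->
  measurable E -> 0 < e -> exists k0, forall k (P : pred (box R n)), (k0 <= k)%N ->
    (forall b, b \in gen Q k -> P b -> (mu (hbox b `&` E) <= (2^-1 * b.2 ^+ n)%:E)%E) ->
    (\sum_(b <- gen Q k | P b) dens mu_ (hbox b `&` E) <= e%:E)%E.
Proof.
move=> wu Q0 mE e0; have [d d0 Hd] := dens_absolutely_continuous mu_ Q wu e0.
have [_ ap] := appr_indic Q0 mE; have d2 : 0 < d / 2 by rewrite divr_gt0.
have [k0 [g [sg dg]]] := ap _ d2; exists k0 => k P kk HP.
have [mg sgk] := step_le Q0 kk sg.
(* The sum over the selected cubes becomes the measure of one set, to which absolute continuity of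
   [u] with respect to Lebesgue measure applies. *)
pose S := ctr Q k @^-1` [set c | P (c, Q.2 / 2 ^+ k)].
have mS : measurable S by exact: measurable_ctr.
have mES : measurable (E `&` S) by exact: measurableI.
have sumE (m : {measure set Rn -> \bar R}) :
    (\sum_(b <- gen Q k | P b) m (hbox b `&` E) = m (hbox Q `&` (E `&` S)))%E.
  rewrite (measure_gen m k Q0 mES) big_mkcond /= !big_seq; apply: eq_bigr => b bk.
  have bE : b = (b.1, Q.2 / 2 ^+ k) by rewrite -(gen_side bk); case: (b).
  have Sb x : hbox b x -> S x <-> P b.
    by move=> bx; rewrite /S /= (ctr_gen Q0 bk bx) -bE.
  case: ifPn => [Pb|nPb].
    congr (m _); apply/seteqP; split => x; first by move=> [bx Ex]; split=> //; split=> //; exact/Sb.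
    by move=> [bx [Ex _]].
  rewrite (_ : _ `&` _ = set0) ?measure0//; apply/seteqP; split => // x [bx [_ /(Sb _ bx)]].
  by rewrite (negbTE nPb).
rewrite (sumE (dens mu_)); apply: Hd.
- by apply: measurableI => //; exact: measurable_hbox.
- by move=> x [].
rewrite -(sumE mu); apply: (@le_lt_trans _ _ (d / 2)%:E); last by rewrite lte_fin; lra.
apply: le_trans dg; rewrite /dist1 (ge0_integral_gen mu k Q0)//; last first.
  by apply/measurable_EFinP; apply: measurable_dist => //; apply: measurable_funTS.
rewrite big_mkcond !big_seq; apply: lee_sum => b bk.
case: ifPn => Pb; last by apply: integral_ge0.
have b0 := gen_side_gt0 Q0 bk.
apply: (le_trans (sparse_box (g b.1) b0 mE (HP b bk Pb))).
rewrite le_eqVlt; apply/orP; left; apply/eqP; apply: eq_integral => x; rewrite inE => bx.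
by rewrite -(sgk x) ?(ctr_gen Q0 bk bx)//; exact: gen_sub bk _ bx.
Qed.

(** Each child falls under one of three cases: a bad one lies in [B], a good one that is not low
    stops and obeys [stop], a good low one is descended further. What remains after [K] generations
    is the sum over the cubes that never stopped. *)
Lemma stopping_tree (m : {measure set Rn -> \bar R}) (E E' B : set Rn) (eta : R)
    (low bad : box R n -> Prop) : measurable E -> measurable E' -> measurable B -> 0 <= eta ->
  (forall Q e, 0 < Q.2 -> low Q -> ~ bad Q -> ~ low (kid Q e) -> ~ bad (kid Q e) ->
    (m (hbox (kid Q e) `&` E) <= eta%:E * m (hbox (kid Q e) `&` E'))%E) ->
  forall K Q, 0 < Q.2 -> low Q -> ~ bad Q ->
    (forall k b, (k <= K)%N -> b \in gen Q k -> bad b -> hbox b `<=` B) ->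
    (m (hbox Q `&` (E `\` B)) <= eta%:E * m (hbox Q `&` E') +
      \sum_(b <- gen Q K | `[< low b /\ ~ bad b >]) m (hbox b `&` E))%E.
Proof.
move=> mE mE' mB eta0 stop; have mEB : measurable (E `\` B) by exact: measurableD.
have S0 (s : seq (box R n)) P : (0 <= \sum_(b <- s | P b) m (hbox b `&` E))%E.
  by apply: sume_ge0.
have sub b : (m (hbox b `&` (E `\` B)) <= m (hbox b `&` E))%E.
  have mb := measurable_hbox b; apply: le_measure; rewrite ?inE; try exact: measurableI.
  by move=> x [bx [Ex _]].
elim=> [|K IH] Q Q0 lQ bQ HB.
  rewrite big_mkcond big_seq1 asboolT//; apply: (le_trans (sub Q)); rewrite leeDr//.
  by rewrite mule_ge0// lee_fin.
rewrite (measure_kids m Q0 mEB) (measure_kids m Q0 mE') ge0_sume_distrr//.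
rewrite [X in (_ <= _ + X)%E]big_mkcond big_genS -big_split /=; apply: lee_sum => e _.
have k0 : 0 < (kid Q e).2 by rewrite /= divr_gt0.
rewrite -big_mkcond /=.
have genK k b : b \in gen (kid Q e) k -> b \in gen Q k.+1.
  by move=> bk; apply/flatten_mapP; exists e => //; rewrite mem_index_enum.
have [be|be] := pselect (bad (kid Q e)).
  have -> : hbox (kid Q e) `&` (E `\` B) = set0.
    apply/seteqP; split => // x [bx [_ nB]]; apply: nB.
    apply: (HB 1%N (kid Q e)) => //; first by apply: genK; rewrite inE.
  by rewrite measure0 adde_ge0// mule_ge0// lee_fin.
have [le|le] := pselect (low (kid Q e)).
  by apply: IH => // k b kK /genK; exact: HB.
apply: (le_trans (sub _)); apply: le_trans (stop Q e Q0 lQ bQ le be) _.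
by rewrite leeDl.
Qed.

End sparse_boxes.

Section threshold_arithmetic.
Context {R : realFieldType} (be s d z z' w : R).
Hypotheses (be1 : 0 < (1 - be) * s).

Lemma above_frozen : w <= d + z -> z <= (1 + be) / 2 * s -> s < w -> (1 - be) * s / 6 < d.
Proof.
move: be1; have -> : (1 - be) * s = s - be * s by ring.
have -> : (1 + be) / 2 * s = (s + be * s) / 2 by field.
by set q := be * s; lra.
Qed.

(** In units of (1 - be) s / 6 the midpoint is 3 above [be * s] and 3 below [s]. The stopping value
    z' is at most 2 above the midpoint and w at most 1 away from z', so w stays between the two
    ends. *)
Lemma between_levels : d <= (1 - be) * s / 6 -> z <= (1 + be) / 2 * s -> (1 + be) / 2 * s < z' ->
  z' - z <= 2 * ((1 - be) * s / 6) -> w <= d + z' -> z' <= d + w -> be * s < w /\ ~ s < w.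
Proof.
move: be1; have -> : (1 - be) * s = s - be * s by ring.
have -> : (1 + be) / 2 * s = (s + be * s) / 2 by field.
by set q := be * s => *; split; [lra|move=> ?; lra].
Qed.

End threshold_arithmetic.

Section good_lambda.
Context {R : realType} {n : nat}.
Local Notation Rn := 'rV[R]_n.
Local Notation mu := (lebesgue_rV R n).
Implicit Types (f g h : Rn -> R[i]) (x y c : Rn) (S : set Rn) (b Q : box R n) (r s t : R).

Context {A CK Sth : R} {theta : R -> R} {T2 : (Rn -> R[i]) -> Rn -> R[i]}
  {K : Rn -> Rn -> R[i]}.
Hypothesis cz : cz_operator A CK Sth theta T2 K.

Local Notation C1 := (@C11 R n A CK Sth).
Local Notation frozen := (@frozen R n K).

Context (p Cb : R) (u v : Rn -> R).
Hypotheses (p1 : 1 < p) (wu : weight u) (Au : A_infty u) (mu_ : measurable_fun setT u)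
  (mv : measurable_fun setT v) (Cb0 : 0 < Cb) (H2 : two_weight p mu_ v Cb).

Let n0 : (0 < n)%N. Proof. exact: cz_n cz. Qed.

(** Were the two constants farther apart, every point of the child would be exceptional for one of
    them. But the two exceptional sets together have measure at most e (2^n + 1) times that of the
    child. *)
Lemma frozen_near (a e t : R) g h Q k : 0 < Q.2 -> e * (1 + 2 ^+ n) < 1 -> 
  (mu (hbox Q `&` lvl (a * t) (fun x => (h x - frozen g Q)%R)) <= (e * Q.2 ^+ n)%:E)%E ->
  (mu (hbox (kid Q k) `&` lvl (a * t) (fun x => (h x - frozen g (kid Q k))%R))
     <= (e * (kid Q k).2 ^+ n)%:E)%E -> cmeasurable setT h ->
  cabs (frozen g (kid Q k) - frozen g Q) <= 2 * (a * t).
Proof.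
move=> Q0 e1 o1 o2 mh; set b := kid Q k in o2 *; have b0 : 0 < b.2 by rewrite /= divr_gt0.
rewrite leNgt; apply/negP => big.
have ml z : measurable (lvl (a * t) (fun x => h x - z)).
  by apply: measurable_lvl; apply: cmeasurableB => //; exact: cmeasurable_cst.
have [mb mQ] := (measurable_hbox b, measurable_hbox Q).
have cov : hbox b `<=` (hbox Q `&` lvl (a * t) (fun x => h x - frozen g Q)) `|`
    (hbox b `&` lvl (a * t) (fun x => h x - frozen g b)).
  move=> x bx; have [l1|l1] := ltP (a * t) (cabs (h x - frozen g Q)).
    by left; split=> //; exact: kid_sub bx.
  right; split; [exact: bx|rewrite /lvl /= ltNge; apply/negP => l2].
  have := cabsB (h x - frozen g Q) (h x - frozen g b).
  rewrite (_ : _ - _ - (_ - _) = frozen g b - frozen g Q); last by ring.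
  by move=> tri; move: big; rewrite mulr_natl mulr2n ltNge (le_trans tri (lerD l1 l2)).
have : (mu (hbox b) <= (e * Q.2 ^+ n)%:E + (e * b.2 ^+ n)%:E)%E.
  apply: (le_trans (le_measure mu _ _ cov)); rewrite ?inE//.
    by apply: measurableU; exact: measurableI.
  apply: (le_trans (measureU2 _ _ _)); try exact: measurableI.
  exact: leeD.
have -> : Q.2 = 2 * b.2 by rewrite /=; field.
rewrite (mu_hbox (ltW b0)) -EFinD lee_fin [(2 * b.2) ^+ n]exprMn.
have bn0 : 0 < b.2 ^+ n by rewrite exprn_gt0.
rewrite mulrA -mulrDl -{2}[e]mulr1 -mulrDr [2 ^+ n + 1]addrC.
by rewrite leNgt gtr_pMl// e1.
Qed.

(* Descend from [Q] through the good dyadic subcubes until [frozen g] exceeds a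
   level between [be * s] and [s]. The oscillation estimate shows that on at least
   half of a stopping cube |h| lies between [be * s] and [s], and [A_infty] turns
   this into the factor [eta < 1]. Cubes that never stop contain few points where
   |h| > s. *)
Lemma good_lambda : exists C be eta : R, [/\ 0 < C, 0 < be < 1, 0 <= eta, eta < be `^ p &
  forall g h Q W s, ext T2 (2 * C1) g h -> 0 < Q.2 -> frozen g Q = 0 ->
    (Lpw p v g setT <= W%:E)%E -> 0 < s ->
    (dens mu_ (hbox Q `&` lvl s h) <=
     (C * (W / s `^ p))%:E + eta%:E * dens mu_ (hbox Q `&` lvl (be * s) h))%E].
Proof.
have p0 : 0 < p by rewrite (lt_trans ltr01).
have h20 : 0 < 2^-1 :> R by rewrite invr_gt0.
have [Cu Cu0 Hu] := Ainfty_proportion mu_ n0 wu Au h20.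
(* On a stopping cube let Y be the part where |h| is between the levels. Then u(E') <= Cu u(Y) and
   u(E) + u(Y) <= u(E') for the parts of [E], [E'] in the cube, whence u(E) <= eta u(E'). *)
pose eta := Cu / (1 + Cu); have Cu1 : 0 < 1 + Cu by rewrite addr_gt0.
have eta0 : 0 < eta by rewrite divr_gt0.
have eta1 : eta < 1 by rewrite /eta ltr_pdivrMr// mul1r ltrDr ltr01.
(* Chosen so that be^p = (1 + eta)/2 lies strictly between eta and 1. *)
pose be := ((1 + eta) / 2) `^ p^-1.
have beE : be `^ p = (1 + eta) / 2.
  by rewrite /be -powRrM mulVf ?gt_eqF// powRr1//; lra.
have be0 : 0 < be by rewrite powR_gt0//; lra.
have be1 : be < 1.
  rewrite ltNge; apply/negP => h; have : (1 : R) `^ p <= be `^ p.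
    by apply: ge0_ler_powR; rewrite ?nnegrE// ltW.
  by rewrite powR1 beE; lra.
(* Small enough for [frozen_near], and at most 1/2, so that exceptional sets fill at most half of a
   cube. *)
pose e : R := 4^-1 / (1 + 2 ^+ n).
have e2 : 0 < 1 + 2 ^+ n :> R by rewrite addr_gt0// exprn_gt0.
have e0 : 0 < e by rewrite divr_gt0// invr_gt0.
have e1 : e * (1 + 2 ^+ n) < 1 by rewrite /e divfK ?gt_eqF// invf_lt1// ltr1n.
have e3 : e <= 2^-1.
  have : e <= e * (1 + 2 ^+ n) by rewrite ler_peMr ?(ltW e0)// lerDl exprn_ge0.
  by rewrite /e divfK ?gt_eqF//; lra.
have [a a0 Ha] := oscillation cz e0.
have [Cm Cm0 Hm] := bad_boxes n0 p1 wu Au mv Cb0 H2.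
(* With t = ga s the oscillation bound a t is (1 - be) s / 6, the unit in [between_levels]. *)
pose ga := (1 - be) / (6 * a); have ga0 : 0 < ga by rewrite divr_gt0 ?subr_gt0 ?mulr_gt0.
exists (Cm / ga `^ p), be, eta; split => //.
- by rewrite divr_gt0 ?powR_gt0.
- by rewrite be0.
- exact: ltW.
- by rewrite beE; lra.
move=> g h Q W s eg Q0 fQ gW s0; have [[mg gi] mh _] := eg.
pose t := ga * s; have t0 : 0 < t by exact: mulr_gt0.
have at_ : a * t = (1 - be) * s / 6 by rewrite /t /ga; field; rewrite gt_eqF.
have at0 : 0 < a * t by exact: mulr_gt0.
pose E := lvl s h; pose E' := lvl (be * s) h.
have mE : measurable E by exact: measurable_lvl.
have mE' : measurable E' by exact: measurable_lvl.
pose lam := (1 + be) / 2 * s.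
pose low b := cabs (frozen g b) <= lam; pose bad b := ~ good t g b.
have osc b : 0 < b.2 -> ~ bad b -> (mu (hbox b `&` lvl (a * t) (fun x => (h x - frozen g b)%R))
    <= (e * b.2 ^+ n)%:E)%E.
  by move=> b0 /contrapT gb; apply: Ha.
have s1 : 0 < (1 - be) * s by rewrite mulr_gt0// subr_gt0.
have mX b : measurable (hbox b `&` lvl (a * t) (fun x => h x - frozen g b)).
  apply: measurableI; first exact: measurable_hbox.
  by apply: measurable_lvl; apply: cmeasurableB => //; exact: cmeasurable_cst.
have sparse b : 0 < b.2 -> low b -> ~ bad b -> (mu (hbox b `&` E) <= (2^-1 * b.2 ^+ n)%:E)%E.
  move=> b0 lb gb; apply: (@le_trans _ _ (e * b.2 ^+ n)%:E); last first.
    by rewrite lee_fin ler_wpM2r// exprn_ge0// ltW.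
  apply: le_trans (osc b b0 gb); apply: le_measure; rewrite ?inE//.
    by apply: measurableI => //; exact: measurable_hbox.
  move=> x [bx]; rewrite /E /lvl /= => hx; split=> //=.
  have := cabsD (h x - frozen g b) (frozen g b); rewrite subrK.
  by move=> tri; rewrite at_; exact: above_frozen s1 tri lb hx.
have stop P k : 0 < P.2 -> low P -> ~ bad P -> ~ low (kid P k) -> ~ bad (kid P k) ->
    (dens mu_ (hbox (kid P k) `&` E) <= eta%:E * dens mu_ (hbox (kid P k) `&` E'))%E.
  move=> P0 lP gP /negP; rewrite -ltNge; set b := kid P k => lb gb.
  have b0 : 0 < b.2 by rewrite /= divr_gt0.
  have near : cabs (frozen g b - frozen g P) <= 2 * (a * t).
    by apply: (frozen_near P0 e1 (osc _ P0 gP) (osc _ b0 gb) mh).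
  pose X := hbox b `&` lvl (a * t) (fun x => h x - frozen g b).
  have mb := measurable_hbox b; have mXb : measurable X by exact: mX.
  have mY : measurable (hbox b `\` X) by exact: measurableD.
  have Y1 x : (hbox b `\` X) x -> E' x /\ ~ E x.
    move=> [bx nX]; have hx : cabs (h x - frozen g b) <= a * t.
      by rewrite leNgt; apply/negP => lt; apply: nX.
    have t1 := cabsD (h x - frozen g b) (frozen g b); rewrite subrK in t1.
    have t2 := cabsD (frozen g b - h x) (h x); rewrite subrK cabsBC in t2.
    have t3 := cabsD (frozen g b - frozen g P) (frozen g P); rewrite subrK -lerBlDr in t3.
    rewrite at_ in hx; have t4 := le_trans t3 near; rewrite at_ in t4.
    exact: between_levels s1 hx lP lb t4 t1 t2.
  have bfin : (mu (hbox b) < +oo)%E by rewrite (mu_hbox (ltW b0)) ltry.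
  have muY : ((2^-1 * b.2 ^+ n)%:E <= mu (hbox b `\` X))%E.
    have c1 : (mu (hbox b) <= mu (hbox b `\` X) + (e * b.2 ^+ n)%:E)%E.
      apply: (@le_trans _ _ (mu (hbox b `\` X) + mu X)%E).
        apply: le_trans (measureU2 _ _ _); rewrite ?inE//.
        apply: le_measure; rewrite ?inE//; first exact: measurableU.
        by move=> x bx; have [Xx|nX] := pselect (X x); [right|left].
      by apply: leeD => //; exact: osc.
    rewrite (mu_hbox (ltW b0)) -leeBlDr// -EFinB in c1; apply: le_trans c1.
    rewrite lee_fin; have bn0 : 0 < b.2 ^+ n by rewrite exprn_gt0.
    have : e * b.2 ^+ n <= 2^-1 * b.2 ^+ n by rewrite ler_pM2r.
    by set z := b.2 ^+ n; lra.
  have Ysub : hbox b `\` X `<=` cube b.1 b.2 by move=> x [/hbox_cube].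
  have Hc := Hu b.1 b.2 _ b0 mY Ysub muY.
  have mbE := measurableI _ _ mb mE; have mbE' := measurableI _ _ mb mE'.
  have fin S : measurable S -> S `<=` hbox b -> exists2 w : R, 0 <= w & dens mu_ S = w%:E.
    move=> mS Sb; exists (fine (dens mu_ S)); first by rewrite fine_ge0.
    rewrite fineK// ge0_fin_numE//; apply: le_lt_trans (cube_fin mu_ b.1 b.2 wu).
    apply: le_measure; rewrite ?inE//; first exact: measurable_cube.
    exact: subset_trans Sb (@hbox_cube _ _ b).
  have [wE wE0 WE] := fin _ mbE (@subIsetl _ _ _).
  have [wE' wE'0 WE'] := fin _ mbE' (@subIsetl _ _ _).
  have [wY wY0 WY] := fin _ mY (@subDsetl _ _ _).
  have i1 : wE' <= Cu * wY.
    rewrite -lee_fin EFinM -WE' -WY; apply: le_trans Hc; apply: le_measure; rewrite ?inE//.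
      exact: measurable_cube.
    by move=> x [/hbox_cube].
  have i2 : wE + wY <= wE'.
    rewrite -lee_fin EFinD -WE' -WE -WY.
    have disj : (hbox b `&` E) `&` (hbox b `\` X) = set0.
      by apply/seteqP; split => // x [[_ Ex] /Y1[_]].
    rewrite -(measureU (dens mu_) mbE mY disj).
    apply: le_measure; rewrite ?inE//; first exact: measurableU.
    move=> x [[bx Ex]|Yx]; split=> //; last 2 first.
    - by case: Yx.
    - by have [] := Y1 _ Yx.
    move: Ex; rewrite /E /E' /lvl /=; apply: le_lt_trans.
    by rewrite ler_piMl// ltW.
  rewrite WE WE' -EFinM lee_fin /eta mulrAC ler_pdivlMr//.
  have := ler_wpM2l (ltW Cu0) i2; move: i1; rewrite !mulrDr mulr1; lra.
have gap : Cm * (W / t `^ p) = Cm / ga `^ p * (W / s `^ p).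
  rewrite /t powRM ?(ltW ga0) ?(ltW s0)//.
  by field; rewrite !gt_eqF// powR_gt0.
have mQ := measurable_hbox Q; rewrite -/E -/E' -gap.
have mQE := measurableI _ _ mQ mE.
(* If the root itself is bad, the maximal function term alone covers it. *)
have [bQ|gQ] := pselect (bad Q).
  apply: (@le_trans _ _ (Cm * (W / t `^ p))%:E); last by rewrite leeDl// mule_ge0// lee_fin ltW.
  apply: le_trans (Hm g [:: Q] t W t0 mg gW _); last first.
    by move=> b; rewrite inE => /eqP ->.
  apply: le_measure; rewrite ?inE//.
    by apply: fin_bigcup_measurable => // b _; exact: measurable_hbox.
  by move=> x [Qx _]; exists Q => //=; rewrite inE.
(* For a given error only [k0] generations are needed, so the list of bad cubes is finite, as
   [bad_boxes] requires; its bound does not depend on [k0]. *)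
apply/lee_addgt0Pr => e' e'0.
have [k0 Hk] := sparse_small mu_ wu Q0 mE e'0.
pose L := [seq b <- flatten [seq gen Q k | k <- iota 0 k0.+1] | `[< bad b >]].
pose B := \bigcup_(b in [set` L]) hbox b.
have mB : measurable B by apply: fin_bigcup_measurable => // b _; exact: measurable_hbox.
have lQ : low Q by rewrite /low fQ cabs0 /lam mulr_ge0 ?(ltW s0)// divr_ge0// addr_ge0// ltW.
have HB k b : (k <= k0)%N -> b \in gen Q k -> bad b -> hbox b `<=` B.
  move=> kk bk bb x bx; exists b => //=; rewrite mem_filter; apply/andP; split; first exact/asboolP.
  by apply/flatten_mapP; exists k => //; rewrite mem_iota.
have Bb : (dens mu_ B <= (Cm * (W / t `^ p))%:E)%E.
  apply: (Hm g L t W t0 mg gW) => b; rewrite mem_filter => /andP[/asboolP bb /flatten_mapP[k _ bk]].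
  by split=> //; exact: gen_side_gt0 bk.
have tree := stopping_tree mE mE' mB (ltW eta0) stop Q0 lQ gQ HB.
have mQEB : measurable (hbox Q `&` (E `\` B)).
  by apply: measurableI => //; exact: measurableD.
apply: (@le_trans _ _ (dens mu_ B + dens mu_ (hbox Q `&` (E `\` B)))%E).
  apply: le_trans (measureU2 _ _ _) => //.
  apply: le_measure; rewrite ?inE//; first exact: measurableU.
  by move=> x [Qx Ex]; have [Bx|nB] := pselect (B x); [left|right].
rewrite -[leRHS]addeA; apply: leeD; first exact: Bb.
apply: (le_trans tree); apply: leeD => //.
apply: Hk => // b bk /asboolP[lb gb]; apply: sparse => //; exact: gen_side_gt0 bk.
Qed.

End good_lambda.

Section two_weight_weak_bound.
Context {R : realType} {n : nat}.
Local Notation Rn := 'rV[R]_n.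
Local Notation mu := (lebesgue_rV R n).
Implicit Types (f g h : Rn -> R[i]) (x y c : Rn) (S : set Rn) (b Q : box R n) (r s t : R).

Context {A CK Sth : R} {theta : R -> R} {T2 : (Rn -> R[i]) -> Rn -> R[i]}
  {K : Rn -> Rn -> R[i]}.
Hypothesis cz : cz_operator A CK Sth theta T2 K.

Local Notation C1 := (@C11 R n A CK Sth).
Local Notation frozen := (@frozen R n K).

Context (p Cb : R) (u v : Rn -> R).
Hypotheses (p1 : 1 < p) (wu : weight u) (Au : A_infty u) (mu_ : measurable_fun setT u)
  (mv : measurable_fun setT v) (Cb0 : 0 < Cb) (H2 : two_weight p mu_ v Cb).

(** After N iterations the remainder is q^N phi(be^N s), at most q^N s^p D by the a priori bound and
    be <= 1; it tends to 0. *)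
Lemma geometric_iteration (phi : R -> R) (q B D be s : R) : 0 <= q -> q < 1 -> 0 <= D ->
  0 < be -> be <= 1 -> (forall s, 0 < s -> phi s <= s `^ p * D) ->
  (forall s, 0 < s -> phi s <= B + q * phi (be * s)) -> 0 <= B -> 0 < s -> phi s <= B / (1 - q).
Proof.
move=> q0 q1 D0 be0 be1 h0 h1 B0 s0.
have q1' : 0 < 1 - q by rewrite subr_gt0.
have it N : forall s, 0 < s -> phi s <= B / (1 - q) + q ^+ N * (s `^ p * D).
  elim: N => [|N IH] s' s'0.
    by rewrite expr0 mul1r; apply: (le_trans (h0 _ s'0)); rewrite lerDr divr_ge0// ltW.
  apply: (le_trans (h1 _ s'0)); have bs : 0 < be * s' by rewrite mulr_gt0.
  have E : B / (1 - q) = B + q * (B / (1 - q)) by field; rewrite gt_eqF.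
  rewrite {1}E -addrA lerD2l exprS -mulrA -mulrDr; apply: ler_wpM2l => //.
  apply: (le_trans (IH _ bs)); rewrite lerD2l; apply: ler_wpM2l; first exact: exprn_ge0.
  apply: ler_wpM2r => //; apply: ge0_ler_powR; rewrite ?nnegrE; [| | |]; try exact: ltW.
    by rewrite ltW// (lt_trans ltr01).
  by rewrite ler_piMl// ltW.
apply/ler_addgt0Pr => e e0.
have := cvg_geometric (s `^ p * D) (_ : `|q| < 1); rewrite ger0_norm// => /(_ q1) cv.
have := (cvgrPdist_lt _ _).1 cv _ e0 => -[N _ HN].
have := HN N (leqnn N); rewrite /= sub0r normrN /geometric /= => lt.
apply: (le_trans (it N _ s0)); rewrite lerD2l mulrC; apply/ltW; exact: le_lt_trans (ler_norm _) lt.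
Qed.

Lemma two_weight_weak : exists2 C : R, 0 < C & forall g h Q W s, ext T2 (2 * C1) g h ->
    0 < Q.2 -> frozen g Q = 0 -> (Lpw p v g setT <= W%:E)%E -> 0 < s ->
    (dens mu_ (hbox Q `&` lvl s h) <= (C * (W / s `^ p))%:E)%E.
Proof.
have [C [be [eta [C0 /andP[be0 be1] eta0 etab H]]]] := good_lambda cz p1 wu Au mv Cb0 H2.
have bp0 : 0 < be `^ p by exact: powR_gt0.
(* The good-lambda inequality is multiplied by s^p; since s^p = (be s)^p / be^p, its factor eta
   becomes q < 1. The a priori bound is finite because u(Q) is. *)
pose q := eta / be `^ p; have q0 : 0 <= q by rewrite divr_ge0// ltW.
have q1 : q < 1 by rewrite /q ltr_pdivrMr// mul1r.
exists (C / (1 - q)); first by rewrite divr_gt0// subr_gt0.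
move=> g h Q W s eg Q0 fQ gW s0; have [_ mh _] := eg.
have W0 : 0 <= W.
  rewrite -lee_fin; apply: le_trans gW; apply: integral_ge0 => x _.
  by rewrite lee_fin mulr_ge0 ?powR_ge0// pospart_ge0.
have mQ := measurable_hbox Q.
have sub (S : set Rn) : measurable S -> (dens mu_ (hbox Q `&` S) <= dens mu_ (cube Q.1 Q.2))%E.
  move=> mS; apply: le_measure; rewrite ?inE; [exact: measurableI|exact: measurable_cube|].
  by move=> x [/hbox_cube].
have fin t : dens mu_ (hbox Q `&` lvl t h) = (fine (dens mu_ (hbox Q `&` lvl t h)))%:E.
  rewrite fineK// ge0_fin_numE//; apply: le_lt_trans (cube_fin mu_ Q.1 Q.2 wu).
  by apply: sub; exact: measurable_lvl.
pose phi t := t `^ p * fine (dens mu_ (hbox Q `&` lvl t h)).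
have := @geometric_iteration phi q (C * W) (wcube mu_ Q.1 Q.2) be s q0 q1.
move=> /(_ _ be0 (ltW be1) _ _ _ s0) it.
rewrite fin lee_fin.
have sp0 : 0 < s `^ p by exact: powR_gt0.
have -> : C / (1 - q) * (W / s `^ p) = (C * W / (1 - q)) / s `^ p by field; rewrite !gt_eqF// subr_gt0.
rewrite ler_pdivlMr// mulrC; apply: it.
- exact/ltW/wcube_gt0.
- move=> t t0; apply: ler_wpM2l; first exact: powR_ge0.
  by rewrite -lee_fin -fin -wcubeE//; apply: sub; exact: measurable_lvl.
- move=> t t0; have := H g h Q W t eg Q0 fQ gW t0; rewrite (fin t) (fin (be * t)) -EFinM -EFinD lee_fin => h1.
  have tp0 : 0 < t `^ p by exact: powR_gt0.
  rewrite /phi powRM ?(ltW be0) ?(ltW t0)//.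
  apply: (le_trans (ler_wpM2l (ltW tp0) h1)); rewrite le_eqVlt; apply/orP; left; apply/eqP.
  by rewrite /q; field; rewrite !gt_eqF.
- exact: mulr_ge0 (ltW C0) W0.
Qed.

End two_weight_weak_bound.

(** * Morrey spaces *)

Section growth.
Context {R : realType}.

Lemma powRVl (t z : R) : 0 <= t -> t^-1 `^ z = (t `^ z)^-1.
Proof. by move=> t0; rewrite -(powR_inv1 t0) -powRrM mulN1r powRN. Qed.

Lemma powR_exprn (t a : R) k : 0 <= t -> (t `^ a) ^+ k = (t ^+ k) `^ a.
Proof.
move=> t0; elim: k => [|k IH]; first by rewrite !expr0 powR1.
by rewrite !exprS powRM ?exprn_ge0// IH.
Qed.

(** The condition rewritten as decay of psi(t)/t in the ratio s/t. The case s = t is not covered by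
    the condition and accounts for the maximum with 1. *)
Lemma D_cond_ratio (kappa : R) (psi : R -> R) : kappa < 1 -> D_cond kappa psi ->
  exists2 C : R, 0 < C & forall s t : R, 0 < s -> s <= t ->
    psi t / t <= C * (psi s / s * (s / t) `^ (1 - kappa)).
Proof.
move=> k1 [psi0 psile [C C0 H]]; exists (Num.max C 1); first by rewrite lt_max ltr01 orbT.
move=> s t s0 st; have t0 := lt_le_trans s0 st.
have [->|ts] := eqVneq s t.
  by rewrite divff ?gt_eqF// powR1 mulr1 ler_peMl ?le_max ?lexx ?orbT// divr_ge0 ?ltW ?psi0.
have {ts}st' : s < t by rewrite lt_neqAle ts.
have pos (z : R) : 0 < z -> z `^ (1 - kappa) = z / z `^ kappa.
  move=> z0; rewrite powRD; last by apply/implyP => _; rewrite gt_eqF.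
  by rewrite powRr1 ?(ltW z0)// powRN.
have [sk tk] := (powR_gt0 kappa s0, powR_gt0 kappa t0).
have e1 : psi s / s * (s / t) `^ (1 - kappa) = psi s / s `^ kappa * (t `^ kappa / t).
  rewrite powRM ?invr_ge0 ?(ltW s0) ?(ltW t0)// pos//.
  have -> : t^-1 `^ (1 - kappa) = t `^ kappa / t.
    by rewrite powRVl ?(ltW t0)// pos// invf_div.
  by field; rewrite !gt_eqF.
rewrite e1 mulrA; have := H s t s0 st' => h.
have e2 : psi t / t = psi t / t `^ kappa * (t `^ kappa / t) by field; rewrite !gt_eqF.
rewrite e2; apply: ler_wpM2r; first by rewrite divr_ge0// ltW.
apply: (le_trans h); apply: ler_wpM2r; last by rewrite le_max lexx.
by rewrite divr_ge0// ltW// psi0.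
Qed.

Lemma D_cond_doubling (kappa : R) (psi : R -> R) (L : R) : 1 < L -> D_cond kappa psi ->
  exists2 C : R, 0 < C & forall s : R, 0 < s -> psi (L * s) <= C * psi s.
Proof.
move=> L1 [psi0 psile [C C0 H]]; have L0 : 0 < L by exact: lt_trans L1.
exists (C * L `^ kappa); first by rewrite mulr_gt0// powR_gt0.
move=> s s0; have sL : s < L * s by rewrite ltr_pMl.
have := H s (L * s) s0 sL.
rewrite powRM ?(ltW L0) ?(ltW s0)//.
have [sk tk] := (powR_gt0 kappa s0, powR_gt0 kappa L0).
rewrite ler_pdivrMr ?mulr_gt0// => h; apply: (le_trans h).
by rewrite le_eqVlt; apply/orP; left; apply/eqP; field; rewrite !gt_eqF.
Qed.

Lemma geometric_sum_le (q : R) N : 0 <= q -> q < 1 -> \sum_(k < N) q ^+ k <= (1 - q)^-1.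
Proof.
move=> q0 q1; have p : 0 < 1 - q by rewrite subr_gt0.
rewrite -[leRHS]mul1r ler_pdivlMr// mulrC -[1 - q]opprB mulNr -subrX1 opprB.
by rewrite gerBl exprn_ge0.
Qed.

End growth.

Section morrey_decay.
Context {R : realType} {n : nat}.
Local Notation Rn := 'rV[R]_n.
Local Notation mu := (lebesgue_rV R n).
Implicit Types (f g h : Rn -> R[i]) (x y c : Rn) (r s t l : R).
Context (p Cb kappa : R) (u v : Rn -> R) (psi : R -> R).
Hypotheses (n0 : (0 < n)%N) (p1 : 1 < p) (wu : weight u) (wv : weight v) (Au : A_infty u)
  (mu_ : measurable_fun setT u) (Cb0 : 0 < Cb) (H2 : two_weight p mu_ v Cb)
  (k1 : kappa < 1) (Hpsi : D_cond kappa psi).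

Let p0 : 0 < p. Proof. by rewrite (lt_trans ltr01). Qed.

Let psi0 t : 0 < t -> 0 < psi t. Proof. by move: t; have [] := Hpsi. Qed.

Lemma morrey_cube f c l : morrey p psi v u f -> 0 < l ->
  (Lpw p v f (cube c l) <= (fine (morrey_norm p psi v u f) `^ p * psi (wcube mu_ c l))%:E)%E.
Proof.
move=> [mf _ fin] l0; have [_ _ u0] := wu; have [mv _ v0] := wv.
have mQ := measurable_cube c l.
set N := morrey_norm p psi v u f in fin *.
have LE : Lpw p v f (cube c l) = (\int[mu]_(x in cube c l) (cabs (f x) `^ p * v x)%:E)%E.
  have mfp : measurable_fun setT (fun x => cabs (f x) `^ p).
    by apply: (measurableT_comp (@measurable_powR R p)); exact: measurable_cabs.
  apply: ae_eq_integral => //.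
  - apply/measurable_EFinP/measurable_funTS; apply: measurable_funM => //.
    exact: measurable_pospart.
  - by apply/measurable_EFinP/measurable_funTS; apply: measurable_funM.
  - by apply: filterS v0 => x v0 _; rewrite /pospart max_l ?ltW.
have ps := psi0 (wcube_gt0 mu_ c wu l0); set P := psi _ in ps *.
set X := Lpw _ _ _ _ in LE *.
have X0 : (0 <= X)%E.
  by apply: integral_ge0 => x _; rewrite lee_fin mulr_ge0 ?powR_ge0 ?pospart_ge0.
have le : ((P^-1%:E * X) `^ p^-1 <= N)%E.
  apply: ereal_sup_ubound; exists c, l; split => //.
  by rewrite /wmeas (wmeasE mu_ u0 mQ) LE.
have Y0 : (0 <= P^-1%:E * X)%E by rewrite mule_ge0// lee_fin invr_ge0 ltW.
have N0 : (0 <= N)%E by apply: le_trans le; exact: poweR_ge0.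
have NE : N = (fine N)%:E by rewrite fineK// ge0_fin_numE.
have X1 : exists2 z : R, 0 <= z & X = z%:E.
  move: le X0; clear LE Y0; case: X => [z| |] //; first by exists z.
  rewrite gt0_muley ?lte_fin ?invr_gt0// poweRyr ?invr_eq0 ?gt_eqF//.
  by rewrite NE leye_eq.
have [z z0 XE] := X1; rewrite XE lee_fin.
move: le; rewrite XE NE -EFinM poweR_EFin lee_fin => h.
have a0 : 0 <= P^-1 * z by rewrite mulr_ge0// invr_ge0 ltW.
have := ge0_ler_powR (ltW p0) (powR_ge0 _ _) (fine_ge0 N0) h.
by rewrite -powRrM mulVf ?gt_eqF// powRr1// mulrC ler_pdivrMr.
Qed.

Local Notation nrm f := (fine (morrey_norm p psi v u f)).

Lemma morrey_norm_ge0 f : morrey p psi v u f -> 0 <= nrm f.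
Proof.
move=> [_ _ fin]; apply: fine_ge0; apply: le_trans (ereal_sup_ubound _); last first.
  by exists 0, 1; split.
exact: poweR_ge0.
Qed.

(* The average of [f] over [cube c l] is at most a multiple of this. *)
Definition profile f c l := nrm f * (psi (wcube mu_ c l) / wcube mu_ c l) `^ p^-1.

Lemma profile_ge0 f c l : morrey p psi v u f -> 0 <= profile f c l.
Proof. by move=> mf; rewrite mulr_ge0 ?powR_ge0// morrey_norm_ge0. Qed.

Lemma morrey_average f c l : morrey p psi v u f -> 0 < l ->
  (L1n (cube c l) f <= (Cb * l ^+ n * profile f c l)%:E)%E.
Proof.
move=> mof l0; have [mf _ _] := mof.
have := H2 l0 (measurable_cabs mf) (fun x => cabs_ge0 (f x)) (morrey_cube c mof l0).
have q0 : 0 <= psi (wcube mu_ c l) / wcube mu_ c l.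
  by rewrite divr_ge0 ?ltW ?psi0// wcube_gt0.
have n0' := morrey_norm_ge0 mof.
rewrite -[_ * psi _ / _]mulrA powRM ?powR_ge0// -powRrM divff ?gt_eqF// powRr1//.
Qed.

(** Reverse doubling gives w(Q) <= t^k w(2^k Q), and [D_cond_ratio] turns this ratio into a power.
    The exponent (1 - kappa)/p is positive, so q = t^((1 - kappa)/p) < 1. *)
Lemma profile_decay : exists C q : R, [/\ 0 < C, 0 <= q < 1 & forall f c l k,
  morrey p psi v u f -> 0 < l -> profile f c (2 ^+ k * l) <= C * profile f c l * q ^+ k].
Proof.
have [t /andP[t0 t1] Ht] := reverse_doubling mu_ n0 wu Au.
have [C C0 HC] := D_cond_ratio k1 Hpsi.
pose a := (1 - kappa) * p^-1; have a0 : 0 < a by rewrite mulr_gt0 ?subr_gt0 ?invr_gt0.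
exists (C `^ p^-1), (t `^ a); split; first exact: powR_gt0.
  rewrite powR_ge0/=; suff : t `^ a < 1 `^ a by rewrite powR1.
  by apply: gt0_ltr_powR => //; rewrite ?nnegrE//; exact: ltW.
move=> f c l k mof l0; rewrite /profile.
have wk j : wcube mu_ c l <= t ^+ j * wcube mu_ c (2 ^+ j * l).
  elim: j => [|j IH]; first by rewrite !expr0 !mul1r.
  apply: (le_trans IH); rewrite exprSr -mulrA; apply: ler_wpM2l; first by rewrite exprn_ge0// ltW.
  by rewrite exprS -mulrA; apply: Ht; rewrite mulr_gt0// exprn_gt0.
have lk : 0 < 2 ^+ k * l by rewrite mulr_gt0// exprn_gt0.
have [w0 w1] := (wcube_gt0 mu_ c wu l0, wcube_gt0 mu_ c wu lk).
have le : wcube mu_ c l <= wcube mu_ c (2 ^+ k * l).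
  by apply: (le_trans (wk k)); rewrite ler_piMl ?(ltW w1)// exprn_ile1// ltW.
set w := wcube mu_ c l in w0 le wk *; set w' := wcube mu_ c (2 ^+ k * l) in w1 le *.
have b0 : 0 <= psi w / w by rewrite divr_ge0 ?(ltW w0)// ltW// psi0.
have b1 : 0 <= psi w' / w' by rewrite divr_ge0 ?(ltW w1)// ltW// psi0.
pose Y := (t ^+ k) `^ (1 - kappa); have Y0 : 0 <= Y by exact: powR_ge0.
have key : psi w' / w' <= C * (psi w / w * Y).
  apply: (le_trans (HC _ _ w0 le)); apply: ler_wpM2l; first exact: ltW.
  apply: ler_wpM2l => //; apply: ge0_ler_powR.
  - by rewrite subr_ge0 ltW.
  - by rewrite nnegrE divr_ge0// ltW.
  - by rewrite nnegrE exprn_ge0// ltW.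
  - by rewrite ler_pdivrMr//; exact: (wk k).
have bY0 : 0 <= psi w / w * Y by exact: mulr_ge0.
have ip0 : 0 <= p^-1 by rewrite invr_ge0 ltW.
have := ge0_ler_powR ip0 b1 (mulr_ge0 (ltW C0) bY0) key.
rewrite (powRM _ (ltW C0) bY0) (powRM _ b0 Y0) => /(ler_wpM2l (morrey_norm_ge0 mof)) h.
apply: (le_trans h); rewrite le_eqVlt; apply/orP; left; apply/eqP.
have -> : (t `^ a) ^+ k = Y `^ p^-1.
  by rewrite powR_exprn ?(ltW t0)// /a powRrM.
ring.
Qed.

End morrey_decay.

Section morrey_bounds.
Context {R : realType} {n : nat}.
Local Notation Rn := 'rV[R]_n.
Local Notation mu := (lebesgue_rV R n).
Implicit Types (f g h F : Rn -> R[i]) (x y c : Rn) (S D : set Rn) (r s t l : R).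

Lemma cintegral_restr (k : Rn -> R[i]) f D :
  cintegral D (fun y => k y * f y) = cintegral setT (fun y => k y * restr D f y).
Proof.
rewrite /cintegral; congr Complex; rewrite Rintegral_mkcond; apply: eq_Rintegral => y _;
  rewrite patchE; case: ifPn => [|/negP] yD.
- by rewrite restr_in//; rewrite inE in yD.
- by rewrite restr_out ?mulr0// => Dy; apply: yD; rewrite inE.
- by rewrite restr_in//; rewrite inE in yD.
- by rewrite restr_out ?mulr0// => Dy; apply: yD; rewrite inE.
Qed.

Lemma cintegrable_restr (k : Rn -> R[i]) f D : measurable D ->
  cintegrable setT (fun y => k y * restr D f y) -> cintegrable D (fun y => k y * f y).
Proof.
move=> mD [i1 i2]; split; apply/(integrable_mkcond _ mD).
- move: i1; congr integrable; apply/funext => y; rewrite patchE; case: ifPn => [|/negP] yD.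
    by rewrite restr_in//; rewrite inE in yD.
  by rewrite restr_out ?mulr0// => Dy; apply: yD; rewrite inE.
- move: i2; congr integrable; apply/funext => y; rewrite patchE; case: ifPn => [|/negP] yD.
    by rewrite restr_in//; rewrite inE in yD.
  by rewrite restr_out ?mulr0// => Dy; apply: yD; rewrite inE.
Qed.

Lemma dens_ae_le u (mu_ : measurable_fun setT u) S D : measurable S -> measurable D ->
  {ae mu, forall x, S x -> D x} -> (dens mu_ S <= dens mu_ D)%E.
Proof.
move=> mS mD SD; rewrite /dens [leLHS]integral_mkcond [leRHS]integral_mkcond.
have mp := measurable_pospart mu_.
apply: ae_ge0_le_integral => //.
- by move=> x _; rewrite patchE; case: ifP => // _; rewrite lee_fin pospart_ge0.
- by apply/(measurable_restrictT _ mS)/measurable_EFinP; exact: measurable_funTS.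
- by move=> x _; rewrite patchE; case: ifP => // _; rewrite lee_fin pospart_ge0.
- by apply/(measurable_restrictT _ mD)/measurable_EFinP; exact: measurable_funTS.
- apply: filterS SD => x SD _; rewrite !patchE; case: ifPn => [|_].
    by rewrite inE => /SD Dx; rewrite mem_set.
  by case: ifP => // _; rewrite lee_fin pospart_ge0.
Qed.

Context {A CK Sth : R} {theta : R -> R} {T2 : (Rn -> R[i]) -> Rn -> R[i]}
  {K : Rn -> Rn -> R[i]}.
Hypothesis cz : cz_operator A CK Sth theta T2 K.

Local Notation C1 := (@C11 R n A CK Sth).
Local Notation frozen := (@frozen R n K).

Context (p Cb kappa : R) (u v : Rn -> R) (psi : R -> R).
Hypotheses (p1 : 1 < p) (wu : weight u) (wv : weight v) (Au : A_infty u)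
  (mu_ : measurable_fun setT u) (Cb0 : 0 < Cb) (H2 : two_weight p mu_ v Cb)
  (k1 : kappa < 1) (Hpsi : D_cond kappa psi).

Let n0 : (0 < n)%N. Proof. exact: cz_n cz. Qed.
Let p0 : 0 < p. Proof. by rewrite (lt_trans ltr01). Qed.

Local Notation morrey := (morrey p psi v u).
Local Notation nrm f := (fine (morrey_norm p psi v u f)).
Local Notation profile := (profile p v psi mu_).

Lemma morrey_cint f c l : morrey f -> 0 < l -> cint (restr (cube c l) f).
Proof.
move=> mof l0; have [mf _ _] := mof; have mQ := measurable_cube c l.
split; first exact: cmeasurable_restr.
rewrite L1n_restr//; apply: le_lt_trans (ltry _).
exact: (morrey_average p1 wu wv H2 Hpsi c mof l0).
Qed.

Definition outer f c l := restr (~` cube c (2 * l)) f.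

Lemma outer_far f c l x y : 0 < l -> cube c l x -> outer f c l y != 0 -> far (l / 2) x y.
Proof.
move=> l0 cx oy; have /notin_cube[i yi] : ~ cube c (2 * l) y.
  by move=> cy; move: oy; rewrite /outer restr_out ?eqxx// => /(_ cy).
exists i; have := cx i; have := ler_normD (y ord0 i - x ord0 i) (x ord0 i - c ord0 i).
rewrite addrA subrK (distrC (y ord0 i) (x ord0 i)); move: yi.
by rewrite (_ : 2 * l / 2 = l); [lra|field].
Qed.

Lemma measurable_outer f c l x : cmeasurable setT f -> 0 < l -> cube c l x ->
  cmeasurable setT (fun y => K x y * outer f c l y).
Proof.
move=> mf l0 cx; apply: (measurable_Kf cz).
  by apply: cmeasurable_restr => //; apply: measurableC; exact: measurable_cube.
apply: restr_out => /=; apply; apply: le_cube cx; lra.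
Qed.

(** On each annulus the kernel size times the integral of |f| is a multiple of the profile of the
    larger cube, and these profiles decay geometrically. The bound is uniform in [x]. *)
Lemma far_bound : exists2 C : R, 0 < C & forall f c l x, morrey f -> 0 < l -> cube c l x ->
  (L1n setT (fun y => (K x y * outer f c l y)%R) <= (C * profile f c l)%:E)%E.
Proof.
have [Cp [q [Cp0 /andP[q0 q1] Hp]]] := profile_decay v n0 p1 wu Au mu_ k1 Hpsi.
have q1' : 0 < 1 - q by rewrite subr_gt0.
have CK0 := cz_CK cz.
exists (CK * Cb * 8 ^+ n * Cp * (1 - q)^-1).
  by rewrite !mulr_gt0 ?exprn_gt0 ?invr_gt0.
move=> f c l x mof l0 cx; have [mf _ _] := mof.
have mD : measurable (~` cube c (2 * l)) by apply: measurableC; exact: measurable_cube.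
have mK := measurable_outer mf l0 cx.
rewrite (@L1n_supp _ _ _ (~` cube c (2 * l)))//; last first.
  by move=> y ny; rewrite /outer restr_out ?mulr0.
have P0 k : 0 <= profile f c (2 ^+ k.+2 * l) by exact: (profile_ge0 mu_ _ _ mof).
have pl0 : 0 <= profile f c l by exact: (profile_ge0 mu_ _ _ mof).
apply: (@annuli_integral _ _ c (2 * l) _ _ (fun y => cabs (f y))
  (fun k => CK * (2 ^+ k * l / 2) ^- n)
  (fun k => Cb * (2 ^+ k.+2 * l) ^+ n * profile f c (2 ^+ k.+2 * l))) => //.
- by rewrite mulr_gt0.
- by apply: measurable_funTS; exact: measurable_cabs.
- by move=> y _; exact: cabs_ge0.
- exact: measurable_cabs.
- by move=> y; exact: cabs_ge0.
- move=> k; apply: mulr_ge0; first exact: ltW.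
  by rewrite invr_ge0 exprn_ge0// divr_ge0// ltW// mulr_gt0// exprn_gt0.
- move=> k; apply: mulr_ge0; last exact: P0.
  apply: mulr_ge0; first exact: ltW.
  by rewrite exprn_ge0// ltW// mulr_gt0// exprn_gt0.
(* In some coordinate y is at least 2^k l from c, while x is within l/2 of c; so y is at least 2^k l
   / 2 from x. *)
- apply: aeW => y Dy k _ /notin_cube[i yi].
  have kl0 : 0 < 2 ^+ k * l / 2 by rewrite divr_gt0// mulr_gt0// exprn_gt0.
  rewrite cabsM; apply: ler_pM; rewrite ?cabs_ge0 ?cabs_restr//.
  apply: (K_far cz) => //; exists i; have := cx i.
  have := ler_normD (y ord0 i - x ord0 i) (x ord0 i - c ord0 i).
  rewrite addrA subrK (distrC (y ord0 i) (x ord0 i)).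
  have : l <= 2 ^+ k * l by rewrite ler_peMl ?(ltW l0)// exprn_ege1// ler1n.
  move: yi; rewrite mulrCA; lra.
- move=> k; rewrite (_ : 2 ^+ k.+1 * (2 * l) = 2 ^+ k.+2 * l); last by rewrite !exprS; ring.
  apply: (morrey_average p1 wu wv H2 Hpsi c mof).
  by rewrite mulr_gt0// exprn_gt0.
- move=> N; apply: (@le_trans _ _ (\sum_(k < N) CK * Cb * 8 ^+ n * Cp * profile f c l * q ^+ k)).
    (* The cube has side 8 times the distance X in the kernel bound, whence 8^n. *)
    apply: ler_sum => k _; set X := 2 ^+ k * l / 2; have X0 : X ^+ n != 0.
      by rewrite expf_neq0// gt_eqF// divr_gt0// mulr_gt0// exprn_gt0.
    have XE : 2 ^+ k.+2 * l = 8 * X by rewrite /X !exprS; field.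
    have qk : q ^+ k.+2 <= q ^+ k by apply: ler_wiXn2l; rewrite ?(ltW q1)// ltnW// ltnW.
    have c0 : 0 <= CK * Cb * 8 ^+ n by rewrite !mulr_ge0 ?exprn_ge0// ltW.
    have := Hp f c l k.+2 mof l0; set P := profile f c (2 ^+ k.+2 * l) => h.
    have -> : CK * X ^- n * (Cb * (2 ^+ k.+2 * l) ^+ n * P) = CK * Cb * 8 ^+ n * P.
      by rewrite XE (exprMn n 8 X); field.
    apply: (le_trans (ler_wpM2l c0 h)); move: c0; set c' := CK * Cb * 8 ^+ n => c0.
    rewrite -[c' * Cp * _]mulrA -[leRHS]mulrA; apply: ler_wpM2l => //.
    apply: ler_wpM2l => //; apply: mulr_ge0 => //; exact: ltW.
  rewrite -mulr_sumr [leRHS](_ : _ = CK * Cb * 8 ^+ n * Cp * profile f c l * (1 - q)^-1).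
    apply: ler_wpM2l; last exact: geometric_sum_le.
    apply: mulr_ge0 => //; apply: mulr_ge0; last exact: ltW.
    by rewrite !mulr_ge0 ?exprn_ge0// ltW.
  by rewrite mulrAC.
Qed.

(** [two_weight_weak] is applied on the half-open box of side 2l, which contains the closed cube of
    side l. *)
Lemma local_weak : exists2 C : R, 0 < C & forall f c l h s, morrey f -> 0 < l ->
  ext T2 (2 * C1) (restr (cube c (2 * l)) f) h -> 0 < s ->
  (dens mu_ (cube c l `&` lvl s h) <=
    (C * (nrm f `^ p * psi (wcube mu_ c (2 * l)) / s `^ p))%:E)%E.
Proof.
have [mv _ _] := wv.
have [C C0 H] := two_weight_weak cz p1 wu Au mv Cb0 H2; exists C => // f c l h s mof l0 eh s0.
have l20 : 0 < 2 * l by rewrite mulr_gt0.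
have [[mg _] mh _] := eh; pose g := restr (cube c (2 * l)) f.
(* The truncated function vanishes off the cube of side 2l, and the dilation removes that cube from
   the integral. *)
have fz : frozen g (c, 2 * l) = 0.
  have E y : K c y * (g y - restr (cube c (dil n * (2 * l))) g y) = 0.
    have [cy|ncy] := pselect (cube c (2 * l) y).
      rewrite restr_in ?subrr ?mulr0//; apply: le_cube cy.
      by rewrite ler_peMl ?dil_ge1// ltW.
    have g0 : g y = 0 by exact: restr_out.
    by rewrite /restr g0 mul0r subrr mulr0.
  rewrite /frozen /cintegral /=; congr Complex;
    by rewrite (_ : (fun _ => _) = cst 0) ?Rintegral_cst ?mul0r//; apply/funext => y; rewrite E.
have gW : (Lpw p v g setT <= (nrm f `^ p * psi (wcube mu_ c (2 * l)))%:E)%E.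
  apply: le_trans (morrey_cube p1 wu wv mu_ Hpsi c mof l20).
  rewrite /Lpw [leRHS]integral_mkcond le_eqVlt; apply/orP; left; apply/eqP.
  apply: eq_integral => y _; rewrite patchE; case: ifPn => [|/negP] yc.
    by rewrite /g restr_in//; rewrite inE in yc.
  rewrite /g restr_out ?cabs0 ?powR0 ?mul0r ?gt_eqF//.
  by move=> cy; apply: yc; rewrite inE.
apply: le_trans (H g h (c, 2 * l) _ s eh l20 fz gW s0).
apply: le_measure; rewrite ?inE.
- by apply: measurableI; [exact: measurable_cube|exact: measurable_lvl].
- by apply: measurableI; [exact: measurable_hbox|exact: measurable_lvl].
- move=> x [cx lx]; split=> // i /=; have := cx i.
  by rewrite ler_norml => /andP[? ?]; apply/andP; split; lra.
Qed.

(** Either the outer part is at most s/2, and |F| > s forces the local part above s/2; or s is so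
    small compared with the profile that the weight of the whole cube is bounded by the right-hand
    side. *)
Lemma value_weak : exists2 C : R, 0 < C & forall f F c r s, morrey f -> is_value T2 K f F ->
  0 < r -> 0 < s ->
  (dens mu_ (eball c r `&` lvl s F) <=
    (C * (nrm f `^ p * psi (fine (dens mu_ (eball c r))) / s `^ p))%:E)%E.
Proof.
have C10 := C11_ge0 cz; have C20 : 0 <= 2 * C1 by exact: mulr_ge0.
have [Cl Cl0 Hl] := local_weak; have [Cf Cf0 Hf] := far_bound.
have nR : 0 < n%:R :> R by rewrite ltr0n.
(* The cube of side r/n lies in the ball, and 4n times that side is 4r = 2l. Thus u(2Q) is bounded
   by the weight of the ball, and then psi by [D_cond_doubling]. *)
have [Cd Cd0 Hd] := doubling mu_ n0 wu Au (mulr_gt0 (ltr0n R 4) nR).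
pose L := Num.max Cd 2; have L1 : 1 < L by rewrite lt_max ltr1n orbT.
have [Cp Cp0 Hp] := D_cond_doubling L1 Hpsi; have [psi0 psile _] := Hpsi.
exists ((Cl + (2 * Cf) `^ p) * Cp * 2 `^ p).
  by rewrite mulr_gt0 ?powR_gt0// mulr_gt0// addr_gt0// powR_gt0// mulr_gt0.
move=> f F c r s mof [mF val] r0 s0; have [mf _ _] := mof.
pose l := 2 * r; have l0 : 0 < l by rewrite mulr_gt0.
have [h /(L1_value_ext cz) eh aF] := val c l l0; have [_ mh _] := eh.
have l20 : 0 < 2 * l by rewrite mulr_gt0.
set w := wcube mu_ c l; set w2 := wcube mu_ c (2 * l).
have w0 : 0 < w by exact: wcube_gt0.
have w20 : 0 < w2 by exact: wcube_gt0.
set wb := fine (dens mu_ (eball c r)); set N := nrm f.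
have N0 : 0 <= N by exact: morrey_norm_ge0 mof.
have mB := measurable_eball c r.
have Bl : eball c r `<=` cube c l by exact: eball_cube.
have rn0 : 0 < r / n%:R by rewrite divr_gt0.
have wbE : dens mu_ (eball c r) = wb%:E.
  rewrite fineK// ge0_fin_numE//; apply: le_lt_trans (cube_fin mu_ c l wu).
  by apply: le_measure; rewrite ?inE//; exact: measurable_cube.
have cB : cube c (r / n%:R) `<=` eball c r.
  have := @cube_eball R n c _ n0 rn0; rewrite mulrCA divff ?mulr1// gt_eqF//.
have w2b : w2 <= L * wb.
  have E : 4 * n%:R * (r / n%:R) = 2 * l by rewrite /l; field; rewrite gt_eqF.
  have := Hd c c _ rn0; rewrite E => /(_ _) h1.
  apply: (@le_trans _ _ (Cd * wcube mu_ c (r / n%:R))).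
    apply: h1; apply: le_cube; rewrite -E ler_peMl ?(ltW rn0)//.
    by rewrite -natrM ler1n muln_gt0.
  have h2 : wcube mu_ c (r / n%:R) <= wb.
    rewrite -lee_fin -wbE -wcubeE//; apply: le_measure; rewrite ?inE//.
    exact: measurable_cube.
  apply: ler_pM => //; rewrite ?le_max ?lexx// ?(ltW Cd0)//.
  by apply: ltW; exact: wcube_gt0.
have wb0 : 0 < wb by move: (lt_le_trans w20 w2b); rewrite pmulr_rgt0// (lt_trans ltr01).
have psi2 : psi w2 <= Cp * psi wb by apply: (le_trans (psile _ _ w20 w2b)); exact: Hp.
have psi1 : psi w <= psi w2.
  apply: psile => //; apply: wcube_le => //; apply: le_cube; lra.
have s20 : 0 < s / 2 by rewrite divr_gt0.
pose S := eball c r `&` lvl s F.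
have mS : measurable S by apply: measurableI => //; exact: measurable_lvl.
have SE : (dens mu_ S <= ((Cl + (2 * Cf) `^ p) * (N `^ p * psi w2 / (s / 2) `^ p))%:E)%E.
  have q0 : 0 <= N `^ p * psi w2 / (s / 2) `^ p.
    by rewrite divr_ge0 ?mulr_ge0 ?powR_ge0// ltW// psi0.
  have [far|near] := leP (2 * (Cf * profile f c l)) (s / 2).
    apply: (@le_trans _ _ (dens mu_ (cube c l `&` lvl (s / 2) h))).
      apply: dens_ae_le => //.
        by apply: measurableI; [exact: measurable_cube|exact: measurable_lvl].
      apply: filterS aF => x aF [Bx sx]; have cx := Bl _ Bx; split=> //.
      have [_ Fx] := aF cx; move: sx; rewrite /lvl /= Fx => sx.
      have := cabsD (h x) (cintegral (~` cube c (2 * l)) (fun y => K x y * f y)).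
      have -> : cintegral (~` cube c (2 * l)) (fun y => K x y * f y) =
          cintegral setT (fun y => K x y * outer f c l y) by exact: cintegral_restr.
      have mK := measurable_outer mf l0 cx.
      have := cabs_cintegral measurableT mK (measurable_cabs mK) (fun y _ => lexx _)
        (Hf f c l x mof l0 cx).
      rewrite cintegral_restr in sx; move: sx far; rewrite -/(outer f c l).
      set z1 := cabs _; set z2 := cabs _; set z3 := cabs _; lra.
    apply: (le_trans (Hl f c l h _ mof l0 eh s20)); rewrite lee_fin.
    by apply: ler_wpM2r => //; rewrite lerDl powR_ge0.
  apply: (@le_trans _ _ w%:E).
    rewrite -wcubeE//; apply: le_measure; rewrite ?inE//; first exact: measurable_cube.
    by move=> x [/Bl].
  rewrite lee_fin.
  have h1 : (s / 2) `^ p <= (2 * Cf) `^ p * (N `^ p * (psi w / w)).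
    have pw : 0 <= psi w / w by rewrite divr_ge0 ?(ltW w0)// ltW// psi0.
    have P0 : 0 <= profile f c l by exact: (profile_ge0 mu_ _ _ mof).
    have c0 : 0 <= 2 * Cf by rewrite mulr_ge0// ltW.
    have PE : profile f c l `^ p = N `^ p * (psi w / w).
      rewrite (_ : profile f c l = N * (psi w / w) `^ p^-1)// (powRM _ N0) ?powR_ge0//.
      by rewrite -powRrM mulVf ?gt_eqF// powRr1.
    rewrite -PE -(powRM _ c0 P0) -mulrA; apply: ge0_ler_powR; rewrite ?nnegrE.
    - exact: ltW.
    - exact: ltW.
    - by rewrite mulrA mulr_ge0.
    - exact: ltW.
  have sp0 : 0 < (s / 2) `^ p by exact: powR_gt0.
  have h2 : w <= (2 * Cf) `^ p * (N `^ p * psi w / (s / 2) `^ p).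
    rewrite mulrA ler_pdivlMr// mulrC -ler_pdivlMr//; apply: (le_trans h1).
    by rewrite !mulrA.
  apply: (le_trans h2); apply: ler_pM; rewrite ?powR_ge0//.
  - by rewrite divr_ge0 ?mulr_ge0 ?powR_ge0// ltW// psi0.
  - by rewrite lerDr ltW.
  - by rewrite ler_pM2r ?invr_gt0//; apply: ler_wpM2l => //; exact: powR_ge0.
apply: (le_trans SE); rewrite lee_fin.
have K0 : 0 < Cl + (2 * Cf) `^ p by rewrite addr_gt0// powR_gt0// mulr_gt0.
rewrite -!mulrA; apply: ler_wpM2l; first exact: ltW.
rewrite powRM ?(ltW s0)// powRVl//.
have [sp tp] := (powR_gt0 p s0, powR_gt0 p (ltr0n R 2)).
have -> : Cp * (2 `^ p * (N `^ p * (psi wb * (s `^ p)^-1))) =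
    N `^ p * ((Cp * psi wb) / (s `^ p / 2 `^ p)) by field; rewrite !gt_eqF.
apply: ler_wpM2l; first exact: powR_ge0.
by rewrite ler_pM2r// invr_gt0 divr_gt0.
Qed.

End morrey_bounds.

(** * Existence of the value on a Morrey space *)

Section value_existence.
Context {R : realType} {n : nat}.
Local Notation Rn := 'rV[R]_n.
Local Notation mu := (lebesgue_rV R n).
Implicit Types (f g h F : Rn -> R[i]) (x y c : Rn) (S D : set Rn) (r s t l : R).

Lemma cube_exhaust c l : exists N0, forall N, (N0 <= N)%N -> cube c l `<=` cube 0 (2 ^+ N).
Proof.
pose B := \sum_(i < n) `|c ord0 i|; exists (Num.truncn (2 * B + l)).+1 => N NN x cx i.
have cB : `|c ord0 i| <= B by rewrite /B (bigD1 i)//= lerDl; apply: sumr_ge0.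
have h1 : 2 * B + l < N%:R :> R.
  by apply: lt_le_trans (truncnS_gt _) _; rewrite ler_nat.
have h2 : N%:R <= 2 ^+ N :> R by rewrite -natrX ler_nat ltnW// ltn_expl.
have := ler_normD (x ord0 i - c ord0 i) (c ord0 i); rewrite subrK mxE subr0.
have := cx i; move: (lt_le_trans h1 h2) cB; lra.
Qed.

Lemma limn_esup_approx (w : nat -> R) (z : R) :
  (forall e : R, 0 < e -> exists N0, forall N, (N0 <= N)%N -> `|w N - z| <= e) ->
  limn_esup (fun N => (w N)%:E) = z%:E.
Proof.
move=> H; suff cv : (fun N => (w N)%:E) @ \oo --> z%:E by rewrite (cvg_limn_einf_sup cv).2.
apply: cvg_EFin; first exact: nearW.
apply/cvgrPdist_le => e e0; have [N0 HN] := H e e0; exists N0 => // N /= NN.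
by rewrite distrC; exact: HN.
Qed.

Context {A CK Sth : R} {theta : R -> R} {T2 : (Rn -> R[i]) -> Rn -> R[i]}
  {K : Rn -> Rn -> R[i]}.
Hypothesis cz : cz_operator A CK Sth theta T2 K.

Local Notation C1 := (@C11 R n A CK Sth).

Context (f : Rn -> R[i]).
Hypotheses (mf : cmeasurable setT f) (fint : forall c l, 0 < l -> cint (restr (cube c l) f))
  (farint : forall c l x, 0 < l -> cube c l x ->
    (L1n setT (fun y => (K x y * outer f c l y)%R) < +oo)%E).

(** By locality H N - h is, on the cube, the kernel integral of the difference of the two
    truncations of [f]. It differs from the outer integral by a tail off the cube of side 2^N, which
    vanishes by absolute convergence. One null set serves all N. *)
Lemma approximation_tail c l h (H : nat -> Rn -> R[i]) : 0 < l ->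
  ext T2 (2 * C1) (restr (cube c (2 * l)) f) h ->
  (forall N, ext T2 (2 * C1) (restr (cube 0 (2 ^+ N)) f) (H N)) ->
  {ae mu, forall x, cube c l x -> forall e : R, 0 < e -> exists N0, forall N, (N0 <= N)%N ->
    cabs (H N x - (h x + cintegral setT (fun y => K x y * outer f c l y))) <= e}.
Proof.
move=> l0 eh eH; have C10 := C11_ge0 cz; have C20 : 0 <= 2 * C1 by exact: mulr_ge0.
have [N1 HN1] := cube_exhaust c (2 * l); have l2 : 0 < l / 2 by rewrite divr_gt0.
pose E N : set Rn := cube 0 (2 ^+ N); have mE N : measurable (E N) by exact: measurable_cube.
have mD : measurable (cube c (2 * l)) by exact: measurable_cube.
pose d N y := restr (E N) f y - restr (cube c (2 * l)) f y.
have dE N y : (N1 <= N)%N -> d N y = outer f c l y - restr (~` E N) (outer f c l) y.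
  move=> NN; rewrite /d /outer.
  have [cy|cy] := pselect (cube c (2 * l) y).
    have Ey := HN1 _ NN _ cy; rewrite restr_in// restr_in// subrr.
    by rewrite restr_out ?sub0r ?restr_out ?oppr0//= => /(_ Ey).
  rewrite [X in _ - X]restr_out// subr0 [restr (~` cube _ _) _ _]restr_in//.
  have [Ey|Ey] := pselect (E N y); first by rewrite restr_in// restr_out ?subr0//= => /(_ Ey).
  by rewrite restr_out// restr_in// restr_in// subrr.
have md N : cmeasurable setT (d N) by apply: cmeasurableB; exact: cmeasurable_restr.
have loc N : {ae mu, forall x, cube c l x -> (N1 <= N)%N ->
    H N x - h x = cintegral setT (fun y => K x y * d N y)}.
  have [NN|_] := leqP N1 N; last exact: aeW.
  have := ext_locality cz (mulr_ge0 (ler0n _ 4) C20) (ext_sub cz C20 (eH N) eh) l2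
    (S := cube c l) _.
  move=> H'; suff : {ae mu, forall x, cube c l x ->
    H N x - h x = cintegral setT (fun y => K x y * d N y)}.
    by apply: filterS => x Hx cx _; exact: Hx.
  apply: H' => x y cx dy; apply: (@outer_far _ _ f c) => //.
  apply: contra dy => /eqP o0; rewrite -/(d N y) dE// o0 sub0r oppr_eq0.
  by rewrite /restr o0 mul0r.
have := ae_foralln loc; apply: filterS => x Hx cx e e0.
have mK := measurable_outer cz mf l0 cx.
have fi := farint l0 cx.
have ndE : nondecreasing_seq E.
  move=> i j ij; apply/subsetPset; apply: le_cube.
  by rewrite ler_weXn2l// ler1n.
have UE : \bigcup_k E k = setT.
  apply/seteqP; split => // y _; have [N HN] := cube_exhaust y 1.
  by exists N => //; apply: (HN N) => // i; rewrite subrr normr0.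
have e2 : 0 < e / 2 by rewrite divr_gt0.
have [N2 HN2] := tail_small (measurable_cabs mK) (fun y => cabs_ge0 _) fi mE ndE UE e2.
exists (maxn N1 N2) => N; rewrite geq_max => /andP[NN1 NN2].
have := HN2 N NN2; set k := fun y => K x y * outer f c l y in mK fi *.
have ik : cintegrable setT k by exact: cintegrable_L1n.
have kd y : K x y * d N y = k y - restr (~` E N) k y.
  by rewrite dE// mulrBr; congr (_ - _); exact: mulrA.
have mkN : cmeasurable setT (restr (~` E N) k) by apply: cmeasurable_restr => //; exact: measurableC.
have ikN : cintegrable setT (restr (~` E N) k).
  apply: cintegrable_L1n => //; rewrite L1n_restr; last exact: measurableC.
  by apply: le_lt_trans fi; apply: L1n_sub => //; exact: measurableC.
have I : H N x - (h x + cintegral setT k) = - cintegral setT (restr (~` E N) k).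
  rewrite opprD addrA Hx// (@eq_cintegral _ _ _ _ (fun y => -1 * restr (~` E N) k y + k y)).
    by rewrite cintegral_lin// mulN1r addrK.
  by move=> y _; rewrite kd mulN1r addrC.
rewrite I cabsN => tail.
have -> : e = 2 * (e / 2) by field.
apply: (@cabs_cintegral _ _ _ _ (fun y => cabs (restr (~` E N) k y))) => //.
  exact: measurable_cabs.
by rewrite -/(L1n setT _) L1n_restr//; exact: measurableC.
Qed.

(** The upper limit of the values at the truncations to growing cubes exists everywhere and is
    measurable. It is defined without reference to a cube, so the same function satisfies the
    formula on every cube. *)
Lemma value_exists : exists F, is_value T2 K f F.
Proof.
have C10 := C11_ge0 cz; have C20 : 0 <= 2 * C1 by exact: mulr_ge0.
have [H eH] := choice (fun N => ext_exists cz (fint 0 (exprn_gt0 N (ltr0n R 2)))).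
have mH N : cmeasurable setT (H N) by have [] := eH N.
pose lim_ (w : R[i] -> R) x := fine (limn_esup (fun N => (w (H N x))%:E)).
have mlim (w : R[i] -> R) : (forall N, measurable_fun setT (fun x => w (H N x))) ->
    measurable_fun setT (lim_ w).
  move=> mw; apply: (@measurableT_comp _ _ _ _ _ _ fine); first exact: fine_measurable.
  by apply: measurable_fun_limn_esup => N; exact/measurable_EFinP.
pose F x := Complex (lim_ (@complex.Re R) x) (lim_ (@complex.Im R) x).
exists F; split.
  by split; apply: mlim => N; have [] := mH N.
move=> c l l0; have l20 : 0 < 2 * l by rewrite mulr_gt0.
have [h eh] := ext_exists cz (fint c l20); exists h; first exact: ext_L1_value C20 eh.
apply: filterS (approximation_tail l0 eh eH) => x Hx cx.
have mK := measurable_outer cz mf l0 cx.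
split.
  apply: cintegrable_restr; first by apply: measurableC; exact: measurable_cube.
  by apply: cintegrable_L1n => //; exact: farint.
rewrite cintegral_restr -/(outer f c l).
set z := h x + _ in Hx *; have {}Hx := Hx cx.
have E (w : R[i] -> R) : (forall z, `|w z| <= cabs z) -> {morph w : z z' / z - z'} ->
    lim_ w x = w z.
  move=> wc wB; rewrite /lim_ (@limn_esup_approx _ (w z))// => e e0.
  have [N0 HN] := Hx e e0; exists N0 => N NN; rewrite -wB; exact: le_trans (wc _) (HN N NN).
have reB : {morph (@complex.Re R) : z z' / z - z'} by case=> ? ? [? ?].
have imB : {morph (@complex.Im R) : z z' / z - z'} by case=> ? ? [? ?].
rewrite /F (E _ (@Re_le_cabs R) reB) (E _ (@Im_le_cabs R) imB).
by case: (z).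
Qed.

End value_existence.

(** The existence of a value is part of the conclusion, so that the norm inequality is not vacuous;
    the inequality holds for every value, these being determined only up to null sets. *)
Theorem theorem5p2 (R : realType) (n : nat) (p : R) (u v : 'rV[R]_n -> R)
    (kappa : R) (psi theta : R -> R)
    (T : ('rV[R]_n -> R[i]) -> ('rV[R]_n -> R[i]) -> R[i])
    (T2 : ('rV[R]_n -> R[i]) -> 'rV[R]_n -> R[i])
    (K : 'rV[R]_n -> 'rV[R]_n -> R[i]) :
  (0 < n)%N -> 1 < p -> weight u -> weight v -> A_infty u ->
  (exists2 r : R, 1 < r & exists C0 : R,
    forall (c : 'rV[R]_n) (l : R), 0 < l ->
      (average (cube c l) (fun x => (u x `^ r)%R) `^ (r * p)^-1 *
       average (cube c l) (fun x => (v x `^ (- (conj_exponent p / p)))%R)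
         `^ (conj_exponent p)^-1 <= C0%:E)%E) ->
  0 <= kappa -> kappa < 1 -> D_cond kappa psi ->
  dini theta -> theta_CZO theta T T2 K ->
  exists2 C : R, 0 < C & forall f, morrey p psi v u f ->
    (exists F, is_value T2 K f F) /\
    (forall F, is_value T2 K f F ->
       (wmorrey_norm p psi u F <= C%:E * morrey_norm p psi v u f)%E).
Proof.
move=> n0 p1 wu wv Au [r r1 [C0 bump]] k0 k1 Hpsi dth Tth.
have [A [CK [Sth cz]]] := theta_CZO_operator n0 dth Tth.
have [mu_ _ u0] := wu; have p0 : 0 < p by rewrite (lt_trans ltr01).
have [Cb Cb0 H] := bump_estimate mu_ n0 p1 r1 wu wv bump.
have H2 : two_weight p mu_ v Cb by exact: H.
have [C Cpos Hw] := value_weak cz p1 wu wv Au Cb0 H2 k1 Hpsi.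
have [Cf _ Hf] := far_bound cz p1 wu wv Au Cb0 H2 k1 Hpsi.
have [psi0 _ _] := Hpsi.
exists (C `^ p^-1); first exact: powR_gt0.
move=> f mof; have [mf _ fin] := mof; split.
  apply: (value_exists cz mf) => [c l l0|c l x l0 cx].
    exact: (morrey_cint p1 wu wv H2 Hpsi c mof l0).
  by apply: le_lt_trans (Hf f c l x mof l0 cx) _; exact: ltry.
move=> F val; have N0 := morrey_norm_ge0 mof.
have NE : morrey_norm p psi v u f = (fine (morrey_norm p psi v u f))%:E.
  rewrite fineK// ge0_fin_numE//; apply: le_trans (ereal_sup_ubound _); last first.
    by exists 0, 1; split.
  exact: poweR_ge0.
rewrite NE; set N := fine _ in N0 *.
apply: ub_ereal_sup => _ [c [t [s [t0 s0 ->]]]].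
have [mF _] := val; have mB := measurable_eball c t.
have mS : measurable (eball c t `&` lvl s F) by apply: measurableI => //; exact: measurable_lvl.
rewrite /wmeas (wmeasE mu_ u0 mB) (wmeasE mu_ u0 mS).
have := Hw f F c t s mof val t0 s0; set P := psi _; set X := dens mu_ (_ `&` _) => XP.
(* Each ball has radius n l for l = t/n, so [eball_facts] applies and its weight is positive, where
   psi is positive. *)
have P0 : 0 < P.
  have n1 : 0 < n%:R :> R by rewrite ltr0n.
  have [m [U [_ _ U0 _]]] := eball_facts mu_ c n0 wu (divr_gt0 t0 n1).
  by rewrite mulrCA divff ?gt_eqF// mulr1 => dB; apply: psi0; rewrite dB.
have X0 : (0 <= X)%E by exact: measure_ge0.
have [x x0 XE] : exists2 x : R, 0 <= x & X = x%:E.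
  by move: X0 XP; case: X => // x; exists x.
rewrite XE poweR_EFin -!EFinM lee_fin; rewrite XE lee_fin in XP.
have ip0 : 0 <= p^-1 by rewrite invr_ge0 ltW.
have sp : 0 < s `^ p by exact: powR_gt0.
have y0 : 0 <= N `^ p * P / s `^ p by rewrite divr_ge0 ?mulr_ge0 ?powR_ge0// ltW.
(* Taking p-th roots in [value_weak] yields the constant C^(1/p) and the norm inequality for this
   ball and level. *)
have := ge0_ler_powR ip0 x0 (mulr_ge0 (ltW Cpos) y0) XP.
have root (z : R) : 0 <= z -> (z `^ p) `^ p^-1 = z.
  by move=> z0; rewrite -powRrM divff ?gt_eqF// powRr1.
rewrite (powRM _ (ltW Cpos) y0) powRM ?mulr_ge0 ?invr_ge0 ?powR_ge0 ?(ltW P0)//.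
rewrite powRM ?powR_ge0 ?(ltW P0)// powRVl ?powR_ge0// !root ?(ltW s0)// => h.
have Pp : 0 < P `^ p^-1 by exact: powR_gt0.
rewrite [_ * s * _]mulrC -ler_pdivlMr ?mulr_gt0 ?invr_gt0//.
apply: (le_trans h); rewrite le_eqVlt; apply/orP; left; apply/eqP.
by field; rewrite !gt_eqF.
Qed.
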